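(* Let $Z_0=(Z_1,\ldots,Z_\upsilon)$ have an $\mathrm{IBP}(A_0,\rho_qB_0)$ distribution, where it is assumed that $\rho_q$ is homogeneous. If $$\varphi:=\varphi(\rho_q|\pi_{A_0})=\int_{\mathbb{R}_+^q}\pi_{A_0}(\mathbf{s}_q)\rho_q(d\mathbf{s}_q)<\infty,$$ then, jointly for $j=1,\ldots,\upsilon$, $$Z_j\overset{d}{=}\sum_{k=1}^{\xi(\varphi)}X_{j,k}\,\delta_{\tilde\omega_k},$$ where the vectors $X_{0,k}=(X_{1,k},\ldots,X_{\upsilon,k})$ are iid across $k$ and independent of $\xi(\varphi)$, a Poisson random variable with mean $\varphi$, and the $\tilde\omega_k$ are iid with distribution $B_0$, independent of $\xi(\varphi)$ and $(X_{0,k})$. Furthermore, setting $H_{0,k}=(H_{1,k},\ldots,H_{q,k})$, there are iid pairs $((H_{0,k},X_{0,k}))$ with distributions $$\mathbb{P}(X_{0,k}\in d\mathbf{a}_0\mid H_{0,k}=\mathbf{s}_q)=\frac{\mathbb{I}_{\{\mathbf{a}_0\neq\mathbf{0}\}}G_{A_0}(d\mathbf{a}_0|\mathbf{s}_q)}{\pi_{A_0}(\mathbf{s}_q)}$$ and $$\mathbb{P}(H_{0,k}\in d\mathbf{s}_q)=\frac{\pi_{A_0}(\mathbf{s}_q)\rho_q(d\mathbf{s}_q)}{\varphi(\rho_q|\pi_{A_0})}.$$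
   Context: **Setting.** $\Omega$ is a Polish space with a probability measure $B_0$. $q,\upsilon$ are positive integers, not necessarily equal. $\rho_q(d\mathbf{s}_q)$ is a homogeneous (i.e. not depending on $\omega\in\Omega$) sigma-finite Lévy measure concentrated on $\mathbb{R}_+^q\setminus\{\mathbf{0}\}$ with $\int\min(s_\cdot,1)\rho_q(d\mathbf{s}_q)<\infty$, where $s_\cdot=\sum_{j=1}^qs_j$. **Multivariate IBP.** $A_0=(A_1,\ldots,A_\upsilon)$ is a random vector with values in $\mathcal{A}\subseteq\mathbb{R}^\upsilon$ and conditional distribution $G_{A_0}(\cdot|\mathbf{s}_q)$ (a probability kernel), $\mathbf{s}_q\in\mathbb{R}_+^q$, such that $1-\pi_{A_0}(\mathbf{s}_q):=\mathbb{P}(A_1=0,\ldots,A_\upsilon=0|\mathbf{s}_q)>0$. Let $N=\sum_k\delta_{(\mathbf{s}_{q,k},\tilde\omega_k)}$ be a Poisson random measure on $\mathbb{R}_+^q\times\Omega$ with intensity $\rho_q(d\mathbf{s}_q)B_0(d\omega)$. $Z_0=(Z_1,\ldots,Z_\upsilon)$ has an $\mathrm{IBP}(A_0,\rho_qB_0)$ distribution if it has the marginal (unconditional) law of the vector of random measures $Z_j=\sum_kA_{j,k}\delta_{\tilde\omega_k}$, $j=1,\ldots,\upsilon$, where conditionally on $N$ the vectors $(A_{1,k},\ldots,A_{\upsilon,k})$ are independent over $k$ with distribution $G_{A_0}(\cdot|\mathbf{s}_{q,k})$. **Convention.** It is understood that $\varphi>0$, so that the normalised law of $H_{0,k}$ makes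 sense. *)

(* Defs.v *)
From HB Require Import structures.
From mathcomp Require Import all_boot all_order all_algebra.
From mathcomp Require Import all_classical all_reals all_analysis.
From mathcomp Require Import measurable_realfun.

Set Implicit Arguments.
Unset Strict Implicit.
Unset Printing Implicit Defensive.

Import Order.TTheory GRing.Theory Num.Theory.
Import numFieldNormedType.Exports.

Local Open Scope classical_set_scope.
Local Open Scope ring_scope.
Local Open Scope ereal_scope.

Definition completely_metrizable (R : realType) (T : topologicalType) : Prop :=
  exists dist : T -> T -> R,
    [/\ forall x y, dist x y = 0%R <-> x = y,
        forall x y, dist x y = dist y x,
        forall x y z, (dist x z <= dist x y + dist y z)%R,
        forall (x : T) (A : set T),
          nbhs x A <-> exists2 e : R, (0 < e)%R & [set y | (dist x y < e)%R] `<=` A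
      & forall u : nat -> T,
          (forall e : R, (0 < e)%R ->
             exists N : nat, forall m n : nat,
               (N <= m)%N -> (N <= n)%N -> (dist (u m) (u n) < e)%R) ->
          exists l : T, u @ \oo --> l].

Definition polish (R : realType) (T : topologicalType) : Prop :=
  (exists2 D : set T, countable D & dense D) /\ completely_metrizable R T.

Notation borel T := (g_sigma_algebraType (@open T)).

(* R^n with its Borel sigma-algebra, i.e. the product sigma-algebra *)
Notation "''R[' R ]^ n" := (n.-tuple (measurableTypeR R))
  (at level 8, n at level 2, format "''R[' R ]^ n").

Definition zerov (R : realType) (n : nat) : 'R[R]^n := [tuple 0%R | _ < n].

Definition orthant (R : realType) (n : nat) : set 'R[R]^n :=
  [set s | forall i : 'I_n, (0 <= tnth s i)%R].
Arguments orthant : clear implicits.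

Definition mutually_independent (R : realType) (d : measure_display)
    (T : measurableType d) (P : probability T R) (I : eqType)
    (F : I -> set (set T)) : Prop :=
  forall (J : seq I) (E : I -> set T), uniq J -> (forall i, F i (E i)) ->
    P (\big[setI/setT]_(i <- J) E i) = \prod_(i <- J) P (E i).

Section RandomMeasures.
Context (R : realType) (d : measure_display) (T : measurableType d)
  (P : probability T R) (d' : measure_display) (X : measurableType d').

(* A possibly signed random measure: measurable evaluations, and almost surely
   a sigma-additive set function. *)
Definition random_measure (M : T -> set X -> \bar R) : Prop :=
  (forall B, measurable B -> measurable_fun setT (M ^~ B)) /\
  {ae P, forall t, M t set0 = 0 /\ semi_sigma_additive (M t)}.

(* The second argument of [poisson_prob] is ignored by its definition, and
   [poisson_prob 0 _] is the Dirac mass at 0. *)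
Definition poisson_random_measure (mu : {measure set X -> \bar R})
    (N : T -> set X -> \bar R) : Prop :=
  [/\ random_measure N,
      forall B, measurable B -> mu B < +oo -> forall n : nat,
        P [set t | N t B = n%:R%:E] = poisson_prob (fine (mu B)) 0%N [set n],
      forall B, measurable B -> mu B = +oo -> P [set t | N t B = +oo] = 1
    & forall B : nat -> set X, (forall n, measurable (B n)) ->
        trivIset setT B ->
        mutually_independent P (fun n => g_sigma_algebra_preimage (fun t => N t (B n)))].

End RandomMeasures.

(* The sigma-algebra on vectors (indexed by J) of set functions generated by
   the evaluations m |-> m j B with B measurable. *)
Definition evaluation_algebra (R : realType) (J : Type) (d' : measure_display)
    (X : measurableType d') : set (set (J -> set X -> \bar R)) :=
  <<s [set D | exists (j : J) (B : set X) (C : set (\bar R)),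
         [/\ measurable B, measurable C & D = [set m | C (m j B)]]] >>.

Definition same_law (R : realType) (J : Type) (d' : measure_display)
    (X : measurableType d')
    (d1 : measure_display) (T1 : measurableType d1) (P1 : probability T1 R)
    (M1 : T1 -> J -> set X -> \bar R)
    (d2 : measure_display) (T2 : measurableType d2) (P2 : probability T2 R)
    (M2 : T2 -> J -> set X -> \bar R) : Prop :=
  forall D, @evaluation_algebra R J d' X D ->
    P1 (M1 @^-1` D) = P2 (M2 @^-1` D).

(* A point process with finitely or infinitely many atoms is an infinite
   sequence of points together with events: the k-th atom exists on E k. *)
Definition atom_measure (R : realType) (T : Type) (d' : measure_display)
    (X : measurableType d') (E : nat -> set T) (x : nat -> T -> X)
    (t : T) (B : set X) : \bar R :=
  \sum_(k <oo | t \in E k) \d_(x k t) B.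
Arguments atom_measure : clear implicits.

(* The information in the enumerated atoms; the value of x k is visible only
   where the k-th atom exists. *)
Definition atom_algebra (T : Type) (d' : measure_display)
    (X : measurableType d') (E : nat -> set T) (x : nat -> T -> X) :
    set (set T) :=
  <<s [set F | exists (k : nat) (D : set X),
         measurable D /\ F = E k `&` x k @^-1` D] >>.

Section IBP.
Context (R : realType) (q upsilon : nat) (d : measure_display)
  (Omega : measurableType d) (G : R.-pker 'R[R]^q ~> 'R[R]^upsilon)
  (rho : {sigma_finite_measure set 'R[R]^q -> \bar R})
  (B0 : probability Omega R).

(* Z_j = \sum_k A_{j,k} delta_{w_k} over the existing atoms; an unordered sum
   of signed terms, hence written through positive and negative parts. *)
Definition weighted_atoms (T : Type) (E : nat -> set T)
    (w : nat -> T -> Omega) (A : nat -> T -> 'R[R]^upsilon)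
    (t : T) (j : 'I_upsilon) (B : set Omega) : \bar R :=
  \sum_(k <oo | t \in E k) ((Num.max (tnth (A k t) j) 0%R)%:E * \d_(w k t) B) -
  \sum_(k <oo | t \in E k) ((Num.max (- tnth (A k t) j)%R 0%R)%:E * \d_(w k t) B).

(* Given the atoms, the marks A k of the existing atoms are independent with
   respective distributions G (s k). *)
Definition conditionally_marked (dT : measure_display) (T : measurableType dT)
    (P : probability T R) (E : nat -> set T) (s : nat -> T -> 'R[R]^q)
    (w : nat -> T -> Omega) (A : nat -> T -> 'R[R]^upsilon) : Prop :=
  forall (J : seq nat) (C : nat -> set 'R[R]^upsilon) (F : set T),
    uniq J -> (forall k, measurable (C k)) ->
    atom_algebra E (fun k t => (s k t, w k t)) F ->
    (forall k, k \in J -> F `<=` E k) ->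
    P (F `&` \big[setI/setT]_(k <- J) (A k @^-1` C k)) =
    \int[P]_(t in F) \prod_(k <- J) G (s k t) (C k).

Definition is_IBP (dT : measure_display) (T : measurableType dT)
    (P : probability T R) (Z : T -> 'I_upsilon -> set Omega -> \bar R) : Prop :=
  (forall j, random_measure P (fun t => Z t j)) /\
  exists (d1 : measure_display) (T1 : measurableType d1)
    (P1 : probability T1 R) (E : nat -> set T1)
    (s : nat -> {mfun T1 >-> 'R[R]^q}) (w : nat -> {mfun T1 >-> Omega})
    (A : nat -> {mfun T1 >-> 'R[R]^upsilon}),
    [/\ forall k, measurable (E k),
        poisson_random_measure P1 (rho \x B0)
          (atom_measure R T1 _ _ E (fun k t => (s k t, w k t))),
        conditionally_marked P1 E s w A
      & same_law P Z P1 (weighted_atoms E w A)].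

Definition pi_A (s : 'R[R]^q) : R := (1 - fine (G s [set zerov R upsilon]))%R.

Definition varphi : \bar R := \int[rho]_(s in orthant R q) (pi_A s)%:E.

(* The law of X given H = s is  I{a <> 0} G(da | s) / pi_A(s). *)
Definition is_jump_pair (dT : measure_display) (T : measurableType dT)
    (P : probability T R) (H : {mfun T >-> 'R[R]^q})
    (X : {mfun T >-> 'R[R]^upsilon}) : Prop :=
  (forall D, measurable D ->
     distribution P H D =
     \int[rho]_(s in D `&` orthant R q)
        ((pi_A s)%:E * ((fine (varphi))^-1)%:E)) /\
  (forall D C, measurable D -> measurable C ->
     P (H @^-1` D `&` X @^-1` C) =
     \int[distribution P H]_(s in D)
        (G s (C `\` [set zerov R upsilon]) * ((pi_A s)^-1)%:E)).

Definition compound_algebras (dT dY : measure_display) (T : measurableType dT)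
    (Y : measurableType dY) (xi : T -> nat) (y : nat -> T -> Y)
    (w : nat -> T -> Omega) (i : option (nat + nat)) : set (set T) :=
  match i with
  | None => g_sigma_algebra_preimage xi
  | Some (inl k) => g_sigma_algebra_preimage (y k)
  | Some (inr k) => g_sigma_algebra_preimage (w k)
  end.

Definition compound_data (dT : measure_display) (T : measurableType dT)
    (P : probability T R) (xi : {mfun T >-> nat})
    (H : nat -> {mfun T >-> 'R[R]^q}) (X : nat -> {mfun T >-> 'R[R]^upsilon})
    (w : nat -> {mfun T >-> Omega}) : Prop :=
  [/\ forall U, distribution P xi U = poisson_prob (fine (varphi)) 0%N U,
      forall k, is_jump_pair P (H k) (X k),
      mutually_independent P
        (fun k => g_sigma_algebra_preimage (fun t => (H k t, X k t))),
      forall k B, measurable B -> distribution P (w k) B = B0 B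
    & mutually_independent P (compound_algebras xi X w)].

Definition compound_sum (T : Type) (xi : T -> nat)
    (X : nat -> T -> 'R[R]^upsilon) (w : nat -> T -> Omega)
    (t : T) (j : 'I_upsilon) (B : set Omega) : \bar R :=
  \sum_(k < xi t) ((tnth (X k t) j)%:E * \d_(w k t) B).

End IBP.

(* Main.v *)
(* Laplace functionals identify the two random vectors. For f >= 0 on pairs
   (a, o) with f (0, o) = 0, integrating out the marks and then using the
   Laplace functional of a Poisson random measure gives
     E exp(- sum_k f(A_k, w_k)) =
       exp(- int int int (1 - exp(- f(a, o))) G(da | s) rho(ds) B0(do)).
   Since f ignores null jumps, the inner integral only charges a <> 0, and the
   right-hand side is exp(- varphi (1 - E exp(- f(X, w)))), which is the value
   for the compound sum, by the Poisson generating function. Applied to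
   f = sum_i theta_i 1_(C_i x B_i) with 0 not in C_i, the equality of Laplace
   transforms yields the joint law of the numbers of atoms in the C_i x B_i.
   The weighted sums Z_j are limits of fixed measurable functions of countably
   many of these counts, so their laws agree as well.
   For existence, the iid variables are functions of the coordinates of an
   infinite product of copies of one probability space; that product measure is
   extended from cylinders, sigma-additivity being obtained by choosing the
   coordinates of a common point of decreasing heavy cylinders one by one. *)

Require Import Defs.
From HB Require Import structures.
From mathcomp Require Import all_boot all_order all_algebra.
From mathcomp Require Import all_classical all_reals all_analysis.
From mathcomp Require Import measurable_realfun ring lra.

Set Implicit Arguments.
Unset Strict Implicit.
Unset Printing Implicit Defensive.

Import Order.TTheory GRing.Theory Num.Theory.
Import numFieldNormedType.Exports.

Local Open Scope classical_set_scope.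
Local Open Scope ring_scope.
Local Open Scope ereal_scope.

(** * Mixtures and product kernels *)

(** A weight [g] with values in [[0, 1]] recurs throughout. Independence and conditional marking are
    given for products of indicators, whereas Laplace functionals need products of functions; the
    passage is made one factor at a time, the other factors being absorbed into the weight. The same
    device reduces joint laws of counts to the law of a single count. Two obstacles shape the rest.
    Marks are described only on events where the atoms concerned exist, while a sum over atoms has a
    random set of indices; events are therefore split according to the existence of each atom in
    turn. And the masses are signed while Laplace functionals take [f >= 0]: positive and negative
    parts of the jumps are approximated from below by simple functions, whose nonzero level sets
    avoid the null jump. Counts may be infinite, so [+oo] is kept as one more value; it is invisible
    to [exp(- theta N)] for [theta > 0] and is recovered from the total mass at [theta = 0]. *)

Section ge0_measurable_ind.
Context d (T : measurableType d) (R : realType).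
Import HBNNSimple.

Lemma ge0_measurable_ind (Q : (T -> \bar R) -> Prop) :
  (forall A, measurable A -> Q (EFin \o \1_A)) ->
  (forall (c : R) f, (0 <= c)%R -> measurable_fun setT f ->
     (forall x, 0 <= f x) -> Q f -> Q (fun x => c%:E * f x)) ->
  (forall f g, measurable_fun setT f -> (forall x, 0 <= f x) ->
     measurable_fun setT g -> (forall x, 0 <= g x) ->
     Q f -> Q g -> Q (f \+ g)) ->
  (forall u : nat -> T -> \bar R, (forall n, measurable_fun setT (u n)) ->
     (forall n x, 0 <= u n x) -> (forall x, nondecreasing_seq (u^~ x)) ->
     (forall n, Q (u n)) -> Q (fun x => limn (u ^~ x))) ->
  forall f, measurable_fun setT f -> (forall x, 0 <= f x) -> Q f.
Proof.
move=> Qind QZ QD Qlim f mf f0.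
pose u := nnsfun_approx measurableT mf.
have -> : f = (fun x => limn (fun n => (u n x)%:E)).
  by apply/funext => x; apply/esym/cvg_lim => //; exact: cvg_nnsfun_approx.
apply: (Qlim (fun n x => (u n x)%:E)) => [n|n x|x m n mn|n].
- exact/measurable_EFinP.
- by rewrite lee_fin.
- by rewrite lee_fin; exact/lefP/nd_nnsfun_approx.
have -> : (fun x => (u n x)%:E) =
    (fun x => \sum_(r <- finmap.enum_fset (fset_set (range (u n))))
       (r%:E * (\1_(u n @^-1` [set r]) x)%:E)).
  apply/funext => x; rewrite fimfunE fsbig_finite//= -sumEFin.
  by apply: eq_bigr => r _; rewrite EFinM.
have : {in finmap.enum_fset (fset_set (range (u n))), forall r : R, (0 <= r)%R}.
  by move=> r; rewrite in_fset_set// inE => -[x _ <-].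
have mind r : measurable_fun setT (EFin \o \1_(u n @^-1` [set r]) : T -> \bar R).
  by apply/measurable_EFinP; exact: measurable_indic.
elim: (finmap.enum_fset _) => [|r s ih] s0.
  under eq_fun do rewrite big_nil.
  have := Qind _ (@measurable0 _ T).
  by congr Q; apply/funext => x /=; rewrite indic0.
have s0' : {in s, forall r : R, (0 <= r)%R}.
  by move=> x xs; apply: s0; rewrite inE xs orbT.
have r0 : (0 <= r)%R by apply: s0; rewrite inE eqxx.
under eq_fun do rewrite big_cons.
apply: (QD (fun x => r%:E * (\1_(u n @^-1` [set r]) x)%:E)).
- exact: measurable_funeM (mind r).
- by move=> x; rewrite mule_ge0//= lee_fin.
- by apply: emeasurable_sum => i; exact: measurable_funeM (mind i).
- move=> x; rewrite big_seq; apply: sume_ge0 => i /s0' i0.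
  by rewrite mule_ge0//= lee_fin.
- apply: (QZ r (EFin \o \1_(u n @^-1` [set r])) r0 (mind r)).
    by move=> x; rewrite /= lee_fin.
  exact: Qind.
- exact: ih.
Qed.

End ge0_measurable_ind.

Section mixture.
Context d d' (T : measurableType d) (Y : measurableType d') (R : realType).
Variables (mu : {measure set T -> \bar R}) (g : T -> \bar R)
  (K : T -> {measure set Y -> \bar R}).

(** The proofs are carried as arguments so that the term by itself determines its measure
    structure. *)
Definition mixture (mg : measurable_fun setT g) (g01 : forall t, 0 <= g t <= 1)
  (mK : forall S, measurable S -> measurable_fun setT (K ^~ S)) (S : set Y) :=
  \int[mu]_t (g t * K t S).

Hypotheses (mg : measurable_fun setT g) (g01 : forall t, 0 <= g t <= 1)
  (mK : forall S, measurable S -> measurable_fun setT (K ^~ S)).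

Local Notation mix := (mixture mg g01 mK).

Let g0 t : 0 <= g t. Proof. by have /andP[] := g01 t. Qed.

Let gfin t : g t \is a fin_num.
Proof.
by have /andP[? g1] := g01 t; rewrite ge0_fin_numE// (le_lt_trans g1) ?ltry.
Qed.

Let mix0 : mix set0 = 0.
Proof. by apply: integral0_eq => t _; rewrite measure0 mule0. Qed.

Let mix_ge0 S : 0 <= mix S.
Proof. by apply: integral_ge0 => t _; rewrite mule_ge0. Qed.

Let mix_sigma_additive : semi_sigma_additive mix.
Proof.
move=> U mU tU mUU; rewrite [X in _ --> X](_ : _ =
  \int[mu]_t (\sum_(n <oo) g t * K t (U n))); last first.
  apply: eq_integral => t _; rewrite -[g t]fineK// nneseriesZl//; congr (_ * _).
  by apply/esym/cvg_lim => //; exact: measure_semi_sigma_additive.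
apply/cvg_closeP; split.
  by apply: is_cvg_nneseries => n _ _; exact: mix_ge0.
rewrite closeE// integral_nneseries//.
- by move=> n; apply: emeasurable_funM => //; exact: mK.
- by move=> n t _; rewrite mule_ge0.
Qed.

HB.instance Definition _ := isMeasure.Build _ _ _ mix
  mix0 mix_ge0 mix_sigma_additive.

(** Both sides are linear and continuous along monotone sequences, so indicators suffice. It is
    stated for every [m] that agrees with the mixture on measurable sets, so that it also applies to
    laws known only through such a formula. *)
Lemma integral_mixture (m : {measure set Y -> \bar R}) (f : Y -> \bar R) :
  (forall S, measurable S -> m S = \int[mu]_t (g t * K t S)) ->
  measurable_fun setT f -> (forall y, 0 <= f y) ->
  \int[m]_y f y = \int[mu]_t (g t * \int[K t]_y f y).
Proof.
move=> mE; move: f.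
have mgint f : measurable_fun setT f -> (forall y, 0 <= f y) ->
    measurable_fun setT (fun t => g t * \int[K t]_y f y).
  move=> mf f0; apply: emeasurable_funM => //.
  exact: measurable_fun_integral_kernel.
apply: ge0_measurable_ind => [A mA|c f c0 mf f0 ih|f h mf f0 mh h0 ihf ihh|u mu' u0 ndu ih].
- rewrite integral_indic// setIT mE//.
  by apply: eq_integral => t _; rewrite integral_indic// setIT.
- have c0' : 0 <= c%:E by rewrite lee_fin.
  rewrite (ge0_integralZl m measurableT mf (fun y _ => f0 y) c0') ih.
  have gf0 t : setT t -> 0 <= g t * \int[K t]_y f y.
    by move=> _; rewrite mule_ge0// integral_ge0.
  rewrite -(ge0_integralZl mu measurableT (mgint _ mf f0) gf0 c0').
  apply: eq_integral => t _.
  by rewrite (ge0_integralZl (K t) measurableT mf (fun y _ => f0 y) c0') muleCA.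
- rewrite (ge0_integralD m measurableT (fun y _ => f0 y) mf (fun y _ => h0 y) mh).
  rewrite ihf ihh -(ge0_integralD mu measurableT _ (mgint _ mf f0) _ (mgint _ mh h0)).
  + apply: eq_integral => t _.
    rewrite (ge0_integralD (K t) measurableT (fun y _ => f0 y) mf (fun y _ => h0 y) mh).
    by apply/esym/ge0_muleDr; exact: integral_ge0.
  + by move=> t _; rewrite mule_ge0// integral_ge0.
  + by move=> t _; rewrite mule_ge0// integral_ge0.
- have ndint t : nondecreasing_seq (fun n => \int[K t]_y u n y).
    by move=> n k nk; apply: ge0_le_integral => // y _; exact: ndu.
  rewrite monotone_convergence//.
  under eq_fun do rewrite ih.
  rewrite -monotone_convergence//.
  + apply: eq_integral => t _.
    rewrite monotone_convergence//.
    by rewrite limeMl//; exact: ereal_nondecreasing_is_cvgn.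
  + by move=> n; exact: mgint.
  + by move=> n t _; rewrite mule_ge0// integral_ge0.
  + by move=> t _ n k nk; rewrite lee_wpmul2l//; exact: ndint.
Qed.

End mixture.

Section unit_interval.
Context {R : realType}.
Implicit Types x y : \bar R.

Lemma mule01 x y : 0 <= x <= 1 -> 0 <= y <= 1 -> 0 <= x * y <= 1.
Proof.
move=> /andP[x0 x1] /andP[y0 y1]; rewrite mule_ge0//=.
by rewrite -[leRHS]mule1 lee_pmul.
Qed.

Lemma prode01 (I : Type) (s : seq I) (f : I -> \bar R) :
  (forall i, 0 <= f i <= 1) -> 0 <= \prod_(i <- s) f i <= 1.
Proof.
move=> f01; elim: s => [|i s ih]; first by rewrite big_nil lexx lee01.
by rewrite big_cons mule01.
Qed.

Lemma fin_num01 x : 0 <= x <= 1 -> x \is a fin_num.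
Proof. by move=> /andP[x0 x1]; rewrite ge0_fin_numE// (le_lt_trans x1) ?ltry. Qed.

Lemma emeasurable_prod d (T : measurableType d) (I : Type) (s : seq I)
    (f : I -> T -> \bar R) : (forall i, measurable_fun setT (f i)) ->
  measurable_fun setT (fun t => \prod_(i <- s) f i t).
Proof.
move=> mf; elim: s => [|i s ih].
  by under eq_fun do rewrite big_nil; exact: measurable_cst.
by under eq_fun do rewrite big_cons; exact: emeasurable_funM.
Qed.

Lemma integral01 d (T : measurableType d) (m : {measure set T -> \bar R})
    (f : T -> \bar R) : m setT <= 1 -> measurable_fun setT f ->
  (forall t, 0 <= f t <= 1) -> 0 <= \int[m]_t f t <= 1.
Proof.
move=> m1 mf f01; rewrite integral_ge0/=; last by move=> t _; case/andP: (f01 t).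
apply: (@le_trans _ _ (\int[m]_t cst 1 t)); last by rewrite integral_cst// mul1e.
by apply: ge0_le_integral => // t _; case/andP: (f01 t).
Qed.

End unit_interval.

Section integral_kernel_eq.
Context (R : realType) d1 d2 d (T1 : measurableType d1) (T2 : measurableType d2)
  (Y : measurableType d) (P1 : probability T1 R) (P2 : probability T2 R)
  (C : set (set Y)).
Hypotheses (mC : measurable = <<s C >>) (CI : setI_closed C) (CT : C setT).

(** Both sides integrate [f] against a mixture. The two mixtures agree on the pi-system [C], which
    contains the whole space, and have mass at most one, so they coincide on all measurable sets. *)
Lemma integral_kernel_eq
    (K1 : T1 -> {measure set Y -> \bar R}) (K2 : T2 -> {measure set Y -> \bar R})
    (g1 : T1 -> \bar R) (g2 : T2 -> \bar R) :
  (forall S, measurable S -> measurable_fun setT (K1 ^~ S)) ->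
  (forall S, measurable S -> measurable_fun setT (K2 ^~ S)) ->
  (forall t, K1 t setT <= 1) ->
  measurable_fun setT g1 -> measurable_fun setT g2 ->
  (forall t, 0 <= g1 t <= 1) -> (forall t, 0 <= g2 t <= 1) ->
  (forall S, C S ->
     \int[P1]_t (g1 t * K1 t S) = \int[P2]_t (g2 t * K2 t S)) ->
  forall f : Y -> \bar R, measurable_fun setT f -> (forall y, 0 <= f y) ->
  \int[P1]_t (g1 t * \int[K1 t]_y f y) = \int[P2]_t (g2 t * \int[K2 t]_y f y).
Proof.
move=> mK1 mK2 K1le1 mg1 mg2 g101 g201 K12 f mf f0.
pose m1 : {measure set Y -> \bar R} := mixture P1 mg1 g101 mK1.
pose m2 : {measure set Y -> \bar R} := mixture P2 mg2 g201 mK2.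
rewrite -(integral_mixture mg1 g101 mK1 (m := m1))//.
rewrite -(integral_mixture mg2 g201 mK2 (m := m2))//.
apply: eq_measure_integral => S mS _.
apply: (measure_unique C (fun=> setT)) => //.
  by rewrite bigcup_const.
move=> _; apply: (@le_lt_trans _ _ 1); last by rewrite ltry.
have K101 t : 0 <= K1 t setT <= 1 by rewrite measure_ge0 K1le1.
have /andP[_ +] := integral01 (m := P1) (probability_le1 P1 measurableT)
  (emeasurable_funM mg1 (mK1 _ measurableT))
  (fun t => mule01 (g101 t) (K101 t)).
by [].
Qed.

(** Induction on [J]: the head factor is already a function and joins the weight, the remaining
    factors are still sets. To justify this for the head, the other factors join the weight in turn
    and the single-kernel case applies. *)
Lemma integral_prod_kernel_eq (I : eqType) (J : seq I)
    (K1 : I -> T1 -> {measure set Y -> \bar R})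
    (K2 : I -> T2 -> {measure set Y -> \bar R})
    (g1 : T1 -> \bar R) (g2 : T2 -> \bar R) :
  uniq J ->
  (forall i S, measurable S -> measurable_fun setT (K1 i ^~ S)) ->
  (forall i S, measurable S -> measurable_fun setT (K2 i ^~ S)) ->
  (forall i t, K1 i t setT <= 1) -> (forall i t, K2 i t setT <= 1) ->
  measurable_fun setT g1 -> measurable_fun setT g2 ->
  (forall t, 0 <= g1 t <= 1) -> (forall t, 0 <= g2 t <= 1) ->
  (forall S : I -> set Y, (forall i, C (S i)) ->
     \int[P1]_t (g1 t * \prod_(i <- J) K1 i t (S i)) =
     \int[P2]_t (g2 t * \prod_(i <- J) K2 i t (S i))) ->
  forall f : I -> Y -> \bar R,
  (forall i, measurable_fun setT (f i)) -> (forall i y, 0 <= f i y <= 1) ->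
  \int[P1]_t (g1 t * \prod_(i <- J) \int[K1 i t]_y f i y) =
  \int[P2]_t (g2 t * \prod_(i <- J) \int[K2 i t]_y f i y).
Proof.
move=> + mK1 mK2 K1le1 K2le1; elim: J g1 g2 => [|j J ih] g1 g2.
  move=> _ mg1 mg2 g101 g201 K12 f mf f01.
  transitivity (\int[P1]_t (g1 t * \prod_(i <- [::]) K1 i t setT)).
    by apply: eq_integral => t _; rewrite !big_nil.
  rewrite (K12 (fun=> setT) (fun=> CT)).
  by apply: eq_integral => t _; rewrite !big_nil.
move=> /= /andP[jJ uJ] mg1 mg2 g101 g201 K12 f mf f01.
have f0 i y : 0 <= f i y by case/andP: (f01 i y).
have mC' S : C S -> measurable S.
  by move=> CS; rewrite mC; exact: sub_sigma_algebra.
have mi1 i : measurable_fun setT (fun t => \int[K1 i t]_y f i y).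
  by apply: measurable_fun_integral_kernel => // U mU; exact: mK1.
have mi2 i : measurable_fun setT (fun t => \int[K2 i t]_y f i y).
  by apply: measurable_fun_integral_kernel => // U mU; exact: mK2.
have i01 i t : 0 <= \int[K1 i t]_y f i y <= 1 by exact: integral01.
have i02 i t : 0 <= \int[K2 i t]_y f i y <= 1 by exact: integral01.
under eq_integral do rewrite big_cons muleA.
under [in RHS]eq_integral do rewrite big_cons muleA.
apply: (ih (fun t => g1 t * \int[K1 j t]_y f j y)
           (fun t => g2 t * \int[K2 j t]_y f j y)) => //.
- exact: emeasurable_funM.
- exact: emeasurable_funM.
- by move=> t; exact: mule01.
- by move=> t; exact: mule01.
move=> S CS.
have K1S01 i t : 0 <= K1 i t (S i) <= 1.
  rewrite measure_ge0/= (le_trans _ (K1le1 i t))//.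
  by rewrite le_measure// inE//; exact: mC'.
have K2S01 i t : 0 <= K2 i t (S i) <= 1.
  rewrite measure_ge0/= (le_trans _ (K2le1 i t))//.
  by rewrite le_measure// inE//; exact: mC'.
under eq_integral do rewrite muleAC.
under [in RHS]eq_integral do rewrite muleAC.
apply: (integral_kernel_eq
  (g1 := fun t => g1 t * \prod_(i <- J) K1 i t (S i))
  (g2 := fun t => g2 t * \prod_(i <- J) K2 i t (S i)) (mK1 j) (mK2 j)
  (K1le1 j)) => //.
- apply: emeasurable_funM => //; apply: emeasurable_prod => i.
  by apply: mK1; exact: mC'.
- apply: emeasurable_funM => //; apply: emeasurable_prod => i.
  by apply: mK2; exact: mC'.
- by move=> t; apply: mule01 => //; exact: prode01.
- by move=> t; apply: mule01 => //; exact: prode01.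
move=> Sj CSj.
(* The family is modified at [j] only; since [j] does not recur in [J], the other factors keep their
   sets. *)
have := K12 (fun i => if i == j then Sj else S i).
have CS' i : C (if i == j then Sj else S i) by case: ifP.
move=> /(_ CS').
have EJ (T : Type) (K : I -> T -> {measure set Y -> \bar R}) (g : T -> \bar R) t :
   g t * \prod_(i <- j :: J) K i t (if i == j then Sj else S i) =
   g t * \prod_(i <- J) K i t (S i) * K j t Sj.
  rewrite big_cons eqxx -muleA [in RHS](muleC (\prod_(_ <- _) _)).
  congr (_ * (_ * _)); rewrite big_seq [in RHS]big_seq.
  by apply: eq_bigr => i iJ; case: eqP iJ jJ => // -> ->.
by under eq_integral do rewrite EJ; under [in RHS]eq_integral do rewrite EJ.
Qed.

End integral_kernel_eq.

(** * Laplace functionals of Poisson and marked point processes *)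

Section expeR_limits.
Context {R : realType}.

Lemma measurable_expeR : measurable_fun setT (@expeR R).
Proof.
apply: (measurability _ (ErealGenInftyO.measurableE R)) => _ /= -[_ [r ->] <-].
rewrite setTI; have [r0|r0] := leP r 0%R.
  rewrite (_ : _ @^-1` _ = set0)//; apply/seteqP; split => // x /=.
  by rewrite in_itv/= ltNge (le_trans _ (expeR_ge0 x))// lee_fin.
rewrite (_ : _ @^-1` _ = `]-oo, (ln r)%:E[%classic); last first.
  apply/seteqP; split => x /=; rewrite !in_itv/=.
  - rewrite -[r in (r%:E)%E](@lnK R) ?posrE//.
    by rewrite -[(expR (ln r))%:E]/(expeR (ln r)%:E) lte_expeR.
  - by rewrite -[(x < _)%E]lte_expeR /= lnK.
exact: emeasurable_itv.
Qed.

Lemma expeRN01 (x : \bar R) : 0 <= x -> 0 <= expeR (- x) <= 1.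
Proof. by move=> x0; rewrite expeR_ge0/= -expeR0 lee_expeR leeNl oppe0. Qed.

(** The limit of [u] may be [+oo]. The exponentials decrease to their infimum, which remains to be
    identified. *)
Lemma cvg_expeRN (u : (\bar R)^nat) : nondecreasing_seq u ->
  expeR (- u n) @[n --> \oo] --> expeR (- limn u).
Proof.
move=> ndu.
have ndv : nonincreasing_seq (fun n => expeR (- u n)).
  by move=> m n mn; rewrite lee_expeR leeN2 ndu.
have cu := ereal_nondecreasing_is_cvgn ndu.
suff -> : expeR (- limn u) = ereal_inf (range (fun n => expeR (- u n))).
  exact: ereal_nonincreasing_cvgn.
apply/eqP; rewrite eq_le; apply/andP; split.
  apply: le_ereal_inf_tmp => _ [n _ <-].
  rewrite lee_expeR leeN2; apply: lime_ge => //.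
  by exists n => // m /= nm; exact: ndu.
set c := ereal_inf _.
(* Writing the infimum as an exponential turns the remaining inequality into a bound on [limn u];
   the value [y = -oo] covers an infimum equal to zero. *)
have /expeR_total[y yE] : 0 <= c.
  by apply: le_ereal_inf_tmp => _ [n _ <-]; exact: expeR_ge0.
rewrite -yE lee_expeR leeNr; apply: lime_le => //.
apply: nearW => n; rewrite leeNr -lee_expeR yE.
by apply: ereal_inf_lbound; exists n.
Qed.

Lemma expeRN_sum (I : Type) (s : seq I) (Q : pred I) (a : I -> \bar R) :
  (forall i, Q i -> 0 <= a i) ->
  expeR (- \sum_(i <- s | Q i) a i) =
  \prod_(i <- s | Q i) expeR (- a i).
Proof.
move=> a0; elim: s => [|i s ih]; first by rewrite !big_nil oppe0 expeR0.
rewrite !big_cons; case: ifPn => // Qi.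
rewrite oppeD ?expeRD ?ih// ge0_adde_def// inE ?a0//.
exact: sume_ge0.
Qed.

Lemma cvg_integral_expeRN d (T : measurableType d) (P : probability T R)
    (u : nat -> T -> \bar R) :
  (forall n, measurable_fun setT (u n)) -> (forall n t, 0 <= u n t) ->
  (forall t, nondecreasing_seq (u ^~ t)) ->
  \int[P]_t expeR (- u n t) @[n --> \oo] -->
  \int[P]_t expeR (- limn (u ^~ t)).
Proof.
move=> mu u0 ndu.
apply: (@dominated_cvg _ _ _ _ _ _ _ _ (cst 1)) => //.
- move=> n; apply: measurableT_comp measurable_expeR _.
  exact: measurableT_comp.
- by move=> t _; exact: cvg_expeRN.
- exact: finite_measure_integrable_cst.
- move=> n t _; have /andP[e0 e1] := expeRN01 (u0 n t).
  by rewrite gee0_abs.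
Qed.

End expeR_limits.

Lemma integral_ae_partition d (T : measurableType d) (R : realType)
    (P : probability T R) (F : nat -> set T) (f : T -> \bar R) :
  (forall n, measurable (F n)) -> trivIset setT F -> P (\bigcup_n F n) = 1 ->
  measurable_fun setT f -> (forall t, 0 <= f t) ->
  \int[P]_t f t = \sum_(n <oo) \int[P]_(t in F n) f t.
Proof.
move=> mF tF PF mf f0.
have mUF : measurable (\bigcup_n F n) by exact: bigcupT_measurable.
have mN : measurable (~` \bigcup_n F n) by exact: measurableC.
have PN : P (~` \bigcup_n F n) = 0 by rewrite probability_setC// PF subee.
rewrite (ge0_negligible_integral mN measurableT mf _ PN)// setTD setCK.
by rewrite ge0_integral_bigcup//; exact: measurable_funTS.
Qed.

Lemma poisson_generating_function (R : realType) (r x : R) :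
  (0 <= r)%R -> (0 <= x)%R ->
  \sum_(n <oo) ((x ^+ n)%:E * poisson_prob r 0%N [set n]) =
  (expR (- (r * (1 - x))))%:E.
Proof.
move=> r0 x0.
have mE n : poisson_prob r 0%N [set n] =
    (r ^+ n * n`!%:R^-1 * expR (- r))%:E.
  rewrite /poisson_prob; case: ifPn => r_gt0.
    by rewrite esum_set1 ?lee_fin ?poisson_pmf_ge0// /poisson_pmf r_gt0.
  (* For rate zero [poisson_prob] is the Dirac mass at [0], which still fits the formula because
     [0 ^ 0 = 1]. *)
  have -> : r = 0%R by apply/eqP; rewrite eq_le r0 leNgt r_gt0.
  rewrite diracE oppr0 expR0 mulr1 expr0n; case: n => [|n].
    by rewrite mem_set// fact0 invr1 mulr1.
  by rewrite memNset ?mul0r.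
have pE n : (x ^+ n)%:E * poisson_prob r 0%N [set n] =
    (expR (- r))%:E * (exp_coeff (r * x) n)%:E.
  by rewrite mE -!EFinM /exp_coeff/= exprMn; congr (_%:E); ring.
under eq_eseriesr do rewrite pE.
rewrite nneseriesZl; last first.
  by move=> n _; rewrite lee_fin /exp_coeff/= mulr_ge0// exprn_ge0// mulr_ge0.
rewrite mulrBr mulr1 opprB addrC expRD EFinM; congr (_ * _).
rewrite -EFin_lim; last exact: is_cvg_series_exp_coeff.
by apply/congr_lim/funext => n /=; rewrite /series/= -sumEFin.
Qed.

Section atoms.
Context {R : realType} {d d' : measure_display} {T : Type}
  {Y : measurableType d'}.

(** A bundled measure with the values of [atom_measure], to which integration theory applies; absent
    atoms contribute the zero measure. *)
Definition atoms (E : nat -> set T) (y : nat -> T -> Y) (t : T) :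
    {measure set Y -> \bar R} :=
  mseries (fun k => if t \in E k then (\d_(y k t) : measure Y R)
                    else (mzero : measure Y R)) 0.

Lemma atomsE E y t B : atoms E y t B = atom_measure R T _ Y E y t B.
Proof.
rewrite /atom_measure eseries_mkcond; apply: eq_eseriesr => k _.
by case: ifPn.
Qed.

Lemma integral_atoms E y t (f : Y -> \bar R) :
  measurable_fun setT f -> (forall x, 0 <= f x) ->
  \int[atoms E y t]_x f x = \sum_(k <oo | t \in E k) f (y k t).
Proof.
move=> mf f0; rewrite ge0_integral_measure_series// [in RHS]eseries_mkcond.
apply: eq_eseriesr => k _; case: ifPn => _; last exact: integral_measure_zero.
by rewrite integral_dirac// diracT mul1e.
Qed.

End atoms.

Lemma measurable_atoms (R : realType) d d' (T : measurableType d)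
    (Y : measurableType d') (E : nat -> set T) (y : nat -> T -> Y) S :
  (forall k, measurable (E k)) -> (forall k, measurable_fun setT (y k)) ->
  measurable S -> measurable_fun setT (fun t => atoms (R := R) E y t S).
Proof.
move=> mE my mS; apply: ge0_emeasurable_sum => //= k _.
rewrite (_ : (fun _ => _) = (fun t => \d_(y k t) S) \_ (E k)); last first.
  by apply/funext => t; rewrite patchE; case: ifPn.
apply/(measurable_restrictT _ (mE k)); apply: measurable_funTS.
exact: (measurableT_comp (measurable_fun_dirac mS) (my k)).
Qed.

Lemma prode_indic (R : realType) (T I : Type) (s : seq I) (A : I -> set T) t :
  \prod_(i <- s) (\1_(A i) t)%:E =
  (\1_(\big[setI/setT]_(i <- s) A i) t)%:E :> \bar R.
Proof.
elim: s => [|i s ih]; first by rewrite !big_nil indicT.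
by rewrite !big_cons ih indicI.
Qed.

Section poisson_laplace.
Context {R : realType} {d d' : measure_display} {T : measurableType d}
  {Y : measurableType d'} (P : probability T R).

(** For finite [m] this is the generating function at [exp(- c)]. For infinite [m] the count is
    almost surely infinite and both sides vanish, except when [c = 0], where [0 * +oo = 0] makes
    both sides one. *)
Lemma laplace_poisson_count (N : T -> \bar R) (m : \bar R) (c : R) :
  measurable_fun setT N -> 0 <= m -> (0 <= c)%R ->
  (m < +oo -> forall n : nat,
     P [set t | N t = n%:R%:E] = poisson_prob (fine m) 0%N [set n]) ->
  (m = +oo -> P [set t | N t = +oo] = 1) ->
  \int[P]_t expeR (- (c%:E * N t)) = expeR (- ((1 - expR (- c))%:E * m)).
Proof.
move=> mN m0 c0 Nfin Ninf.
have mNE x : measurable [set t | N t = x].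
  rewrite -[X in measurable X]setTI; exact: (mN measurableT _ (emeasurable_set1 x)).
have mh : measurable_fun setT (fun t => expeR (- (c%:E * N t))).
  apply: measurableT_comp measurable_expeR _.
  by apply: measurableT_comp => //; exact: measurable_funeM.
have h0 t : 0 <= expeR (- (c%:E * N t)) by exact: expeR_ge0.
move: c0; rewrite le_eqVlt => /predU1P[<-|c0].
  rewrite oppr0 expR0 subrr mul0e oppe0 expeR0.
  under eq_integral do rewrite mul0e oppe0 expeR0.
  by rewrite integral_cst// mul1e; exact: probability_setT.
have ec1 : (expR (- c) < 1)%R by rewrite -expR0 ltr_expR oppr_lt0.
move: m0; have [moo m0|] := ltP m +oo; last first.
  rewrite leye_eq => /eqP moo _; rewrite moo gt0_muley ?lte_fin ?subr_gt0//=.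
  have mC : measurable (~` [set t | N t = +oo]) by exact: measurableC.
  have PC : P (~` [set t | N t = +oo]) = 0.
    by rewrite probability_setC// Ninf// subee.
  rewrite (ge0_negligible_integral mC measurableT mh _ PC)// setTD setCK.
  by apply: integral0_eq => t /= ->; rewrite gt0_muley ?lte_fin.
have mfin : m \is a fin_num by rewrite ge0_fin_numE.
rewrite (integral_ae_partition (F := fun n => [set t | N t = n%:R%:E]))//; last 2 first.
- by move=> i j _ _ [t [/= ->]] [] /(mulrIn (oner_neq0 R)).
- rewrite measure_semi_bigcup//; last 2 first.
  + by move=> i j _ _ [t [/= ->]] [] /(mulrIn (oner_neq0 R)).
  + exact: bigcupT_measurable.
  (* The generating function at one is the total mass, so the events [N = n] exhaust the space up to
     a null set. *)
  have := poisson_generating_function (fine_ge0 m0) (@ler01 R).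
  rewrite subrr mulr0 oppr0 expR0 => <-; apply: eq_eseriesr => n _.
  by rewrite expr1n mul1e; exact: Nfin.
have := poisson_generating_function (fine_ge0 m0) (expR_ge0 (- c)).
move=> pE; rewrite (_ : expeR (- (_ * m)) = (expR (- (fine m * (1 - expR (- c)))))%:E).
  rewrite -pE; apply: eq_eseriesr => n _.
  rewrite -(Nfin moo n) -(integral_cst P (mNE _)).
  apply: eq_integral => t; rewrite inE/= => ->.
  by rewrite -EFinM -EFinN /= -expRM_natr mulNr.
by rewrite -[in LHS](fineK mfin) -EFinM -EFinN /= mulrC.
Qed.

(** Independence compares two kernels: Dirac masses at the [X n], and the constant kernels given by
    their laws. *)
Lemma independent_integral_prod dV (V : measurableType dV)
    (X : nat -> {mfun T >-> V}) (J : seq nat) (f : nat -> V -> \bar R) :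
  mutually_independent P (fun n => g_sigma_algebra_preimage (X n)) ->
  uniq J -> (forall n, measurable_fun setT (f n)) ->
  (forall n x, 0 <= f n x <= 1) ->
  \int[P]_t \prod_(n <- J) f n (X n t) = \prod_(n <- J) \int[P]_t f n (X n t).
Proof.
move=> indX uJ mf f01.
have f0 n x : 0 <= f n x by case/andP: (f01 n x).
have CI : setI_closed (measurable : set (set V)) by exact: measurableI.
have CE : measurable = <<s (measurable : set (set V)) >>.
  by apply/esym/smallest_id; exact: sigma_algebra_measurable.
have m1 (T' : measurableType d) : measurable_fun setT (cst 1 : T' -> \bar R).
  exact: measurable_cst.
have o01 (t : T) : 0 <= (cst 1 t : \bar R) <= 1 by rewrite /= lee01 lexx.
have := integral_prod_kernel_eq (P1 := P) (P2 := P) CE CI measurableT (J := J)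
  (K1 := fun n t => \d_(X n t)) (K2 := fun n _ => distribution P (X n))
  (g1 := cst 1) (g2 := cst 1) uJ _ _ _ _ (m1 T) (m1 T) o01 o01 _ mf f01.
move=> H.
transitivity (\int[P]_t (cst 1 t * \prod_(n <- J) \int[\d_(X n t)]_y f n y)).
  apply: eq_integral => t _; rewrite mul1e; apply: eq_bigr => n _.
  by rewrite integral_dirac// diracT mul1e.
rewrite H.
- rewrite /= mul1e integral_cst//= (_ : P setT = 1) ?mule1; last exact: probability_setT.
  by apply: eq_bigr => n _; rewrite ge0_integral_distribution.
- move=> n S mS; exact: (measurableT_comp (measurable_fun_dirac mS)).
- by move=> n S mS; exact: measurable_cst.
- by move=> n t; rewrite /= diracT.
- by move=> n t; apply: probability_le1.
move=> S mS /=.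
rewrite mul1e integral_cst//= (_ : P setT = 1) ?mule1; last exact: probability_setT.
rewrite -(indX J (fun n => X n @^-1` (S n)))//; last first.
  by move=> n; exists (S n) => //; rewrite setTI.
have mXS : measurable (\big[setI/[set: T]]_(n <- J) X n @^-1` S n).
  apply: bigsetI_measurable => n _; rewrite -[X in measurable X]setTI.
  exact: measurable_funP.
rewrite -[X in P X]setIT -(integral_indic P measurableT mXS).
apply: eq_integral => t _; rewrite mul1e -prode_indic; apply: eq_bigr => n _.
by rewrite diracE indicE.
Qed.

Variables (mu : {measure set Y -> \bar R}) (N : T -> {measure set Y -> \bar R}).
Hypothesis prmN : poisson_random_measure P mu N.

Import HBNNSimple.

(** The level sets of a simple function are disjoint, so the counts in them are independent Poisson
    variables and the exponential factorises. *)
Let laplace_nnsfun (f : {nnsfun Y >-> R}) :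
  \int[P]_t expeR (- \int[N t]_y (f y)%:E) =
  expeR (- \int[mu]_y (1 - expeR (- (f y)%:E))).
Proof.
have [[mN _] Nfin Ninf indN] := prmN.
pose s := finmap.enum_fset (fset_set (range f)).
(* Independence is given for infinite sequences of disjoint sets; the finite list of level sets is
   padded with empty sets. *)
pose B n := if (n < size s)%N then f @^-1` [set s`_n] else set0.
have s_ge0 n : (0 <= s`_n)%R.
  have [ns|sn] := ltnP n (size s); last by rewrite nth_default.
  have := mem_nth 0%R ns; rewrite in_fset_set ?inE//.
  by move=> [y _ <-].
have mB n : measurable (B n) by rewrite /B; case: ifPn.
have tB : trivIset setT B.
  move=> i j _ _ [y []]; rewrite /B; case: ifPn => // si; case: ifPn => // sj.
  move=> /= -> /eqP; rewrite nth_uniq ?finmap.fset_uniq// => /eqP//.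
(* One decomposition serves for both [f] and [1 - exp(- f)], which share their level sets. *)
have fE (phi : R -> R) y : (phi (f y))%:E =
    \sum_(0 <= n < size s) ((phi s`_n)%:E * (\1_(B n) y)%:E).
  have fys : f y \in s by rewrite in_fset_set// inE; exists y.
  rewrite (bigD1_seq (index (f y) s)) ?iota_uniq ?mem_index_iota ?index_mem//=.
  rewrite nth_index// /B index_mem fys nth_index// indicE mem_set// mule1.
  rewrite big_nat_cond big1 ?adde0// => i /andP[/andP[_ si] /eqP iy].
  rewrite si indicE memNset ?mule0//= => fyi; apply: iy.
  by rewrite fyi index_uniq// finmap.fset_uniq.
have intE (phi : R -> R) (m : {measure set Y -> \bar R}) :
    (forall r, 0 <= r -> 0 <= phi r)%R ->
    \int[m]_y (phi (f y))%:E = \sum_(0 <= n < size s) ((phi s`_n)%:E * m (B n)).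
  move=> phi0; under eq_integral do rewrite fE.
  have mi n : measurable_fun setT (fun y => (\1_(B n) y)%:E : \bar R).
    by apply/measurable_EFinP; exact: measurable_indic.
  have pn0 n : 0 <= (phi s`_n)%:E by rewrite lee_fin phi0.
  have i0 n y : setT y -> 0 <= (\1_(B n) y)%:E :> \bar R by rewrite lee_fin.
  rewrite ge0_integral_sum//.
  - apply: eq_bigr => n _.
    by rewrite (ge0_integralZl m measurableT (mi n) (i0 n) (pn0 n)) integral_indic// setIT.
  - by move=> n; exact: measurable_funeM.
  - by move=> n y _; rewrite mule_ge0// i0.
have intid (m : {measure set Y -> \bar R}) :
    \int[m]_y (f y)%:E = \sum_(0 <= n < size s) ((s`_n)%:E * m (B n)).
  exact: (intE id).
have -> : \int[mu]_y (1 - expeR (- (f y)%:E)) =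
    \sum_(0 <= n < size s) ((1 - expR (- s`_n))%:E * mu (B n)).
  rewrite -(intE (fun r => 1 - expR (- r))%R)// => r r0.
  by rewrite subr_ge0 -expR0 ler_expR oppr_le0.
pose V n : {mfun T >-> \bar R} :=
  HB.pack (fun t => N t (B n)) (isMeasurableFun.Build _ _ _ _ _ (mN _ (mB n))).
have VE n t : V n t = N t (B n) by [].
rewrite expeRN_sum; last first.
  move=> n _; rewrite mule_ge0// lee_fin subr_ge0 -expR0 ler_expR oppr_le0//.
(* The absolute value changes nothing on counts, but gives a factor bounded by one at every extended
   real, as the product formula requires. *)
transitivity (\int[P]_t \prod_(0 <= n < size s)
    (fun n x => expeR (- `|(s`_n)%:E * x|)) n (V n t)).
  apply: eq_integral => t _; rewrite intid expeRN_sum; last first.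
    by move=> n _; rewrite mule_ge0// lee_fin.
  by apply: eq_bigr => n _; rewrite gee0_abs// mule_ge0// lee_fin.
rewrite (independent_integral_prod (X := V)
  (f := fun n x => expeR (- `|(s`_n)%:E * x|)))//.
- apply: eq_bigr => n _; rewrite -(@laplace_poisson_count (V n))//.
  + by apply: eq_integral => t _; rewrite gee0_abs// mule_ge0// lee_fin.
  + by move=> mBoo k; rewrite -Nfin.
  + by move=> mBoo; rewrite -(Ninf _ (mB n)).
- exact: (indN B).
- exact: iota_uniq.
- move=> n; apply: measurableT_comp measurable_expeR _.
  apply: measurableT_comp => //; apply: measurableT_comp => //.
  exact: measurable_funeM.
- by move=> n x; exact: expeRN01.
Qed.

(** Monotone passage from simple functions: integrals against [N t] increase, as do the integrals of
    [1 - exp(- u n)] against [mu], so both sides converge. *)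
Lemma laplace_poisson_random_measure (f : Y -> \bar R) :
  measurable_fun setT f -> (forall y, 0 <= f y) ->
  \int[P]_t expeR (- \int[N t]_y f y) =
  expeR (- \int[mu]_y (1 - expeR (- f y))).
Proof.
move=> mf f0.
have mN S : measurable S -> measurable_fun setT (N ^~ S).
  by case: prmN => -[mN _] _ _ _; exact: mN.
pose u := nnsfun_approx measurableT mf.
have ndu y : nondecreasing_seq (fun n => (u n y)%:E).
  by move=> m n mn; rewrite lee_fin; exact/lefP/nd_nnsfun_approx.
have mun n : measurable_fun setT (fun y => (u n y)%:E) by exact/measurable_EFinP.
have u0 n y : 0 <= (u n y)%:E by rewrite lee_fin.
have fE y : f y = limn (fun n => (u n y)%:E).
  by apply/esym/cvg_lim => //; exact: cvg_nnsfun_approx.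
have L : \int[P]_t expeR (- \int[N t]_y (u n y)%:E) @[n --> \oo] -->
         \int[P]_t expeR (- \int[N t]_y f y).
  rewrite [X in _ --> X](_ : _ = \int[P]_t expeR
      (- limn (fun n => \int[N t]_y (u n y)%:E))); last first.
    apply: eq_integral => t _; rewrite -monotone_convergence//.
    by congr (expeR (- _)); apply: eq_integral.
  apply: cvg_integral_expeRN => [n|n t|t m n mn].
  - exact: measurable_fun_integral_kernel.
  - by apply: integral_ge0 => y _.
  - by apply: ge0_le_integral => // y _; exact: ndu.
have me n : measurable_fun setT (fun y => 1 - expeR (- (u n y)%:E)).
  apply: emeasurable_funB => //; apply: measurableT_comp measurable_expeR _.
  exact: measurableT_comp.
have Rr : expeR (- \int[mu]_y (1 - expeR (- (u n y)%:E))) @[n --> \oo] -->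
          expeR (- \int[mu]_y (1 - expeR (- f y))).
  rewrite [X in _ --> expeR (- X)](_ : _ =
      limn (fun n => \int[mu]_y (1 - expeR (- (u n y)%:E)))); last first.
    rewrite -monotone_convergence//.
    - apply: eq_integral => y _; rewrite fE; apply/esym/cvg_lim => //.
      apply: cvgeB; [|exact: cvg_cst|exact: cvg_expeRN].
      by rewrite fin_num_adde_defr.
    - by move=> n y _; rewrite sube_ge0//; case/andP: (expeRN01 (u0 n y)).
    - by move=> y _ m n mn; rewrite leeB// lee_expeR leeN2 ndu.
  apply: cvg_expeRN => m n mn; apply: ge0_le_integral => //.
  - by move=> y _; rewrite sube_ge0//; case/andP: (expeRN01 (u0 m y)).
  - by move=> y _; rewrite leeB// lee_expeR leeN2 ndu.
have LE n : \int[P]_t expeR (- \int[N t]_y (u n y)%:E) =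
    expeR (- \int[mu]_y (1 - expeR (- (u n y)%:E))) := laplace_nnsfun (u n).
move: Rr; under eq_fun do rewrite -LE; move=> Rr.
exact: (cvg_unique _ L Rr).
Qed.

End poisson_laplace.

Lemma integral_indicM d (T : measurableType d) (R : realType)
    (mu : {measure set T -> \bar R}) (D : set T) (f : T -> \bar R) :
  \int[mu]_(t in D) f t = \int[mu]_t ((\1_D t)%:E * f t).
Proof.
rewrite integral_mkcond epatch_indic.
by apply: eq_integral => t _; rewrite muleC.
Qed.

Lemma measurable_lne (R : realType) : measurable_fun setT (@lne R).
Proof.
apply: (measurability _ (ErealGenInftyO.measurableE R)) => _ /= -[_ [r ->] <-].
rewrite setTI (_ : _ @^-1` _ = `]-oo, (expR r)%:E[%classic).
  exact: emeasurable_itv.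
apply/seteqP; split => -[x| |] //=; rewrite !in_itv/= ?ltNyr//.
- case: ifPn => [x0 _|]; first by rewrite lte_fin (le_lt_trans x0) ?expR_gt0.
  by rewrite -ltNge !lte_fin => x0; rewrite -{1}[r]expRK ltr_ln ?posrE ?expR_gt0.
- case: ifPn => [x0 _|]; first by rewrite ltNyr.
  by rewrite -ltNge !lte_fin => x0; rewrite -{2}[r]expRK ltr_ln ?posrE ?expR_gt0.
Qed.

Lemma indic01 (R : realType) (T : Type) (D : set T) t :
  0 <= (\1_D t : R)%:E <= 1.
Proof. by rewrite indicE !lee_fin; case: (t \in D); rewrite !lexx ?ler01. Qed.

Lemma measurable_indicE (R : realType) d (T : measurableType d) (D : set T) :
  measurable D -> measurable_fun setT (fun t => (\1_D t)%:E : \bar R).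
Proof. by move=> mD; apply/measurable_EFinP; exact: measurable_indic. Qed.

Definition rectangles {d d'} (X : measurableType d) (Y : measurableType d') :
  set (set (X * Y)) := [set A `*` B | A in measurable & B in measurable].

Arguments rectangles {d d'} X Y.

Lemma rectanglesI {d d'} (X : measurableType d) (Y : measurableType d') :
  setI_closed (rectangles X Y).
Proof.
move=> _ _ [A mA [B mB <-]] [A' mA' [B' mB' <-]].
exists (A `&` A'); first exact: measurableI.
by exists (B `&` B'); [exact: measurableI|rewrite setXI].
Qed.

Lemma rectanglesT {d d'} (X : measurableType d) (Y : measurableType d') :
  rectangles X Y setT.
Proof. by exists setT => //; exists setT => //; rewrite setXTT. Qed.

Section kprecomp.
Context d1 d2 d3 (Z : measurableType d1) (X : measurableType d2)
  (Y : measurableType d3) (R : realType) (G : R.-pker X ~> Y) (h : Z -> X).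

(** The kernel [G] pulled back along [h], so that the measurability of kernel integrals applies to
    integrands that depend on more than the argument of [G]. *)
Definition kprecomp (mh : measurable_fun setT h) (z : Z) :
  {measure set Y -> \bar R} := G (h z).

Hypothesis mh : measurable_fun setT h.

Let measurable_kprecomp U : measurable U ->
  measurable_fun setT (kprecomp mh ^~ U).
Proof.
move=> mU; exact: (measurableT_comp (measurable_kernel G _ mU) mh).
Qed.

HB.instance Definition _ := isKernel.Build _ _ _ _ _ (kprecomp mh)
  measurable_kprecomp.

Let kprecomp_prob z : kprecomp mh z setT = 1.
Proof. exact: prob_kernel. Qed.

HB.instance Definition _ := Kernel_isProbability.Build _ _ _ _ _
  (kprecomp mh) kprecomp_prob.

End kprecomp.

Lemma measurable_integral_kprecomp d1 d2 d3 (Z : measurableType d1)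
    (X : measurableType d2) (Y : measurableType d3) (R : realType)
    (G : R.-pker X ~> Y) (h : Z -> X) (k : Z * Y -> \bar R) :
  measurable_fun setT h -> measurable_fun setT k -> (forall x, 0 <= k x) ->
  measurable_fun setT (fun z => \int[G (h z)]_y k (z, y)).
Proof.
move=> mh mk k0.
have := measurable_fun_integral_finite_kernel k
  (kprecomp G mh : R.-pker Z ~> Y) k0 mk.
exact.
Qed.

Section mpair.
Context d d' (V : measurableType d) (W : measurableType d') (R : realType).
Implicit Types (m : {measure set V -> \bar R}) (o : W).

Let mdirac o (S : set (V * W)) : measurable S ->
  measurable_fun setT (fun a : V => \d_(a, o) S : \bar R).
Proof.
move=> mS; apply: (measurableT_comp (measurable_fun_dirac mS)).
exact: measurable_fun_pair.
Qed.

Let one01 (a : V) : 0 <= (cst 1 a : \bar R) <= 1.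
Proof. by rewrite /= lee01 lexx. Qed.

(** The image of [m] under [a |-> (a, o)]: the law of a random mark paired with a known location. *)
Definition mpair m o : {measure set (V * W) -> \bar R} :=
  mixture m (measurable_cst (1 : \bar R)) one01 (@mdirac o).

Lemma integral_mpair m o (f : V * W -> \bar R) :
  measurable_fun setT f -> (forall y, 0 <= f y) ->
  \int[mpair m o]_y f y = \int[m]_a f (a, o).
Proof.
move=> mf f0.
rewrite (integral_mixture (mu := m) (measurable_cst (1 : \bar R)) one01 (@mdirac o))//.
apply: eq_integral => a _; rewrite mul1e integral_dirac//=.
by rewrite diracT mul1e.
Qed.

Lemma mpairE m o S : measurable S -> mpair m o S = \int[m]_a \d_(a, o) S.
Proof. by move=> mS; apply: eq_integral => a _; rewrite mul1e. Qed.

Lemma diracX (a : V) o (C : set V) (D : set W) :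
  \d_(a, o) (C `*` D) = (\1_C a)%:E * (\1_D o)%:E :> \bar R.
Proof.
rewrite diracE -EFinM !indicE -natrM mulnb; congr ((nat_of_bool _)%:R%:E).
by apply/idP/andP; rewrite !inE => -[].
Qed.

Lemma mpairX m o (C : set V) (D : set W) : measurable C -> measurable D ->
  mpair m o (C `*` D) = m C * (\1_D o)%:E.
Proof.
move=> mC mD; rewrite mpairE; last exact: measurableX.
under eq_integral do rewrite diracX.
rewrite ge0_integralZr//; last exact: measurable_indicE.
by rewrite integral_indic// setIT.
Qed.

End mpair.

(** * Integrating out the marks of a point process *)

Section marking.
Context (R : realType) (q upsilon : nat) (d : measure_display)
  (Omega : measurableType d) (G : R.-pker 'R[R]^q ~> 'R[R]^upsilon)
  (dT : measure_display) (T : measurableType dT) (P : probability T R)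
  (E : nat -> set T) (s : nat -> {mfun T >-> 'R[R]^q})
  (w : nat -> {mfun T >-> Omega}) (A : nat -> {mfun T >-> 'R[R]^upsilon}).
Hypotheses (mE : forall k, measurable (E k))
  (cmA : conditionally_marked G P E s w A).

Local Notation alg := (atom_algebra E (fun k t => (s k t, w k t))).

Let algC F : alg F -> alg (~` F).
Proof. by move=> aF; rewrite -setTD; exact: sigma_algebraCD. Qed.

Let algI F F' : alg F -> alg F' -> alg (F `&` F').
Proof.
move=> aF aF'; rewrite -[_ `&` _]setCK setCI; apply: algC.
rewrite -bigcup2E; apply: sigma_algebra_bigcup => -[|[|]] /=; [exact: algC..|].
by move=> _; exact: sigma_algebra0.
Qed.

Let algE k (D : set ('R[R]^q * Omega)) : measurable D ->
  alg (E k `&` (fun t => (s k t, w k t)) @^-1` D).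
Proof. by move=> mD; apply: sub_sigma_algebra; exists k, D. Qed.

Let algEk k : alg (E k).
Proof. by have := @algE k setT measurableT; rewrite preimage_setT setIT. Qed.

Let malg F : alg F -> measurable F.
Proof.
apply: smallest_sub; first exact: sigma_algebra_measurable.
move=> _ [k [D [mD ->]]]; apply: measurableI => //.
rewrite -[X in measurable X]setTI.
exact: (measurable_fun_pair (@measurable_funPT _ _ _ _ (s k))
  (@measurable_funPT _ _ _ _ (w k))).
Qed.

(** Whether the atom [n] exists is decided here: on [E n] its factor moves to the deterministic
    list, off [E n] the factor is absent. *)
Let split_last_atom (u : nat -> T -> \bar R) n J F :
  (forall k, measurable_fun setT (u k)) -> (forall k t, 0 <= u k t <= 1) ->
  alg F ->
  \int[P]_t ((\1_F t)%:E * (\prod_(k <- J) u k t *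
    \prod_(0 <= k < n.+1 | t \in E k) u k t)) =
  \int[P]_t ((\1_(F `&` E n) t)%:E * (\prod_(k <- n :: J) u k t *
    \prod_(0 <= k < n | t \in E k) u k t)) +
  \int[P]_t ((\1_(F `&` ~` E n) t)%:E * (\prod_(k <- J) u k t *
    \prod_(0 <= k < n | t \in E k) u k t)).
Proof.
move=> mu u01 aF; have mF := malg aF.
have prodE01 J' m t : 0 <= \prod_(k <- J') u k t *
    \prod_(0 <= k < m | t \in E k) u k t <= 1.
  apply: mule01; first exact: prode01.
  rewrite big_mkcond; apply: prode01 => k; case: ifP => // _.
  by rewrite lexx lee01.
have mprodE J' m : measurable_fun setT (fun t => \prod_(k <- J') u k t *
    \prod_(0 <= k < m | t \in E k) u k t).
  apply: emeasurable_funM; first exact: emeasurable_prod.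
  under eq_fun do rewrite big_mkcond/=.
  apply: emeasurable_prod => k; apply: measurable_fun_if => //.
  - apply: (measurable_fun_bool true); rewrite setTI.
    rewrite [X in measurable X](_ : _ = E k)//.
    by apply/seteqP; split => t; [exact: set_mem|exact: mem_set].
  - exact: measurable_funTS.
rewrite -ge0_integralD//.
- apply: eq_integral => t _.
  have -> : \prod_(0 <= k < n.+1 | t \in E k) u k t =
      \prod_(0 <= k < n | t \in E k) u k t * (if t \in E n then u n t else 1).
    by rewrite big_mkcond big_nat_recr//= [in RHS]big_mkcond.
  rewrite big_cons !indicE !in_setI in_setC.
  case: (t \in F); rewrite /= ?mul0e ?adde0//.
  case: (t \in E n); rewrite /= ?mul0e ?adde0 ?add0e !mul1e ?mule1//.
  by rewrite muleA [u n t * _]muleC muleAC.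
- by move=> t _; case/andP: (mule01 (indic01 R (F `&` E n) t) (prodE01 (n :: J) n t)).
- by apply: emeasurable_funM => //; apply: measurable_indicE; exact: measurableI.
- by move=> t _; case/andP: (mule01 (indic01 R (F `&` ~` E n) t) (prodE01 J n t)).
- apply: emeasurable_funM => //; apply: measurable_indicE.
  by apply: measurableI => //; exact: measurableC.
Qed.

Variable f : 'R[R]^upsilon * Omega -> \bar R.
Hypotheses (mf : measurable_fun setT f) (f0 : forall y, 0 <= f y).

Let h y := expeR (- f y).

Let h01 y : 0 <= h y <= 1. Proof. exact: expeRN01. Qed.

Let mh : measurable_fun setT h.
Proof. by apply: measurableT_comp measurable_expeR _; exact: measurableT_comp. Qed.

Let hG (x : 'R[R]^q * Omega) := \int[G x.1]_a h (a, x.2).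

Let mhx (o : Omega) : measurable_fun setT (fun a => h (a, o)).
Proof. by apply: measurableT_comp => //; exact: measurable_fun_pair. Qed.

Let hG01 x : 0 <= hG x <= 1.
Proof. by apply: integral01 => //; rewrite prob_kernel. Qed.

Let mhG : measurable_fun setT hG.
Proof.
apply: (measurable_integral_kprecomp G
  (k := fun xa : ('R[R]^q * Omega) * 'R[R]^upsilon => h (xa.2, xa.1.2))).
- exact: measurable_fst.
- apply: measurableT_comp => //; apply: measurable_fun_pair => //.
  by apply: measurableT_comp; [exact: measurable_snd|exact: measurable_fst].
- by move=> [x a]; case/andP: (h01 (a, x.2)).
Qed.

Let my k : measurable_fun setT (fun t => (A k t, w k t)).
Proof. by apply: measurable_fun_pair. Qed.

Let mx k : measurable_fun setT (fun t => (s k t, w k t)).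
Proof. by apply: measurable_fun_pair. Qed.

(** The value of an atom is visible to [alg] only where the atom exists; since [F] lies in each
    [E k], intersecting with [E k] costs nothing. *)
Let alg_restrict J F (D : nat -> set Omega) : alg F ->
  (forall k, k \in J -> F `<=` E k) -> (forall k, measurable (D k)) ->
  alg (F `&` \big[setI/setT]_(k <- J) (w k @^-1` D k)).
Proof.
move=> aF FJ mD; elim: J FJ => [|k J ih] FJ; first by rewrite big_nil setIT.
rewrite big_cons (_ : _ `&` _ =
  (E k `&` (fun t => (s k t, w k t)) @^-1` (setT `*` D k)) `&`
  (F `&` \big[setI/setT]_(k <- J) (w k @^-1` D k))); last first.
  apply/seteqP; split => t /=.
    move=> [Ft [wt Jt]]; split=> //; split => //; apply: FJ Ft.
    by rewrite inE eqxx.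
  by move=> [[_ [_ wt]] [Ft Jt]].
apply: algI; first by apply: algE; exact: measurableX.
by apply: ih => i iJ; apply: FJ; rewrite inE iJ orbT.
Qed.

Let indic_restrict J F (D : nat -> set Omega) (a : nat -> \bar R) t :
  (\1_F t)%:E * \prod_(k <- J) (a k * (\1_(D k) (w k t))%:E) =
  (\1_(F `&` \big[setI/setT]_(k <- J) (w k @^-1` D k)) t)%:E *
    \prod_(k <- J) a k.
Proof.
rewrite big_split/= (prode_indic R J (fun k => w k @^-1` D k) t) indicI EFinM.
by rewrite -muleA; congr (_ * _); rewrite muleC.
Qed.

(** On rectangles [C k] times [D k], the constraints [D k] on locations are absorbed into the event
    [F], which stays in the atom algebra. What is left constrains the marks alone, and this is what
    conditional marking describes. Rectangles then generate the rest. *)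
Let marks_integral J F : uniq J -> alg F -> (forall k, k \in J -> F `<=` E k) ->
  \int[P]_t ((\1_F t)%:E * \prod_(k <- J) h (A k t, w k t)) =
  \int[P]_t ((\1_F t)%:E * \prod_(k <- J) hG (s k t, w k t)).
Proof.
move=> uJ aF FJ.
have h0 y : 0 <= h y by case/andP: (h01 y).
have m1F : measurable_fun setT (fun t => (\1_F t)%:E : \bar R).
  exact: measurable_indicE (malg aF).
have := integral_prod_kernel_eq (P1 := P) (P2 := P)
  (measurable_prod_measurableType _ _) (@rectanglesI _ _ _ _)
  (@rectanglesT _ _ _ _)
  (K1 := fun k t => \d_(A k t, w k t)) (K2 := fun k t => mpair (G (s k t)) (w k t))
  uJ _ _ _ _ m1F m1F (indic01 R F) (indic01 R F) _ (fun=> mh) (fun=> h01).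
move=> H.
transitivity (\int[P]_t ((\1_F t)%:E *
    \prod_(k <- J) \int[\d_(A k t, w k t)]_y h y)).
  apply: eq_integral => t _; congr (_ * _); apply: eq_bigr => k _.
  by rewrite integral_dirac// diracT mul1e.
rewrite H.
- apply: eq_integral => t _; congr (_ * _); apply: eq_bigr => k _.
  by rewrite integral_mpair.
- by move=> k S mS; exact: (measurableT_comp (measurable_fun_dirac mS) (my k)).
- move=> k S mS; under eq_fun do rewrite mpairE//.
  apply: (measurable_integral_kprecomp G
    (k := fun ta : T * 'R[R]^upsilon => \d_(ta.2, w k ta.1) S)) => //.
  apply: (measurableT_comp (measurable_fun_dirac mS)).
  apply: measurable_fun_pair; first exact: measurable_snd.
  by apply: measurableT_comp => //; exact: measurable_fst.
- by move=> k t; rewrite /= diracT.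
- by move=> k t; rewrite -setXTT mpairX// indicT mule1 prob_kernel.
move=> S RS.
have /choice[CD CDE] : forall k, exists CD : set 'R[R]^upsilon * set Omega,
    [/\ measurable CD.1, measurable CD.2 & CD.1 `*` CD.2 = S k].
  by move=> k; have [C mC [D mD CDS]] := RS k; exists (C, D).
have mC k : measurable (CD k).1 by case: (CDE k).
have mD k : measurable (CD k).2 by case: (CDE k).
have SE k : S k = (CD k).1 `*` (CD k).2 by case: (CDE k).
have aF' := alg_restrict aF FJ mD.
have := cmA uJ mC aF' (fun k kJ => subset_trans (@subIsetl _ _ _) (FJ k kJ)).
rewrite integral_indicM => H2.
transitivity (\int[P]_t ((\1_(F `&` \big[setI/setT]_(k <- J) (w k @^-1` (CD k).2)) t)%:E
    * \prod_(k <- J) G (s k t) (CD k).1)); last first.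
  apply: eq_integral => t _; rewrite -indic_restrict; congr (_ * _).
  by apply: eq_bigr => k _; rewrite SE mpairX.
rewrite -H2 -[X in P X]setIT -(integral_indic P measurableT); last first.
  apply: measurableI; first exact: malg.
  apply: bigsetI_measurable => k _; rewrite -[X in measurable X]setTI.
  exact: measurable_funP.
apply: eq_integral => t _.
rewrite [in RHS]indicI EFinM -(prode_indic R J (fun k => A k @^-1` (CD k).1) t).
rewrite -indic_restrict; congr (_ * _).
by apply: eq_bigr => k _; rewrite SE /= diracX.
Qed.

(** The list [J] holds the atoms already decided to exist on [F], all of index at least [n]; the
    indices below [n] are still undecided. At [n = 0] no random index set is left. *)
Let marks_integral_cond n J F : uniq J -> alg F ->
  (forall k, k \in J -> (n <= k)%N /\ F `<=` E k) ->
  \int[P]_t ((\1_F t)%:E * (\prod_(k <- J) h (A k t, w k t) *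
    \prod_(0 <= k < n | t \in E k) h (A k t, w k t))) =
  \int[P]_t ((\1_F t)%:E * (\prod_(k <- J) hG (s k t, w k t) *
    \prod_(0 <= k < n | t \in E k) hG (s k t, w k t))).
Proof.
elim: n J F => [|n ih] J F uJ aF FJ.
  under eq_integral do rewrite big_geq// mule1.
  under [in RHS]eq_integral do rewrite big_geq// mule1.
  by apply: marks_integral => // k /FJ[].
rewrite (split_last_atom (u := fun k t => h (A k t, w k t)))//; last first.
  by move=> k; exact: measurableT_comp (my k).
rewrite (split_last_atom (u := fun k t => hG (s k t, w k t)))//; last first.
  by move=> k; exact: measurableT_comp (mx k).
congr (_ + _).
- apply: ih => /=.
  + by rewrite uJ andbT; apply/negP => /FJ[]; rewrite ltnn.
  + by apply: algI => //; exact: algEk.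
  + move=> k; rewrite inE => /predU1P[->|/FJ[/ltnW nk FE]]; split => // t [] //.
    by move=> /FE.
- apply: ih => //.
  + by apply: algI => //; apply: algC; exact: algEk.
  + by move=> k /FJ[/ltnW nk FE]; split => // t [] /FE.
Qed.

Let cvg_prod_atoms (v : nat -> T -> \bar R) :
  (forall k, measurable_fun setT (v k)) -> (forall k t, 0 <= v k t) ->
  \int[P]_t (\prod_(0 <= k < n | t \in E k) expeR (- v k t)) @[n --> \oo] -->
  \int[P]_t expeR (- \sum_(k <oo | t \in E k) v k t).
Proof.
move=> mv v0.
under eq_fun => n.
  under eq_integral do rewrite -expeRN_sum//.
  over.
apply: cvg_integral_expeRN => [n|n t|t m n mn].
- under eq_fun do rewrite big_mkcond/=.
  apply: emeasurable_sum => k.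
  rewrite (_ : (fun _ => _) = v k \_ (E k)); last first.
    by apply/funext => t; rewrite patchE.
  by apply/(measurable_restrictT _ (mE k)); exact: measurable_funTS.
- exact: sume_ge0.
- exact: lee_sum_nneg_natr.
Qed.

(** Averaging over the marks replaces each factor [exp(- f)] by its mean [hG]. The product of these
    means is rewritten as the exponential of a sum over atoms of [- lne hG], which has again the
    form of a Laplace functional; a vanishing mean corresponds to the value [+oo]. Finitely many
    indices are treated at a time, and both sides pass to the limit. *)
Lemma laplace_marking :
  \int[P]_t expeR (- \int[atoms E (fun k t => (A k t, w k t)) t]_y f y) =
  \int[P]_t expeR (- \int[atoms E (fun k t => (s k t, w k t)) t]_x - lne (hG x)).
Proof.
have hG_ge0 x : 0 <= hG x by case/andP: (hG01 x).
have ehG x : expeR (- - lne (hG x)) = hG x by rewrite oppeK; apply/eqP; rewrite lneK_eq.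
have ln0 x : 0 <= - lne (hG x).
  rewrite leeNr oppe0 -lee_expeR -[lne _]oppeK ehG expeR0.
  by case/andP: (hG01 x).
have mln : measurable_fun setT (fun x => - lne (hG x)).
  by apply: measurableT_comp => //; exact: measurableT_comp (@measurable_lne R) mhG.
under eq_integral do rewrite integral_atoms//.
under [in RHS]eq_integral do rewrite integral_atoms//.
have L := cvg_prod_atoms (v := fun k t => f (A k t, w k t))
  (fun k => measurableT_comp mf (my k)) (fun k t => f0 _).
have Rr := cvg_prod_atoms (v := fun k t => - lne (hG (s k t, w k t)))
  (fun k => measurableT_comp mln (mx k)) (fun k t => ln0 _).
apply: (cvg_unique _ L) => //.
suff -> : (fun n => \int[P]_t \prod_(0 <= k < n | t \in E k)
      expeR (- f (A k t, w k t))) =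
    (fun n => \int[P]_t \prod_(0 <= k < n | t \in E k)
      expeR (- - lne (hG (s k t, w k t)))) by [].
apply/funext => n.
have aT : alg setT by rewrite -setC0; apply: algC; exact: sigma_algebra0.
have := @marks_integral_cond n [::] setT erefl aT (fun k => ltac:(by [])).
have IE (u : nat -> T -> \bar R) : \int[P]_t ((\1_setT t)%:E *
    (\prod_(k <- [::]) u k t * \prod_(0 <= k < n | t \in E k) u k t)) =
    \int[P]_t \prod_(0 <= k < n | t \in E k) u k t.
  by apply: eq_integral => t _; rewrite indicT big_nil !mul1e.
rewrite (IE (fun k t => h (A k t, w k t))) (IE (fun k t => hG (s k t, w k t))) => ->.
by apply: eq_integral => t _; apply: eq_bigr => k _; rewrite ehG.
Qed.

End marking.

Lemma integral_probability_cst d (T : measurableType d) (R : realType)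
    (P : probability T R) (c : \bar R) : \int[P]_t c = c.
Proof.
rewrite (integral_cst P measurableT c) -[RHS]mule1; congr (_ * _).
exact: probability_setT.
Qed.

(** * Compound sums with a random number of independent terms *)

Section compound.
Context (R : realType) dV dW (V : measurableType dV) (W : measurableType dW)
  (dT : measure_display) (T : measurableType dT) (P : probability T R)
  (xi : {mfun T >-> nat}) (X : nat -> {mfun T >-> V})
  (w : nat -> {mfun T >-> W}) (nuX : probability V R) (nuW : probability W R).
Hypotheses (lawX : forall k C, measurable C -> P (X k @^-1` C) = nuX C)
  (laww : forall k D, measurable D -> P (w k @^-1` D) = nuW D)
  (indep : mutually_independent P (compound_algebras xi X w)).

Let compound_rectangle n (J : seq nat) (C : nat -> set V) (D : nat -> set W) :
  uniq J -> (forall k, measurable (C k)) -> (forall k, measurable (D k)) ->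
  P ((xi @^-1` [set n] `&` \big[setI/setT]_(k <- J) (w k @^-1` D k)) `&`
     \big[setI/setT]_(k <- J) (X k @^-1` C k)) =
  P (xi @^-1` [set n]) * \prod_(k <- J) (nuX (C k) * nuW (D k)).
Proof.
move=> uJ mC mD.
(* The joint event uses the count, the jumps and the locations at once; [L] lists the indices of all
   these variables in the single independent family. *)
pose L : seq (option (nat + nat)) :=
  None :: [seq Some (inl k) | k <- J] ++ [seq Some (inr k) | k <- J].
pose F (i : option (nat + nat)) := match i with
  | None => xi @^-1` [set n]
  | Some (inl k) => X k @^-1` C k
  | Some (inr k) => w k @^-1` D k end.
have uL : uniq L.
  rewrite /= cat_uniq !map_inj_uniq ?uJ//=; try by move=> i j [].
  rewrite andbT mem_cat negb_or; apply/andP; split.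
  - by apply/andP; split; apply/negP => /mapP[].
  - by apply/hasPn => _ /mapP[k _ ->]; apply/negP => /mapP[].
have := indep uL (E := F); rewrite /L !big_cons !big_cat !big_map/= => H.
rewrite -setIA [X in _ `&` X]setIC H.
  rewrite big_split/=; congr (_ * (_ * _)).
  - by apply: eq_bigr => k _; rewrite lawX.
  - by apply: eq_bigr => k _; rewrite laww.
by case=> [[k|k]|] /=; [exists (C k)|exists (D k)|exists [set n]] => //; rewrite setTI.
Qed.

Variable f : V * W -> \bar R.
Hypotheses (mf : measurable_fun setT f) (f0 : forall y, 0 <= f y).

Let m := \int[nuX \x nuW]_y expeR (- f y).

Let h01 y : 0 <= expeR (- f y) <= 1. Proof. exact: expeRN01. Qed.

Let mh : measurable_fun setT (fun y => expeR (- f y)).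
Proof. by apply: measurableT_comp measurable_expeR _; exact: measurableT_comp. Qed.

Let mxi n : measurable (xi @^-1` [set n]).
Proof. by rewrite -[X in measurable X]setTI; exact: measurable_funP. Qed.

Let mXw k : measurable_fun setT (fun t => (X k t, w k t)).
Proof. exact: measurable_fun_pair. Qed.

Let nuXW_setT : (nuX \x nuW) setT = 1.
Proof.
rewrite -setXTT product_measure1E//= -[RHS]mule1.
by congr (_ * _); exact: probability_setT.
Qed.

Let nuXW_le1 : (nuX \x nuW) setT <= 1. Proof. by rewrite nuXW_setT. Qed.

(** The indicator of [xi = n] is the weight on one side and the constant [P(xi = n)] on the other,
    so independence from the count comes together with that of the terms. *)
Let compound_count n :
  \int[P]_(t in xi @^-1` [set n]) expeR (- \sum_(0 <= k < n) f (X k t, w k t)) =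
  P (xi @^-1` [set n]) * \prod_(0 <= k < n) m.
Proof.
rewrite integral_indicM.
have m1 : measurable_fun setT (fun t => (\1_(xi @^-1` [set n]) t)%:E : \bar R).
  exact: measurable_indicE.
have Pxi01 (t : T) : 0 <= (cst (P (xi @^-1` [set n])) t : \bar R) <= 1.
  by rewrite /= measure_ge0/= probability_le1.
have := integral_prod_kernel_eq (P1 := P) (P2 := P)
  (measurable_prod_measurableType _ _) (@rectanglesI _ _ _ _)
  (@rectanglesT _ _ _ _) (J := index_iota 0 n)
  (K1 := fun k t => \d_(X k t, w k t))
  (K2 := fun k t => (nuX \x nuW : measure _ R))
  (iota_uniq _ _) _ _ _ _ m1 (measurable_cst (P (xi @^-1` [set n])))
  (indic01 R _) Pxi01 _ (fun=> mh) (fun=> h01).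
move=> H.
transitivity (\int[P]_t ((\1_(xi @^-1` [set n]) t)%:E *
    \prod_(0 <= k < n) \int[\d_(X k t, w k t)]_y expeR (- f y))).
  apply: eq_integral => t _; congr (_ * _); rewrite expeRN_sum//.
  by apply: eq_bigr => k _; rewrite integral_dirac// diracT mul1e.
rewrite H.
- by rewrite /= integral_probability_cst.
- by move=> k S mS; exact: (measurableT_comp (measurable_fun_dirac mS) (mXw k)).
- by move=> k S mS; exact: measurable_cst.
- by move=> k t; rewrite /= diracT.
- by move=> k t; exact: nuXW_le1.
move=> S RS.
have /choice[CD CDE] : forall k, exists CD : set V * set W,
    [/\ measurable CD.1, measurable CD.2 & CD.1 `*` CD.2 = S k].
  by move=> k; have [C mC [D mD CDS]] := RS k; exists (C, D).
have mC k : measurable (CD k).1 by case: (CDE k).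
have mD k : measurable (CD k).2 by case: (CDE k).
have SE k : S k = (CD k).1 `*` (CD k).2 by case: (CDE k).
rewrite /= integral_probability_cst [RHS](_ : _ = P (xi @^-1` [set n]) *
    \prod_(0 <= k < n) (nuX (CD k).1 * nuW (CD k).2)); last first.
  by congr (_ * _); apply: eq_bigr => k _; rewrite SE product_measure1E.
rewrite -compound_rectangle ?iota_uniq// -[X in P X]setIT.
have mbig (dY : measure_display) (Y : measurableType dY) (x : nat -> {mfun T >-> Y}) B :
    (forall k, measurable (B k)) ->
    measurable (\big[setI/setT]_(0 <= k < n) (x k @^-1` B k)).
  move=> mB; apply: bigsetI_measurable => k _.
  by rewrite -[X in measurable X]setTI; exact: measurable_funP.
rewrite -(integral_indic P measurableT); last first.
  by apply: measurableI; [apply: measurableI|]; [|exact: mbig..].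
apply: eq_integral => t _; rewrite !indicI !EFinM -muleA; congr (_ * _).
rewrite -(prode_indic R (index_iota 0 n) (fun k => w k @^-1` (CD k).2) t).
rewrite -(prode_indic R (index_iota 0 n) (fun k => X k @^-1` (CD k).1) t).
rewrite -big_split/=; apply: eq_bigr => k _.
by rewrite SE /= diracX muleC.
Qed.

(** On [xi = n] exactly the first [n] atoms exist; summing over [n] gives the generating function of
    [xi] at the mean [m] of [exp(- f)]. *)
Lemma laplace_compound :
  \int[P]_t expeR (- \int[atoms (fun k => [set t | (k < xi t)%N])
                            (fun k t => (X k t, w k t)) t]_y f y) =
  \sum_(n <oo) ((fine m ^+ n)%:E * P (xi @^-1` [set n])).
Proof.
have mxiE k : measurable [set t | (k < xi t)%N].
  rewrite -[X in measurable X]setTI.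
  have mx : measurable_fun setT xi by [].
  exact: (mx measurableT [set n | (k < n)%N] I).
have mN S : measurable S -> measurable_fun setT
    (fun t => atoms (R := R) (fun k => [set t | (k < xi t)%N])
                            (fun k t => (X k t, w k t)) t S).
  exact: measurable_atoms.
rewrite (integral_ae_partition (F := fun n => xi @^-1` [set n]))//.
- apply: eq_eseriesr => n _.
  have mfin : m \is a fin_num.
    by apply: fin_num01; apply: integral01 => //; exact: nuXW_le1.
  rewrite (_ : (fine m ^+ n)%:E = \prod_(0 <= k < n) m); last first.
    rewrite big_const_nat subn0 -[m in RHS]fineK//.
    by elim: n => //= n <-; rewrite exprS EFinM.
  rewrite muleC -compound_count; apply: eq_integral => t /set_mem xin.
  rewrite integral_atoms// eseries_mkcond.
  congr (expeR (- _)).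
  rewrite (nneseries_split 0 n); last by move=> k _; case: ifP.
  rewrite add0n eseries0 ?adde0; last first.
    by move=> k nk _; rewrite memNset//= xin ltnNge nk.
  rewrite big_nat_cond [RHS]big_nat_cond; apply: eq_bigr => k.
  by move=> /andP[/andP[_ kn] _]; rewrite mem_set//= xin.
- by move=> i j _ _ [t [/= -> ->]].
- rewrite [X in P X](_ : _ = setT) ?probability_setT//.
  by apply/seteqP; split => // t _; exists (xi t).
- apply: measurableT_comp measurable_expeR _; apply: measurableT_comp => //.
  exact: measurable_fun_integral_kernel.
- by move=> t; exact: expeR_ge0.
Qed.

End compound.

(** * Jump laws *)

Lemma integral_onem d (T : measurableType d) (R : realType)
    (m : {measure set T -> \bar R}) (h : T -> \bar R) :
  m setT = 1 -> measurable_fun setT h -> (forall t, 0 <= h t <= 1) ->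
  \int[m]_t (1 - h t) = 1 - \int[m]_t h t.
Proof.
move=> m1 mh h01.
have h0 t : 0 <= h t by case/andP: (h01 t).
have hfin t : h t \is a fin_num by exact: fin_num01.
have ifin : \int[m]_t h t \is a fin_num.
  by apply: fin_num01; apply: integral01 => //; rewrite m1.
have h0' t : 0 <= 1 - h t by have /andP[_ ht1] := h01 t; rewrite sube_ge0 ?hfin ?orbT.
have mh' : measurable_fun setT (fun t => 1 - h t).
  by apply: emeasurable_funB.
rewrite -[LHS](addeK _ ifin).
rewrite -(ge0_integralD m measurableT (fun t _ => h0' t) mh' (fun t _ => h0 t) mh).
congr (_ - _); rewrite -[RHS]m1 -[RHS]mul1e -(integral_cst m measurableT).
by apply: eq_integral => t _; rewrite subeK.
Qed.

Lemma measurable_zerov (R : realType) n : measurable [set zerov R n].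
Proof.
have -> : [set zerov R n] = \bigcap_(i in [set: 'I_n]) [set s : 'R[R]^n | tnth s i = 0%R].
  apply/seteqP; split => s /=.
    by move=> -> i _ /=; rewrite tnth_mktuple.
  by move=> s0; apply: eq_from_tnth => i; rewrite tnth_mktuple; exact: s0.
apply: fin_bigcap_measurable => // i _.
rewrite -[X in measurable X]setTI.
exact: (@measurable_tnth _ (measurableTypeR R) n i measurableT [set 0%R]
  (measurable_set1 0%R)).
Qed.

Arguments measurable_zerov : clear implicits.

Lemma measurable_orthant (R : realType) n : measurable (orthant R n).
Proof.
have -> : orthant R n = \bigcap_(i in [set: 'I_n]) [set s : 'R[R]^n | (0 <= tnth s i)%R].
  by apply/seteqP; split => s /= s0 i; [move=> _; exact: s0|exact: s0].
apply: fin_bigcap_measurable => // i _.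
rewrite (_ : [set s | _] = (fun s : 'R[R]^n => tnth s i) @^-1` `[0%R, +oo[%classic); last first.
  by apply/seteqP; split => s /=; rewrite in_itv/= andbT.
rewrite -[X in measurable X]setTI.
by apply: (@measurable_tnth _ (measurableTypeR R) n i measurableT) => //.
Qed.

Section jumps.
Context (R : realType) (q upsilon : nat) (d : measure_display)
  (Omega : measurableType d) (G : R.-pker 'R[R]^q ~> 'R[R]^upsilon)
  (rho : {sigma_finite_measure set 'R[R]^q -> \bar R})
  (B0 : probability Omega R).

Local Notation O := (zerov R upsilon).

Let G01 s A : measurable A -> 0 <= G s A <= 1.
Proof.
move=> mA; rewrite measure_ge0/= (le_trans _ (sprob_kernel_le1 G s))//.
by rewrite le_measure ?inE.
Qed.

Lemma pi_AE s : (pi_A G s)%:E = G s (~` [set O]).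
Proof.
have mO := measurable_zerov R upsilon.
rewrite /pi_A EFinB fineK ?fin_num01 ?G01// -setTD.
rewrite (measureD measurableT mO) ?setTI.
  by congr (_ - _); apply/esym; exact: prob_kernel.
exact: le_lt_trans (sprob_kernel_le1 G s) (ltry 1).
Qed.

Lemma pi_A01 s : 0 <= (pi_A G s)%:E <= 1.
Proof. by rewrite pi_AE G01//; apply: measurableC; exact: measurable_zerov. Qed.

Lemma measurable_pi_A : measurable_fun setT (fun s => (pi_A G s)%:E).
Proof.
under eq_fun do rewrite pi_AE.
by apply: measurable_kernel; apply: measurableC; exact: measurable_zerov.
Qed.

Hypothesis rho_orthant : rho (~` orthant R q) = 0.

Lemma integral_orthant (f : 'R[R]^q -> \bar R) : measurable_fun setT f ->
  (forall s, 0 <= f s) ->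
  \int[rho]_(s in orthant R q) f s = \int[rho]_s f s.
Proof.
move=> mf f0; rewrite [RHS](@ge0_negligible_integral _ _ _ rho setT (~` orthant R q))//.
- by rewrite setTD setCK.
- by apply: measurableC; exact: measurable_orthant.
Qed.

Lemma varphiE : varphi G rho = \int[rho]_s (pi_A G s)%:E.
Proof.
rewrite /varphi integral_orthant//; first exact: measurable_pi_A.
by move=> s; case/andP: (pi_A01 s).
Qed.

Hypotheses (phi_gt0 : 0 < varphi G rho) (phi_fin : varphi G rho < +oo).

Let c := fine (varphi G rho).

Let cE : c%:E = varphi G rho.
Proof. by rewrite fineK// ge0_fin_numE// ltW. Qed.

Let c_gt0 : (0 < c)%R. Proof. by rewrite -lte_fin cE. Qed.

Lemma measurable_inv_pi_A :
  measurable_fun setT (fun s => ((pi_A G s)^-1)%:E : \bar R).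
Proof.
have pi0 s : (0 <= pi_A G s)%R by rewrite -lee_fin; case/andP: (pi_A01 s).
under eq_fun do rewrite -(powR_inv1 (pi0 _)).
apply/measurable_EFinP; apply: (measurableT_comp (measurable_powR _)).
by have /measurable_EFinP := measurable_pi_A.
Qed.

Section jump_pair.
Context (dT : measure_display) (T : measurableType dT) (P : probability T R)
  (H : {mfun T >-> 'R[R]^q}) (X : {mfun T >-> 'R[R]^upsilon}).

Section jump_location.
Hypothesis law_location : forall D, measurable D ->
  distribution P H D =
  \int[rho]_(s in D `&` orthant R q) ((pi_A G s)%:E * (c^-1)%:E).

Let lawH S : measurable S ->
  c%:E * distribution P H S = \int[rho]_s ((pi_A G s)%:E * \d_s S).
Proof.
move=> mS; rewrite law_location//.
have pi0 s : 0 <= (pi_A G s)%:E by case/andP: (pi_A01 s).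
have ci0 : 0 <= (c^-1)%:E by rewrite lee_fin invr_ge0 ltW.
have c0 : 0 <= c%:E by rewrite lee_fin ltW.
have mpi : measurable_fun setT (fun s => (pi_A G s)%:E * (c^-1)%:E).
  by apply: emeasurable_funM => //; exact: measurable_pi_A.
have F0 s : 0 <= (\1_S s)%:E * ((pi_A G s)%:E * (c^-1)%:E).
  by rewrite !mule_ge0// lee_fin.
have mF : measurable_fun setT (fun s => (\1_S s)%:E * ((pi_A G s)%:E * (c^-1)%:E)).
  by apply: emeasurable_funM => //; exact: measurable_indicE.
have -> : \int[rho]_(s in S `&` orthant R q) ((pi_A G s)%:E * (c^-1)%:E) =
    \int[rho]_s ((\1_S s)%:E * ((pi_A G s)%:E * (c^-1)%:E)).
  rewrite setIC integral_mkcondr epatch_indic -[RHS]integral_orthant//.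
  by apply: eq_integral => s _; rewrite muleC.
rewrite -(ge0_integralZl rho measurableT mF (fun s _ => F0 s) c0).
apply: eq_integral => s _; rewrite diracE muleCA [RHS]muleC -indicE.
by congr (_ * _); rewrite muleCA -!EFinM mulfV ?gt_eqF// mulr1.
Qed.

Lemma integral_jump_location (F : 'R[R]^q -> \bar R) : measurable_fun setT F ->
  (forall s, 0 <= F s) ->
  c%:E * \int[distribution P H]_s F s = \int[rho]_s ((pi_A G s)%:E * F s).
Proof.
move=> mF F0.
have m1 S : measurable S -> measurable_fun setT (fun s : 'R[R]^q => \d_s S : \bar R).
  by move=> mS; exact: measurable_fun_dirac.
have c0 : (0 <= c)%R by exact: ltW.
transitivity (\int[mscale (NngNum c0) (distribution P H)]_s F s).
  by rewrite ge0_integral_mscale.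
rewrite (integral_mixture (mu := rho) measurable_pi_A pi_A01 m1)//.
apply: eq_integral => s _; congr (_ * _).
by rewrite integral_dirac// diracT mul1e.
Qed.

Lemma integral_jump_location_kernel D C : measurable D -> measurable C ->
  c%:E * \int[distribution P H]_(s in D)
           (G s (C `\` [set O]) * ((pi_A G s)^-1)%:E) =
  \int[rho]_s ((\1_D s)%:E * G s (C `\` [set O])).
Proof.
move=> mD mC.
have mCO : measurable (C `\` [set O]).
  by apply: measurableD => //; exact: measurable_zerov.
have pi0 s : (0 <= pi_A G s)%R by rewrite -lee_fin; case/andP: (pi_A01 s).
have mF : measurable_fun setT (fun s => G s (C `\` [set O]) * ((pi_A G s)^-1)%:E).
  apply: emeasurable_funM; [exact: measurable_kernel|exact: measurable_inv_pi_A].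
rewrite integral_indicM integral_jump_location//; last 2 first.
- by apply: emeasurable_funM => //; exact: measurable_indicE.
- by move=> s; rewrite !mule_ge0// lee_fin ?invr_ge0.
apply: eq_integral => s _; rewrite muleCA; congr (_ * _).
rewrite muleC -muleA -EFinM.
(* Where [pi_A] vanishes its inverse is zero by convention, and the cancellation fails; but there
   [G s] does not charge nonzero jumps, so both sides are zero. *)
have [pis0|pis] := eqVneq (pi_A G s) 0%R; last by rewrite mulVf// mule1.
rewrite pis0 mulr0 mule0; apply/esym/eqP; rewrite eq_le measure_ge0 andbT.
have sCO : C `\` [set O] `<=` ~` [set O] by move=> a [].
rewrite -[0]/(0%R%:E) -pis0 pi_AE le_measure ?inE//.
by apply: measurableC; exact: measurable_zerov.
Qed.

End jump_location.

Hypothesis HX : is_jump_pair G rho P H X.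

Lemma law_jump C : measurable C ->
  c%:E * P (X @^-1` C) = \int[rho]_s G s (C `\` [set O]).
Proof.
move=> mC.
have := HX.2 setT C measurableT mC; rewrite preimage_setT setTI => ->.
rewrite (integral_jump_location_kernel HX.1)//.
by apply: eq_integral => s _; rewrite indicT mul1e.
Qed.

(** Multiplying by [varphi] removes the normalisations of the jump pair, leaving [G] restricted to
    nonzero jumps (the kernel [K] below) and mixed over [rho]. The condition [g O = 0] makes the
    restriction invisible. *)
Lemma integral_jump (g : 'R[R]^upsilon -> \bar R) : measurable_fun setT g ->
  (forall a, 0 <= g a) -> g O = 0 ->
  c%:E * \int[distribution P X]_a g a = \int[rho]_s \int[G s]_a g a.
Proof.
move=> mg g0 gO.
have mO : measurable (~` [set O]) by apply: measurableC; exact: measurable_zerov.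
have c0 : (0 <= c)%R by exact: ltW.
have m1 S : measurable S -> measurable_fun setT (fun a : 'R[R]^upsilon => \d_a S : \bar R).
  by move=> mS; exact: measurable_fun_dirac.
have m1O : measurable_fun setT (fun a => (\1_(~` [set O]) a)%:E : \bar R).
  exact: measurable_indicE.
pose K s : {measure set 'R[R]^upsilon -> \bar R} :=
  mixture (G s) m1O (indic01 R (~` [set O])) m1.
have KE s S : measurable S -> K s S = G s (S `\` [set O]).
  move=> mS; rewrite /K /= /mixture setDE setIC -[in RHS](setIT (_ `&` S)).
  rewrite -integral_indic//; last exact: measurableI.
  by apply: eq_integral => a _; rewrite indicI EFinM /= diracE indicE.
have mK S : measurable S -> measurable_fun setT (K ^~ S).
  move=> mS; under eq_fun do rewrite KE//.
  by apply: measurable_kernel; apply: measurableD => //; exact: measurable_zerov.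
have one01 (s : 'R[R]^q) : 0 <= (cst 1 s : \bar R) <= 1 by rewrite /= lee01 lexx.
transitivity (\int[mscale (NngNum c0) (distribution P X)]_a g a).
  by rewrite ge0_integral_mscale.
rewrite (integral_mixture (mu := rho) (measurable_cst (1 : \bar R)) one01 mK)//.
- apply: eq_integral => s _; rewrite mul1e.
  rewrite (integral_mixture (mu := G s) m1O (indic01 R (~` [set O])) m1)//.
  apply: eq_integral => a _; rewrite integral_dirac// diracT mul1e indicE in_setC.
  have [/set_mem/= ->|_] := boolP (a \in [set O]); first by rewrite gO mul0e.
  by rewrite mul1e.
- move=> S mS; transitivity (c%:E * P (X @^-1` S)) => //.
  rewrite law_jump//; apply: eq_integral => s _.
  by rewrite mul1e KE.
Qed.

End jump_pair.

End jumps.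

(** * The common Laplace functional of the two representations *)

Section laplace.
Context (R : realType) (q upsilon : nat) (d : measure_display)
  (Omega : measurableType d) (G : R.-pker 'R[R]^q ~> 'R[R]^upsilon)
  (rho : {sigma_finite_measure set 'R[R]^q -> \bar R})
  (B0 : probability Omega R) (f : 'R[R]^upsilon * Omega -> \bar R).
Hypotheses (mf : measurable_fun setT f) (f0 : forall y, 0 <= f y).

Let h01 y : 0 <= expeR (- f y) <= 1. Proof. exact: expeRN01. Qed.

Let mh : measurable_fun setT (fun y => expeR (- f y)).
Proof. by apply: measurableT_comp measurable_expeR _; exact: measurableT_comp. Qed.

Let mhx (o : Omega) : measurable_fun setT (fun a => expeR (- f (a, o))).
Proof. by apply: (measurableT_comp mh); exact: measurable_fun_pair. Qed.

Let hG01 (x : 'R[R]^q * Omega) :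
  0 <= \int[G x.1]_a expeR (- f (a, x.2)) <= 1.
Proof. by apply: integral01 => //; exact: sprob_kernel_le1. Qed.

Let mhG : measurable_fun setT
  (fun x : 'R[R]^q * Omega => \int[G x.1]_a expeR (- f (a, x.2))).
Proof.
apply: (measurable_integral_kprecomp G
  (k := fun xa : ('R[R]^q * Omega) * 'R[R]^upsilon =>
          expeR (- f (xa.2, xa.1.2)))).
- exact: measurable_fst.
- apply: (measurableT_comp mh); apply: measurable_fun_pair => //.
  by apply: measurableT_comp; [exact: measurable_snd|exact: measurable_fst].
- by move=> [x a]; exact: expeR_ge0.
Qed.

Lemma laplace_IBP (dT : measure_display) (T : measurableType dT)
  (P : probability T R) (E : nat -> set T) (s : nat -> {mfun T >-> 'R[R]^q})
  (w : nat -> {mfun T >-> Omega}) (A : nat -> {mfun T >-> 'R[R]^upsilon}) :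
  (forall k, measurable (E k)) ->
  poisson_random_measure P (rho \x B0)
    (atom_measure R T _ _ E (fun k t => (s k t, w k t))) ->
  conditionally_marked G P E s w A ->
  \int[P]_t expeR (- \int[atoms E (fun k t => (A k t, w k t)) t]_y f y) =
  expeR (- \int[rho \x B0]_x (1 - \int[G x.1]_a expeR (- f (a, x.2)))).
Proof.
move=> mE prm cm; rewrite (laplace_marking mE cm)//.
have prm' : poisson_random_measure P (rho \x B0)
    (fun t => atoms (R := R) E (fun k t => (s k t, w k t)) t).
  rewrite (_ : (fun t => _) = atom_measure R T _ _ E (fun k t => (s k t, w k t)))//.
  by apply/funext => t; apply/funext => B; exact: atomsE.
rewrite (laplace_poisson_random_measure prm').
- congr (expeR (- _)); apply: eq_integral => x _; congr (_ - _).
  by rewrite oppeK; apply/eqP; rewrite lneK_eq; case/andP: (hG01 x).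
- by apply: measurableT_comp => //; exact: measurableT_comp (@measurable_lne R) mhG.
- move=> x; rewrite leeNr oppe0 -lee_expeR expeR0.
  have /andP[hG0 hG1] := hG01 x.
  by rewrite (_ : expeR _ = \int[G x.1]_a expeR (- f (a, x.2)))//; apply/eqP; rewrite lneK_eq.
Qed.

Lemma laplace_compound_data (dT : measure_display) (T : measurableType dT)
  (P : probability T R) (xi : {mfun T >-> nat})
  (H : nat -> {mfun T >-> 'R[R]^q}) (X : nat -> {mfun T >-> 'R[R]^upsilon})
  (w : nat -> {mfun T >-> Omega}) :
  rho (~` orthant R q) = 0 -> 0 < varphi G rho -> varphi G rho < +oo ->
  (forall o, f (zerov R upsilon, o) = 0) ->
  compound_data G rho B0 P xi H X w ->
  \int[P]_t expeR (- \int[atoms (fun k => [set t | (k < xi t)%N])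
                            (fun k t => (X k t, w k t)) t]_y f y) =
  expeR (- \int[rho \x B0]_x (1 - \int[G x.1]_a expeR (- f (a, x.2)))).
Proof.
move=> rho0 phi_gt0 phi_fin fO [lawxi HX _ laww indep].
pose nuX : probability 'R[R]^upsilon R := distribution P (X 0%N).
have cE : (fine (varphi G rho))%:E = varphi G rho.
  by rewrite fineK// ge0_fin_numE// ltW.
have c_gt0 : (0 < fine (varphi G rho))%R by rewrite -lte_fin cE.
(* Being a jump pair determines the law of the jump, so the first jump can serve as reference for
   all. *)
have lawX k C : measurable C -> P (X k @^-1` C) = nuX C.
  move=> mC.
  have := law_jump rho0 phi_gt0 phi_fin (HX k) mC.
  rewrite -(law_jump rho0 phi_gt0 phi_fin (HX 0%N) mC).
  move=> /(congr1 (fun x => ((fine (varphi G rho))^-1)%:E * x)).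
  by rewrite !muleA -!EFinM mulVf ?gt_eqF// !mul1e.
rewrite (laplace_compound (nuX := nuX) (nuW := B0) lawX laww indep)//.
set m := \int[nuX \x B0]_y _.
have nu1 : (nuX \x B0) setT = 1.
  rewrite -setXTT product_measure1E//= -[RHS]mule1.
  by congr (_ * _); exact: probability_setT.
have nu1' : (nuX \x B0) setT <= 1 by rewrite nu1.
have /andP[m0 m1] : 0 <= m <= 1 by exact: integral01.
have mfin : m \is a fin_num by apply: fin_num01; rewrite m0.
have := poisson_generating_function (ltW c_gt0) (fine_ge0 m0).
under eq_eseriesr do rewrite -lawxi.
move=> ->; rewrite -[LHS]/(expeR (- (_ * _))%:E) EFinN; congr (expeR (- _)).
rewrite EFinM EFinB cE (fineK mfin).
rewrite -[1 - m](integral_onem nu1)//.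
have h'0 y : 0 <= 1 - expeR (- f y).
  by have /andP[_ hy] := h01 y; rewrite sube_ge0 ?(fin_num01 (h01 y)) ?orbT.
have mh' : measurable_fun setT (fun y => 1 - expeR (- f y)).
  by apply: emeasurable_funB.
have mhG' : measurable_fun setT (fun x : 'R[R]^q * Omega =>
    1 - \int[G x.1]_a expeR (- f (a, x.2))).
  by apply: emeasurable_funB.
have hG'0 (x : 'R[R]^q * Omega) : 0 <= 1 - \int[G x.1]_a expeR (- f (a, x.2)).
  by have /andP[_ hx] := hG01 x; rewrite sube_ge0 ?(fin_num01 (hG01 x)) ?orbT.
have mh'o (o : Omega) : measurable_fun setT (fun a => 1 - expeR (- f (a, o))).
  by apply: (measurableT_comp mh'); exact: measurable_fun_pair.
(* On both sides the location is made the outer variable: for fixed [o] the identity between jump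
   integrals applies to [1 - exp(- f(a, o))], which vanishes at the null jump. *)
rewrite (fubini_tonelli2 (m1 := nuX) (m2 := B0) _ mh' h'0)
  (fubini_tonelli2 (m1 := rho) (m2 := B0) _ mhG' hG'0).
rewrite /fubini_G -cE -ge0_integralZl//; last 3 first.
- exact: (@measurable_fun_fubini_tonelli_G _ _ _ _ _ nuX _ mh' h'0).
- by move=> o _; exact: integral_ge0.
- by rewrite lee_fin ltW.
apply: eq_integral => o _.
rewrite (integral_jump rho0 phi_gt0 phi_fin (HX 0%N))//; last first.
  by rewrite fO oppe0 expeR0 subee.
apply: eq_integral => s _; rewrite integral_onem//.
exact: prob_kernel.
Qed.

End laplace.

(** Cancel the first [n] terms and divide by [z ^ n]: as [z] tends to zero only the coefficient of
    index [n] survives. One inequality suffices, the roles of [a] and [b] being exchangeable. *)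
Lemma laplace_coef_le (R : realType) (a b : nat -> \bar R) (n : nat) :
  (forall i, 0 <= a i) -> (forall i, 0 <= b i) ->
  \sum_(i <oo) a i <= 1 -> \sum_(i <oo) b i <= 1 ->
  (forall z : R, (0 < z < 1)%R ->
     \sum_(i <oo) ((z ^+ i)%:E * a i) = \sum_(i <oo) ((z ^+ i)%:E * b i)) ->
  (forall i, (i < n)%N -> a i = b i) -> a n <= b n.
Proof.
move=> a0 b0 a1 b1 ab abn; apply/lee_addgt0Pr => e e0.
(* The tail of the [b] series beyond [n] is at most [z ^ n * z], hence [z <= e]; the bound [1/2]
   keeps [z] below one. *)
pose z := (Num.min e 2^-1)%R.
have z0 : (0 < z)%R by rewrite lt_min e0/= invr_gt0 ltr0n.
have z1 : (z < 1)%R by rewrite gt_min invf_lt1 ?ltr0n// ltr1n orbT.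
have zE k : 0 <= (z ^+ k)%:E by rewrite lee_fin exprn_ge0// ltW.
have term_fin (c : nat -> \bar R) k : (forall i, 0 <= c i) ->
    \sum_(i <oo) c i <= 1 -> c k \is a fin_num.
  move=> c0 c1; apply: fin_num01; rewrite c0/= (le_trans _ c1)//.
  rewrite (le_trans _ (nneseries_lim_ge k.+1 _))//.
  by rewrite big_nat_recr//= leeDr// sume_ge0.
have := ab z; rewrite z0 z1 => /(_ isT).
have za0 k : 0 <= (z ^+ k)%:E * a k by rewrite mule_ge0.
have zb0 k : 0 <= (z ^+ k)%:E * b k by rewrite mule_ge0.
rewrite (nneseries_split 0 n)// [in RHS](nneseries_split 0 n)// !add0n.
have -> : \sum_(0 <= k < n) ((z ^+ k)%:E * a k) = \sum_(0 <= k < n) ((z ^+ k)%:E * b k).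
  rewrite big_nat_cond [RHS]big_nat_cond; apply: eq_bigr => i /andP[/andP[_ ni] _].
  by rewrite abn.
have sfin : \sum_(0 <= k < n) ((z ^+ k)%:E * b k) \is a fin_num.
  by elim/big_rec: _ => // k x _ xfin; rewrite fin_numD xfin fin_numM ?term_fin.
set S := \sum_(0 <= k < n) _ in sfin *.
move=> /(congr1 (fun x => x - S)); rewrite ![S + _]addeC !addeK// => tails.
have zn0 : (0 < z ^+ n)%R by rewrite exprn_gt0.
rewrite -(@lee_pmul2l _ (z ^+ n)%:E) ?lte_fin//.
apply: (@le_trans _ _ (\sum_(n <= k <oo) ((z ^+ k)%:E * a k))).
  rewrite (nneseries_split n 1)// addn1 big_nat1.
  by rewrite leeDl// nneseries_ge0.
rewrite tails (nneseries_split n 1)// addn1 big_nat1 ge0_muleDr ?lee_fin ?(ltW e0)//.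
rewrite leeD2l// ?fin_numM ?term_fin//.
apply: (@le_trans _ _ (\sum_(n.+1 <= k <oo) ((z ^+ n.+1)%:E * b k))).
  rewrite [leLHS]eseries_cond [leRHS]eseries_cond.
  apply: lee_nneseries => [k _ _|k /andP[_ nk]]; first exact: zb0.
  by rewrite lee_wpmul2r// lee_fin ler_wiXn2l ?(ltW z0) ?(ltW z1).
rewrite nneseriesZl// exprSr EFinM -muleA lee_wpmul2l//.
apply: (@le_trans _ _ (z%:E * 1)).
  rewrite lee_wpmul2l ?lee_fin ?(ltW z0)// (le_trans _ b1)//.
  rewrite [leRHS](nneseries_split 0 n.+1)// add0n leeDr// sume_ge0//.
by rewrite mule1 lee_fin ge_min lexx.
Qed.

(** * Laws of counting variables *)

Section counts.
Context {R : realType}.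

Definition count_valued (x : \bar R) := (exists n, x = n%:R%:E) \/ x = +oo.

Section decomposition.
Context d (T : measurableType d) (P : probability T R) (N : T -> \bar R)
  (g : T -> \bar R).
Hypotheses (mN : measurable_fun setT N) (cN : forall t, count_valued (N t))
  (mg : measurable_fun setT g) (g01 : forall t, 0 <= g t <= 1).

Local Notation c x :=
  (\int[P]_t (g t * (\1_(N @^-1` [set (x%E : \bar R)]) t)%:E)).

Let c_ge0 x : 0 <= c x.
Proof.
by apply: integral_ge0 => t _; case/andP: (mule01 (g01 t) (indic01 R (N @^-1` [set x]) t)).
Qed.

Let mNE C : measurable C -> measurable (N @^-1` C).
Proof. by move=> mC; rewrite -[X in measurable X]setTI; exact: mN. Qed.

Lemma integral_count (phi : \bar R -> \bar R) : measurable_fun setT phi ->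
  (forall x, 0 <= phi x) ->
  \int[P]_t (g t * phi (N t)) =
  phi +oo * c +oo + \sum_(n <oo) (phi n%:R%:E * c n%:R%:E).
Proof.
move=> mphi phi0.
have g0 t : 0 <= g t by case/andP: (g01 t).
have mgphi : measurable_fun setT (fun t => g t * phi (N t)).
  by apply: emeasurable_funM => //; exact: measurableT_comp.
have gphi0 t : 0 <= g t * phi (N t) by rewrite mule_ge0.
have mNx x : measurable (N @^-1` [set x]) by exact: mNE (emeasurable_set1 x).
have intx x : \int[P]_(t in N @^-1` [set x]) (g t * phi (N t)) = phi x * c x.
  have mg1 : measurable_fun setT (fun t => g t * (\1_(N @^-1` [set x]) t)%:E).
    by apply: emeasurable_funM => //; exact: measurable_indicE.
  have g10 t : 0 <= g t * (\1_(N @^-1` [set x]) t)%:E by rewrite mule_ge0// lee_fin.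
  rewrite integral_indicM -(ge0_integralZl P measurableT mg1 (fun t _ => g10 t) (phi0 x)).
  apply: eq_integral => t _; rewrite indicE.
  have [/set_mem/= ->|_] := boolP (t \in _); last by rewrite mul0e !mule0.
  by rewrite mul1e mule1 muleC.
have TE : setT = N @^-1` [set +oo] `|` \bigcup_n (N @^-1` [set n%:R%:E]).
  apply/seteqP; split => // t _.
  by case: (cN t) => [[n Nt]|Nt]; [right; exists n|left].
transitivity (\int[P]_(t in N @^-1` [set +oo] `|`
    \bigcup_n (N @^-1` [set n%:R%:E])) (g t * phi (N t))); first by rewrite -TE.
rewrite ge0_integral_setU//.
- rewrite intx ge0_integral_bigcup//.
  + by congr (_ + _); apply: eq_eseriesr => n _; exact: intx.
  + exact: measurable_funTS.
  + by move=> i j _ _ [t [/= ->]] [] /(mulrIn (oner_neq0 R)).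
- exact: bigcupT_measurable.
- exact: measurable_funTS.
- by apply/disj_setPS => t [/= Ny] [n _ /= Nn]; rewrite Ny in Nn.
Qed.

Lemma sum_count_le1 : \sum_(n <oo) c n%:R%:E <= 1.
Proof.
have := integral_count (phi := cst 1) (measurable_cst _) (fun=> lee01).
under eq_integral do rewrite mule1.
under eq_eseriesr do rewrite mul1e.
rewrite mul1e => E.
have /andP[_ +] := integral01 (probability_le1 P measurableT) mg g01.
by rewrite E; apply: le_trans; rewrite leeDr.
Qed.

End decomposition.

Section one_count.
Context d1 d2 (T1 : measurableType d1) (T2 : measurableType d2)
  (P1 : probability T1 R) (P2 : probability T2 R)
  (N1 : T1 -> \bar R) (N2 : T2 -> \bar R)
  (g1 : T1 -> \bar R) (g2 : T2 -> \bar R).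
Hypotheses (mN1 : measurable_fun setT N1) (mN2 : measurable_fun setT N2)
  (cN1 : forall t, count_valued (N1 t)) (cN2 : forall t, count_valued (N2 t))
  (mg1 : measurable_fun setT g1) (mg2 : measurable_fun setT g2)
  (g101 : forall t, 0 <= g1 t <= 1) (g201 : forall t, 0 <= g2 t <= 1).

(** With [z = exp(- r)] and [r > 0] the transform is a power series in [z] whose coefficients are
    the weighted masses at the integers, the value [+oo] contributing nothing. These coefficients
    agree by strong induction. *)
Lemma count_law_laplace :
  (forall r : R, (0 <= r)%R ->
     \int[P1]_t (g1 t * expeR (- (r%:E * N1 t))) =
     \int[P2]_t (g2 t * expeR (- (r%:E * N2 t)))) ->
  forall C, measurable C ->
  \int[P1]_t (g1 t * (\1_C (N1 t))%:E) = \int[P2]_t (g2 t * (\1_C (N2 t))%:E).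
Proof.
move=> L C mC.
pose c1 (x : \bar R) := \int[P1]_t (g1 t * (\1_(N1 @^-1` [set x]) t)%:E).
pose c2 (x : \bar R) := \int[P2]_t (g2 t * (\1_(N2 @^-1` [set x]) t)%:E).
have E1 := integral_count P1 mN1 cN1 mg1 g101.
have E2 := integral_count P2 mN2 cN2 mg2 g201.
have me (r : R) : measurable_fun setT (fun x : \bar R => expeR (- (r%:E * x))).
  apply: measurableT_comp measurable_expeR _; apply: measurableT_comp => //.
  exact: measurable_funeM.
have e0 (r : R) x : 0 <= expeR (- (r%:E * x)) by exact: expeR_ge0.
have c1_ge0 x : 0 <= c1 x.
  by apply: integral_ge0 => t _; case/andP: (mule01 (g101 t) (indic01 R (N1 @^-1` [set x]) t)).
have c2_ge0 x : 0 <= c2 x.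
  by apply: integral_ge0 => t _; case/andP: (mule01 (g201 t) (indic01 R (N2 @^-1` [set x]) t)).
have zL (z : R) : (0 < z < 1)%R ->
    \sum_(i <oo) ((z ^+ i)%:E * c1 i%:R%:E) = \sum_(i <oo) ((z ^+ i)%:E * c2 i%:R%:E).
  move=> /andP[z0 z1].
  have r0 : (0 < - ln z)%R by rewrite oppr_gt0 ln_lt0 ?z0.
  have := L _ (ltW r0).
  rewrite (E1 _ (me (- ln z)%R) (e0 _)) (E2 _ (me (- ln z)%R) (e0 _)).
  rewrite gt0_muley ?lte_fin//= !mul0e !add0e => LE.
  have zi i : (z ^+ i)%:E = expeR (- ((- ln z)%:E * i%:R%:E)).
    by rewrite -EFinM -EFinN /= mulNr opprK expRM_natr lnK ?posrE.
  under eq_eseriesr do rewrite zi.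
  by under [in RHS]eq_eseriesr do rewrite zi.
have c12 n : c1 n%:R%:E = c2 n%:R%:E.
  elim/ltn_ind: n => n ih; apply/eqP; rewrite eq_le; apply/andP; split.
  - apply: (laplace_coef_le (a := fun i => c1 i%:R%:E) (b := fun i => c2 i%:R%:E)) => //.
    + exact: sum_count_le1.
    + exact: sum_count_le1.
  - apply: (laplace_coef_le (a := fun i => c2 i%:R%:E) (b := fun i => c1 i%:R%:E)) => //.
    + exact: sum_count_le1.
    + exact: sum_count_le1.
    + by move=> z z01; rewrite zL.
    + by move=> i /ih ->.
have c12oo : c1 +oo = c2 +oo.
  (* At [r = 0] the value [+oo] counts as well and the total masses agree; subtracting the finite
     mass of the integers leaves the mass at [+oo]. *)
  have := L 0%R (lexx _).
  rewrite (E1 _ (me 0%R) (e0 _)) (E2 _ (me 0%R) (e0 _)).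
  rewrite !mul0e oppe0 expeR0 !mul1e.
  under eq_eseriesr do rewrite mul0e oppe0 expeR0 mul1e.
  under [in RHS]eq_eseriesr do rewrite mul0e oppe0 expeR0 mul1e.
  move=> E; have {}E : c1 +oo + \sum_(n <oo) c1 n%:R%:E =
      c2 +oo + \sum_(n <oo) c2 n%:R%:E by exact: E.
  have sE : \sum_(n <oo) c1 n%:R%:E = \sum_(n <oo) c2 n%:R%:E.
    by apply: eq_eseriesr.
  have sfin : \sum_(n <oo) c2 n%:R%:E \is a fin_num.
    by apply: fin_num01; rewrite nneseries_ge0//=; exact: sum_count_le1.
  by move: E; rewrite sE => /(congr1 (fun x => x - \sum_(n <oo) c2 n%:R%:E)); rewrite !addeK.
have mi : measurable_fun setT (fun x : \bar R => (\1_C x)%:E : \bar R).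
  exact: measurable_indicE.
have i0 (x : \bar R) : 0 <= (\1_C x : R)%:E by rewrite lee_fin.
rewrite (E1 _ mi i0) (E2 _ mi i0); congr (_ * _ + _); first exact: c12oo.
by apply: eq_eseriesr => n _; congr (_ * _); exact: c12.
Qed.

End one_count.

Section joint_counts.
Context d1 d2 (T1 : measurableType d1) (T2 : measurableType d2)
  (P1 : probability T1 R) (P2 : probability T2 R) (I : eqType)
  (N1 : I -> T1 -> \bar R) (N2 : I -> T2 -> \bar R).
Hypotheses (mN1 : forall i, measurable_fun setT (N1 i))
  (mN2 : forall i, measurable_fun setT (N2 i))
  (cN1 : forall i t, count_valued (N1 i t))
  (cN2 : forall i t, count_valued (N2 i t)).

(** One count at a time is turned from an exponential into an indicator. The indicators already
    obtained and the exponentials still pending form the weight for the single-count case. *)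
Lemma joint_count_law_laplace (J : seq I) (g1 : T1 -> \bar R) (g2 : T2 -> \bar R) :
  uniq J ->
  measurable_fun setT g1 -> measurable_fun setT g2 ->
  (forall t, 0 <= g1 t <= 1) -> (forall t, 0 <= g2 t <= 1) ->
  (forall r : I -> R, (forall i, 0 <= r i)%R ->
     \int[P1]_t (g1 t * \prod_(i <- J) expeR (- ((r i)%:E * N1 i t))) =
     \int[P2]_t (g2 t * \prod_(i <- J) expeR (- ((r i)%:E * N2 i t)))) ->
  forall C : I -> set (\bar R), (forall i, measurable (C i)) ->
  \int[P1]_t (g1 t * \prod_(i <- J) (\1_(C i) (N1 i t))%:E) =
  \int[P2]_t (g2 t * \prod_(i <- J) (\1_(C i) (N2 i t))%:E).
Proof.
elim: J g1 g2 => [|j J ih] g1 g2 + mg1 mg2 g101 g201 L C mC.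
  move=> _.
  transitivity (\int[P1]_t (g1 t * \prod_(i <- [::]) expeR (- (0%R%:E * N1 i t)))).
    by apply: eq_integral => t _; rewrite !big_nil.
  rewrite (L (fun=> 0%R))//.
  by apply: eq_integral => t _; rewrite !big_nil.
move=> /= /andP[jJ uJ].
have N10 i t : 0 <= N1 i t by case: (cN1 i t) => [[n ->]|->]; rewrite ?lee_fin ?leey.
have N20 i t : 0 <= N2 i t by case: (cN2 i t) => [[n ->]|->]; rewrite ?lee_fin ?leey.
have mind d (T : measurableType d) (N : T -> \bar R) i : measurable_fun setT N ->
    measurable_fun setT (fun t => (\1_(C i) (N t))%:E : \bar R).
  move=> mN; apply/measurable_EFinP.
  apply: (measurableT_comp (f := \1_(C i) : \bar R -> R)); last exact: mN.
  exact: measurable_indic.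
under eq_integral do rewrite big_cons muleA.
under [in RHS]eq_integral do rewrite big_cons muleA.
apply: (ih (fun t => g1 t * (\1_(C j) (N1 j t))%:E)
           (fun t => g2 t * (\1_(C j) (N2 j t))%:E)) => //.
- by apply: emeasurable_funM => //; exact: mind.
- by apply: emeasurable_funM => //; exact: mind.
- by move=> t; apply: mule01 => //; exact: indic01.
- by move=> t; apply: mule01 => //; exact: indic01.
move=> r r0.
have e01 d (T : measurableType d) (N : I -> T -> \bar R) i t :
    (forall i t, 0 <= N i t) -> 0 <= expeR (- ((r i)%:E * N i t)) <= 1.
  by move=> N0; apply: expeRN01; rewrite mule_ge0// lee_fin.
have me d (T : measurableType d) (N : I -> T -> \bar R) i :
    measurable_fun setT (N i) ->
    measurable_fun setT (fun t => expeR (- ((r i)%:E * N i t))).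
  move=> mN; apply: measurableT_comp measurable_expeR _.
  by apply: measurableT_comp => //; exact: measurable_funeM.
under eq_integral do rewrite muleAC.
under [in RHS]eq_integral do rewrite muleAC.
apply: (count_law_laplace (N1 := N1 j) (N2 := N2 j)
  (g1 := fun t => g1 t * \prod_(i <- J) expeR (- ((r i)%:E * N1 i t)))
  (g2 := fun t => g2 t * \prod_(i <- J) expeR (- ((r i)%:E * N2 i t)))) => //.
- by apply: emeasurable_funM => //; apply: emeasurable_prod => i; exact: me.
- by apply: emeasurable_funM => //; apply: emeasurable_prod => i; exact: me.
- by move=> t; apply: mule01 => //; apply: prode01 => i; exact: e01.
- by move=> t; apply: mule01 => //; apply: prode01 => i; exact: e01.
move=> rj rj0.
have := L (fun i => if i == j then rj else r i).
have r'0 i : (0 <= if i == j then rj else r i)%R by case: ifP.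
move=> /(_ r'0).
have EJ (T : Type) (N : I -> T -> \bar R) (g : T -> \bar R) t :
   g t * \prod_(i <- j :: J) expeR (- ((if i == j then rj else r i)%:E * N i t)) =
   g t * \prod_(i <- J) expeR (- ((r i)%:E * N i t)) * expeR (- (rj%:E * N j t)).
  rewrite big_cons eqxx -muleA [in RHS](muleC (\prod_(_ <- _) _)).
  congr (_ * (_ * _)); rewrite big_seq [in RHS]big_seq.
  by apply: eq_bigr => i iJ; case: eqP iJ jJ => // -> ->.
by under eq_integral do rewrite EJ; under [in RHS]eq_integral do rewrite EJ.
Qed.

End joint_counts.

End counts.

(** The partial sums are nondecreasing integers: if bounded they attain their maximum and are
    stationary from there on, otherwise they tend to [+oo]. *)
Lemma atoms_count_valued (R : realType) (T : Type) d (Y : measurableType d)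
    (E : nat -> set T) (y : nat -> T -> Y) t S :
  count_valued (atoms (R := R) E y t S).
Proof.
rewrite atomsE /atom_measure.
have d0 k : (t \in E k) -> 0 <= \d_(y k t) S :> \bar R by rewrite diracE lee_fin.
have /choice[u uE] : forall n, exists m : nat,
    \sum_(0 <= k < n | t \in E k) \d_(y k t) S = m%:R%:E :> \bar R.
  elim=> [|n [m mE]]; first by exists 0%N; rewrite big_geq.
  rewrite big_mkcond big_nat_recr//= -big_mkcond mE.
  exists (m + ((t \in E n) && (y n t \in S)))%N.
  by rewrite natrD EFinD; congr (_ + _); case: (t \in E n).
have [[M Mu]|nbd] := pselect (exists M, forall n, (u n <= M)%N).
  left; have pE : exists v, `[< exists n, u n = v >].
    by exists (u 0%N); apply/asboolP; exists 0%N.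
  have pM v : `[< exists n, u n = v >] -> (v <= M)%N by move=> /asboolP[n <-].
  have [m /asboolP[n0 un0] um] := ex_maxnP pE pM.
  exists m; apply: cvg_lim => //; apply: cvg_near_cst.
  exists n0 => // n /= n0n; rewrite uE; congr (_%:R%:E).
  apply/eqP; rewrite eqn_leq um/=; last by apply/asboolP; exists n.
  rewrite -un0 -(ler_nat R) -lee_fin -!uE.
  exact: lee_sum_nneg_natr.
right; apply/eqyP => A A0.
have [n An] : exists n, (A <= (u n)%:R)%R.
  apply/not_existsP => uA; apply: nbd; exists (Num.truncn A).+1 => n.
  have := uA n => /negP; rewrite -ltNge => uAn.
  rewrite -(ler_nat R); apply: ltW; apply: (lt_trans uAn); exact: truncnS_gt.
apply: (@le_trans _ _ (u n)%:R%:E); first by rewrite lee_fin.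
by rewrite -uE; apply: nneseries_lim_ge => k _; exact: d0.
Qed.

(** * Laws of weighted atoms *)

Section same_law.
Context (R : realType) d1 d2 (T1 : measurableType d1) (T2 : measurableType d2)
  (P1 : probability T1 R) (P2 : probability T2 R).

Definition measurable_evaluations d (T : measurableType d) (J : Type) dX
    (X : measurableType dX) (M : T -> J -> set X -> \bar R) :=
  forall j B, measurable B -> measurable_fun setT (fun t => M t j B).

(** Finite-dimensional events form a pi-system generating the evaluation algebra, on which two
    probability laws agree as soon as they agree on the pi-system. *)
Lemma same_law_cylinders (J : Type) dX (X : measurableType dX)
    (M1 : T1 -> J -> set X -> \bar R) (M2 : T2 -> J -> set X -> \bar R) :
  measurable_evaluations M1 -> measurable_evaluations M2 ->
  (forall n (j : 'I_n -> J) (B : 'I_n -> set X) (C : 'I_n -> set (\bar R)),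
     (forall i, measurable (B i)) -> (forall i, measurable (C i)) ->
     P1 (\big[setI/setT]_(i < n) [set t | C i (M1 t (j i) (B i))]) =
     P2 (\big[setI/setT]_(i < n) [set t | C i (M2 t (j i) (B i))])) ->
  same_law P1 M1 P2 M2.
Proof.
move=> mM1 mM2 M12 D; rewrite /evaluation_algebra; set gens := (X in <<s X >>) => eD.
pose cyl : set (set (J -> set X -> \bar R)) := [set D | exists n
  (j : 'I_n -> J) (B : 'I_n -> set X) (C : 'I_n -> set (\bar R)),
  [/\ forall i, measurable (B i), forall i, measurable (C i) &
      D = \big[setI/setT]_(i < n) [set m | C i (m (j i) (B i))]]].
have cylI : setI_closed cyl.
  move=> _ _ [n [j [B [C [mB mC ->]]]]] [n' [j' [B' [C' [mB' mC' ->]]]]].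
  (* Concatenating two finite families of constraints shows that cylinders are stable under
     intersection. *)
  pose cmb (A : Type) (x : 'I_n -> A) (x' : 'I_n' -> A) (i : 'I_(n + n')) :=
    match fintype.split i with inl a => x a | inr b => x' b end.
  exists (n + n')%N, (cmb _ j j'), (cmb _ B B'), (cmb _ C C'); split.
  - by move=> i; rewrite /cmb; case: fintype.split.
  - by move=> i; rewrite /cmb; case: fintype.split.
  - rewrite big_split_ord/=; congr (_ `&` _); apply: eq_bigr => i _.
    + by rewrite /cmb (unsplitK (inl i)).
    + by rewrite /cmb (unsplitK (inr i)).
have gcyl : gens `<=` cyl.
  move=> _ [j [B [C [mB mC ->]]]].
  by exists 1%N, (fun=> j), (fun=> B), (fun=> C); rewrite big_ord1.
have cylg : cyl `<=` (measurable : set (set (g_sigma_algebraType gens))).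
  move=> _ [n [j [B [C [mB mC ->]]]]]; apply: bigsetI_measurable => i _.
  by apply: sub_sigma_algebra; exists (j i), (B i), (C i).
have cylT : cyl setT.
  have j0 : 'I_0 -> J by case.
  by exists 0%N, j0, (fun=> setT), (fun=> setT); rewrite big_ord0.
have mM d (T : measurableType d) (M : T -> J -> set X -> \bar R) :
    measurable_evaluations M ->
    measurable_fun setT (M : T -> g_sigma_algebraType gens).
  move=> mM; apply: measurability => //.
  move=> _ [_ [j [B [C [mB mC ->]]]] <-].
  exact: (mM j B mB).
pose M1' : {mfun T1 >-> g_sigma_algebraType gens} :=
  HB.pack (M1 : T1 -> g_sigma_algebraType gens)
    (isMeasurableFun.Build _ _ _ _ _ (mM _ _ _ mM1)).
pose M2' : {mfun T2 >-> g_sigma_algebraType gens} :=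
  HB.pack (M2 : T2 -> g_sigma_algebraType gens)
    (isMeasurableFun.Build _ _ _ _ _ (mM _ _ _ mM2)).
rewrite -[LHS]/(distribution P1 M1' D) -[RHS]/(distribution P2 M2' D).
have covT : \bigcup_(k : nat) (setT : set (g_sigma_algebraType gens)) = setT.
  by rewrite bigcup_const.
have U := @g_sigma_algebra_measure_unique _ R (g_sigma_algebraType gens) cyl cylg
  (fun=> setT) (fun=> cylT) covT (distribution P1 M1') (distribution P2 M2') cylI.
apply: (U _ _ D _).
- move=> _ [n [j [B [C [mB mC ->]]]]].
  rewrite /distribution /pushforward.
  have := M12 n j B C mB mC.
  have pre (T : Type) (M : T -> J -> set X -> \bar R) :
      M @^-1` (\big[setI/setT]_(i < n) [set m | C i (m (j i) (B i))]) =
      \big[setI/setT]_(i < n) [set t | C i (M t (j i) (B i))].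
    exact: (big_morph (fun A => M @^-1` A) (fun A B => preimage_setI M A B) (preimage_setT M)).
  by rewrite -!pre.
- by move=> _; apply: (@le_lt_trans _ _ 1); [exact: probability_le1|exact: ltry].
- by apply: sub_smallest2r eD => //; exact: smallest_sigma_algebra.
Qed.

(** The same [psi] must serve both sides. The sets [D] whose two preimages come from one common
    event [D0] of the first algebra form a sigma-algebra, and it contains the generators. *)
Lemma same_law_transfer (J J' : Type) dX dX' (X : measurableType dX)
    (X' : measurableType dX')
    (M1 : T1 -> J -> set X -> \bar R) (M2 : T2 -> J -> set X -> \bar R)
    (M1' : T1 -> J' -> set X' -> \bar R) (M2' : T2 -> J' -> set X' -> \bar R) :
  (forall j B, measurable B -> exists psi : (J -> set X -> \bar R) -> \bar R,
     [/\ forall C, measurable C -> evaluation_algebra [set m | C (psi m)],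
         forall t, M1' t j B = psi (M1 t) & forall t, M2' t j B = psi (M2 t)]) ->
  same_law P1 M1 P2 M2 -> same_law P1 M1' P2 M2'.
Proof.
move=> H M12 D eD.
suff [D0 [eD0 D01 D02]] : exists D0, [/\ @evaluation_algebra R J _ X D0,
    M1' @^-1` D = M1 @^-1` D0 & M2' @^-1` D = M2 @^-1` D0].
  by rewrite D01 D02; exact: M12.
move: D eD; apply: smallest_sub; last first.
  move=> _ [j [B [C [mB mC ->]]]]; have [psi [epsi psi1 psi2]] := H j B mB.
  exists [set m | C (psi m)]; split; first exact: epsi.
  - by apply/seteqP; split => t /=; rewrite psi1.
  - by apply/seteqP; split => t /=; rewrite psi2.
split.
- by exists set0; rewrite !preimage_set0; split => //; exact: sigma_algebra0.
- move=> D [D0 [eD0 D01 D02]]; exists (~` D0); split.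
  + by rewrite -[~` D0]setTD; exact: sigma_algebraCD.
  + by rewrite setTD; apply: (congr1 (@setC T1) D01).
  + by rewrite setTD; apply: (congr1 (@setC T2) D02).
- move=> F /choice[F0 FF0]; exists (\bigcup_n F0 n); split.
  + by apply: sigma_algebra_bigcup => n; have [] := FF0 n.
  + rewrite [LHS]preimage_bigcup [RHS]preimage_bigcup.
    by apply: eq_bigcupr => n _; have [] := FF0 n.
  + rewrite [LHS]preimage_bigcup [RHS]preimage_bigcup.
    by apply: eq_bigcupr => n _; have [] := FF0 n.
Qed.

End same_law.

Lemma measurable_indic_comp (R : realType) d d' (T : measurableType d)
    (U : measurableType d') (h : T -> U) (B : set U) :
  measurable_fun setT h -> measurable B ->
  measurable_fun setT (fun t => (\1_B (h t))%:E : \bar R).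
Proof.
move=> mh mB.
rewrite (_ : (fun t => _) = (fun t => (\1_(h @^-1` B) t)%:E)).
  by apply: measurable_indicE; rewrite -[X in measurable X]setTI; exact: mh.
by apply/funext => t; rewrite !indicE.
Qed.

(** * Recovering the weighted sums from counts of nonzero jumps *)

Section jump_parts.
Context (R : realType) (upsilon : nat).
Import HBNNSimple.

(** The Boolean [b] selects the negative part of the coordinate [j]. *)
Definition jump_part (j : 'I_upsilon) (b : bool) (a : 'R[R]^upsilon) : \bar R :=
  (Num.max (if b then - tnth a j else tnth a j) 0)%:E%R.

Lemma measurable_jump_part j b : measurable_fun setT (jump_part j b).
Proof.
have mt : measurable_fun setT (fun a : 'R[R]^upsilon => tnth a j : R).
  exact: (@measurable_tnth _ (measurableTypeR R) upsilon j).
apply/measurable_EFinP; apply: measurable_maxr => //; case: b => //.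
exact: measurableT_comp.
Qed.

Lemma jump_part_ge0 j b a : 0 <= jump_part j b a.
Proof. by rewrite /jump_part lee_fin le_max lexx orbT. Qed.

Lemma jump_part0 j b : jump_part j b (zerov R upsilon) = 0.
Proof. by rewrite /jump_part tnth_mktuple oppr0 if_same maxxx. Qed.

Definition jump_approx j b : {nnsfun 'R[R]^upsilon >-> R}^nat :=
  nnsfun_approx measurableT (measurable_jump_part j b).

(** The approximations are nonnegative and increase to [jump_part], which vanishes at the null
    jump. *)
Lemma jump_approx0 j b n : jump_approx j b n (zerov R upsilon) = 0%R.
Proof.
have cv : ((jump_approx j b k (zerov R upsilon))%:E @[k --> \oo] --> (0 : \bar R)).
  rewrite -(jump_part0 j b).
  by apply: cvg_nnsfun_approx => // a _; exact: jump_part_ge0.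
apply/eqP; rewrite eq_le fun_ge0 andbT -lee_fin.
apply: (@le_trans _ _ (limn (fun k => (jump_approx j b k (zerov R upsilon))%:E))).
  apply: lime_ge; first exact: cvgP cv.
  by exists n => // k /= nk; rewrite lee_fin; exact/lefP/nd_nnsfun_approx.
by rewrite (cvg_lim _ cv).
Qed.

(* Level sets of the approximations; those of level 0 are dropped, so that all
   of them avoid the null jump. *)
Definition jump_level (i : 'I_upsilon * bool * nat * R) : set 'R[R]^upsilon :=
  let: (j, b, n, r) := i in
  if (0 < r)%R then jump_approx j b n @^-1` [set r] else set0.

Lemma measurable_jump_level i : measurable (jump_level i).
Proof. by case: i => [[[j b] n] r]; rewrite /jump_level; case: ifP. Qed.

Lemma jump_level0 i : ~ jump_level i (zerov R upsilon).
Proof.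
case: i => [[[j b] n] r]; rewrite /jump_level; case: ifP => [r0|_] //=.
by rewrite jump_approx0 => r0'; rewrite -r0' ltxx in r0.
Qed.

End jump_parts.

Arguments jump_approx {R upsilon} j b.
Arguments measurable_jump_part {R upsilon} j b.


Section atoms_levels.
Context (R : realType) (upsilon : nat) dO (Omega : measurableType dO)
  (T : Type) (E : nat -> set T) (y : nat -> T -> 'R[R]^upsilon * Omega).
Import HBNNSimple.

Definition level_counts (t : T) (i : 'I_upsilon * bool * nat * R) (B : set Omega) :=
  atoms (R := R) E y t (jump_level i `*` B).

Definition jump_sum (j : 'I_upsilon) (b : bool) (B : set Omega)
    (m : 'I_upsilon * bool * nat * R -> set Omega -> \bar R) (n : nat) : \bar R :=
  \sum_(r <- finmap.enum_fset (fset_set (range (jump_approx j b n))))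
     (r%:E * m (j, b, n, r) B).

(** The integrals of the simple approximations are finite combinations of level counts. They
    increase, so their upper limit is their limit; the upper limit is used because it stays defined
    and measurable on arbitrary set functions, where [jump_sum] need not converge. *)
Lemma integral_atoms_jump_part j b t B : measurable B ->
  \int[atoms E y t]_x (jump_part j b x.1 * (\1_B x.2)%:E) =
  limn_esup (jump_sum j b B (level_counts t)).
Proof.
move=> mB.
pose u n (x : 'R[R]^upsilon * Omega) := (jump_approx j b n x.1)%:E * (\1_B x.2)%:E.
have m1B : measurable_fun setT (fun x : 'R[R]^upsilon * Omega => (\1_B x.2)%:E : \bar R).
  exact: measurable_indic_comp measurable_snd mB.
have mu n : measurable_fun setT (u n).
  apply: emeasurable_funM => //; apply/measurable_EFinP.
  by apply: measurableT_comp => //; exact: measurable_fst.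
have u0 n x : 0 <= u n x by rewrite mule_ge0// lee_fin.
have ndu x : nondecreasing_seq (u ^~ x).
  by move=> k n kn; rewrite lee_wpmul2r ?lee_fin//; exact/lefP/nd_nnsfun_approx.
have uE : (fun x => jump_part j b x.1 * (\1_B x.2)%:E) = (fun x => limn (u ^~ x)).
  apply/funext => x; apply/esym/cvg_lim => //; apply: cvgeZr => //.
  by apply: cvg_nnsfun_approx => // a _; exact: jump_part_ge0.
rewrite uE monotone_convergence//.
have <- : (fun n => \int[atoms E y t]_x u n x) = jump_sum j b B (level_counts t).
  apply/funext => n; rewrite /jump_sum.
  pose s : seq R := finmap.enum_fset (fset_set (range (jump_approx j b n))).
  have s0 r : r \in s -> (0 <= r)%R.
    by rewrite in_fset_set// inE => -[a _ <-].
  have mi r : measurable_fun setT (fun x : 'R[R]^upsilon * Omega =>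
      (\1_(jump_level (j, b, n, r) `*` B) x)%:E : \bar R).
    by apply: measurable_indicE; apply: measurableX => //; exact: measurable_jump_level.
  have i0 r (x : 'R[R]^upsilon * Omega) : setT x ->
      0 <= (\1_(jump_level (j, b, n, r) `*` B) x : R)%:E by rewrite lee_fin.
  (* All [r] in [s] are nonnegative; the absolute value makes the terms nonnegative for every [r],
     as the exchange of sum and integral requires. *)
  have -> : u n = (fun x => \sum_(r <- s)
      (`|r|%:E * (\1_(jump_level (j, b, n, r) `*` B) x)%:E)).
    apply/funext => x; rewrite /u fimfunE fsbig_finite//= -sumEFin.
    rewrite ge0_sume_distrl; last first.
      by move=> r _; rewrite EFinM nnfun_muleindic_ge0.
    rewrite -/s big_seq [in RHS]big_seq; apply: eq_bigr => r rs.
    rewrite EFinM -muleA ger0_norm ?s0//.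
    have := s0 _ rs; rewrite le_eqVlt => /predU1P[<-|r0]; first by rewrite !mul0e.
    congr (_ * _); rewrite -EFinM /jump_level r0 !indicE in_setX.
    by rewrite -natrM mulnb.
  have mri r : measurable_fun setT (fun x : 'R[R]^upsilon * Omega =>
      `|r|%:E * (\1_(jump_level (j, b, n, r) `*` B) x)%:E).
    exact: measurable_funeM.
  rewrite (ge0_integral_sum (atoms E y t) measurableT mri); last first.
    by move=> r x _; rewrite mule_ge0// ?lee_fin// i0.
  rewrite /jump_sum -/s big_seq [in RHS]big_seq; apply: eq_bigr => r /s0 r0.
  have r0' : 0 <= `|r|%:E by rewrite lee_fin.
  rewrite (ge0_integralZl _ measurableT (mi r) (i0 r) r0') ger0_norm//.
  rewrite integral_indic ?setIT//.
  by apply: measurableX => //; exact: measurable_jump_level.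
rewrite is_cvg_limn_esupE//; apply: ereal_nondecreasing_is_cvgn => k n kn.
by apply: ge0_le_integral => // x _; exact: ndu.
Qed.

End atoms_levels.

Section same_law_weighted_atoms.
Context (R : realType) (upsilon : nat) dO (Omega : measurableType dO)
  d1 d2 (T1 : measurableType d1) (T2 : measurableType d2)
  (P1 : probability T1 R) (P2 : probability T2 R)
  (E1 : nat -> set T1) (w1 : nat -> {mfun T1 >-> Omega})
  (A1 : nat -> {mfun T1 >-> 'R[R]^upsilon})
  (E2 : nat -> set T2) (w2 : nat -> {mfun T2 >-> Omega})
  (A2 : nat -> {mfun T2 >-> 'R[R]^upsilon}).
Hypotheses (mE1 : forall k, measurable (E1 k)) (mE2 : forall k, measurable (E2 k)).

Local Notation y1 := (fun k t => (A1 k t, w1 k t)).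
Local Notation y2 := (fun k t => (A2 k t, w2 k t)).

Hypothesis laplace12 : forall f : 'R[R]^upsilon * Omega -> \bar R,
  measurable_fun setT f -> (forall x, 0 <= f x) ->
  (forall o, f (zerov R upsilon, o) = 0) ->
  \int[P1]_t expeR (- \int[atoms E1 y1 t]_x f x) =
  \int[P2]_t expeR (- \int[atoms E2 y2 t]_x f x).

(** A linear combination of counts is the integral of a step function against the atoms. Its level
    sets avoid the null jump, so this function is an admissible test function. *)
Lemma same_law_level_counts :
  same_law P1 (level_counts E1 y1) P2 (level_counts E2 y2).
Proof.
have mS i (B : set Omega) : measurable B ->
    measurable (jump_level (R := R) (upsilon := upsilon) i `*` B).
  by move=> mB; apply: measurableX => //; exact: measurable_jump_level.
have my1 k : measurable_fun setT (y1 k) by exact: measurable_fun_pair.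
have my2 k : measurable_fun setT (y2 k) by exact: measurable_fun_pair.
have mc1 : measurable_evaluations (level_counts E1 y1).
  by move=> i B mB; apply: measurable_atoms => //; exact: mS.
have mc2 : measurable_evaluations (level_counts E2 y2).
  by move=> i B mB; apply: measurable_atoms => //; exact: mS.
apply: same_law_cylinders => // n i B C mB mC.
have one01 (T : Type) (t : T) : 0 <= (cst 1 t : \bar R) <= 1 by rewrite /= lee01 lexx.
have intE d (T : measurableType d) (P : probability T R)
    (M : T -> 'I_upsilon * bool * nat * R -> set Omega -> \bar R) :
    measurable_evaluations M ->
    P (\big[setI/setT]_(k < n) [set t | C k (M t (i k) (B k))]) =
    \int[P]_t (cst 1 t * \prod_(k < n) (\1_(C k) (M t (i k) (B k)))%:E).
  move=> mM.
  have mMC k : measurable [set t | C k (M t (i k) (B k))].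
    by rewrite -[X in measurable X]setTI; exact: (mM _ _ (mB k) measurableT _ (mC k)).
  rewrite -[X in P X]setIT -(integral_indic P measurableT); last exact: bigsetI_measurable.
  apply: eq_integral => t _; rewrite mul1e -prode_indic.
  by apply: eq_bigr => k _; rewrite !indicE.
rewrite (intE _ _ P1)// (intE _ _ P2)//.
apply: (joint_count_law_laplace
  (N1 := fun k t => level_counts E1 y1 t (i k) (B k))
  (N2 := fun k t => level_counts E2 y2 t (i k) (B k))) => //.
- by move=> k; exact: mc1.
- by move=> k; exact: mc2.
- by move=> k t; exact: atoms_count_valued.
- by move=> k t; exact: atoms_count_valued.
- exact: index_enum_uniq.
move=> r r0.
pose f (x : 'R[R]^upsilon * Omega) : \bar R :=
  \sum_(k < n) ((r k)%:E * (\1_(jump_level (i k) `*` B k) x)%:E).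
have f1 k : measurable_fun setT (fun x : 'R[R]^upsilon * Omega =>
    (r k)%:E * (\1_(jump_level (i k) `*` B k) x)%:E).
  by apply: measurable_funeM; apply: measurable_indicE; exact: mS.
have f10 k (x : 'R[R]^upsilon * Omega) :
    0 <= (r k)%:E * (\1_(jump_level (i k) `*` B k) x)%:E.
  by rewrite mule_ge0 ?lee_fin//; exact: r0.
have mf : measurable_fun setT f by exact: emeasurable_sum.
have f0 x : 0 <= f x by exact: sume_ge0.
have fO o : f (zerov R upsilon, o) = 0.
  rewrite /f big1// => k _; rewrite indicE memNset ?mule0// => -[/= + _].
  exact: jump_level0.
have LE (T : Type) (E : nat -> set T) (y : nat -> T -> 'R[R]^upsilon * Omega) t :
    cst 1 t * \prod_(k < n) expeR (- ((r k)%:E * level_counts E y t (i k) (B k))) =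
    expeR (- \int[atoms E y t]_x f x).
  rewrite mul1e -expeRN_sum; last first.
    by move=> k _; rewrite mule_ge0 ?lee_fin.
  congr (expeR (- _)); rewrite /f ge0_integral_sum//.
  apply: eq_bigr => k _; rewrite ge0_integralZl//.
  - by rewrite integral_indic ?setIT//; exact: mS.
  - by apply: measurable_indicE; exact: mS.
  - by rewrite lee_fin r0.
under eq_integral do rewrite LE.
under [in RHS]eq_integral do rewrite LE.
exact: laplace12.
Qed.

(** Each evaluation is the difference of two upper limits of level counts, one per sign, by a
    formula that is the same on both spaces. *)
Lemma same_law_weighted_atoms :
  same_law P1 (weighted_atoms E1 w1 A1) P2 (weighted_atoms E2 w2 A2).
Proof.
apply: same_law_transfer same_law_level_counts => j B mB.
exists (fun m => limn_esup (jump_sum j false B m) - limn_esup (jump_sum j true B m)).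
have wE (T : Type) (E : nat -> set T) (w : nat -> T -> Omega)
    (A : nat -> T -> 'R[R]^upsilon) t :
    weighted_atoms E w A t j B =
    limn_esup (jump_sum j false B (level_counts E (fun k t => (A k t, w k t)) t)) -
    limn_esup (jump_sum j true B (level_counts E (fun k t => (A k t, w k t)) t)).
  have mp b : measurable_fun setT (fun x : 'R[R]^upsilon * Omega =>
      jump_part j b x.1 * (\1_B x.2)%:E).
    apply: emeasurable_funM.
      exact: (measurableT_comp (measurable_jump_part j b) measurable_fst).
    exact: measurable_indic_comp measurable_snd mB.
  have p0 b (x : 'R[R]^upsilon * Omega) : 0 <= jump_part j b x.1 * (\1_B x.2)%:E.
    by rewrite mule_ge0 ?jump_part_ge0// lee_fin.
  rewrite -!integral_atoms_jump_part// !integral_atoms//.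
split => //.
- move=> C mC; rewrite /evaluation_algebra; set gens := (X in <<s X >>).
  pose Phi := g_sigma_algebraType gens.
  have mev k D : measurable D -> measurable_fun setT (fun m : Phi => (m : _ -> _) k D).
    move=> mD _ C' mC'; rewrite setTI; apply: sub_sigma_algebra.
    by exists k, D, C'.
  have mlim b : measurable_fun setT (fun m : Phi => limn_esup (jump_sum j b B m)).
    apply: measurable_fun_limn_esup => n; apply: emeasurable_sum => r.
    by apply: measurable_funeM; exact: mev.
  have := emeasurable_funB (mlim false) (mlim true) measurableT mC.
  by rewrite setTI.
Qed.

End same_law_weighted_atoms.

Lemma nneseries_ltn (R : realType) (n : nat) (P : pred nat) (a : nat -> \bar R) :
  (forall k, 0 <= a k) -> (forall k, P k = (k < n)%N) ->
  \sum_(k <oo | P k) a k = \sum_(k < n) a k.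
Proof.
move=> a0 PE; rewrite eseries_mkcond (nneseries_split 0 n); last first.
  by move=> k _; case: ifP.
rewrite add0n eseries0 ?adde0; last by move=> k nk _; rewrite PE ltnNge nk.
rewrite big_mkord; apply: eq_bigr => k _.
by rewrite PE ltn_ord.
Qed.

Lemma weighted_atoms_compound (R : realType) (upsilon : nat) d
    (Omega : measurableType d) (T : Type) (xi : T -> nat)
    (X : nat -> T -> 'R[R]^upsilon) (w : nat -> T -> Omega) :
  weighted_atoms (fun k => [set t | (k < xi t)%N]) w X = compound_sum xi X w.
Proof.
apply/funext => t; apply/funext => j; apply/funext => B.
have PE k : (t \in [set t | (k < xi t)%N]) = (k < xi t)%N.
  by apply/idP/idP => [/set_mem|/mem_set].
rewrite /weighted_atoms /compound_sum.
have p0 (r : R) k : 0 <= (Num.max r 0)%:E%R * \d_(w k t) B.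
  by rewrite mule_ge0 ?diracE ?lee_fin// le_max lexx orbT.
rewrite !(nneseries_ltn _ PE)//.
have dE k : \d_(w k t) B = ((w k t \in B)%:R : R)%:E by rewrite diracE.
under eq_bigr do rewrite dE -EFinM.
under [X in _ - X]eq_bigr do rewrite dE -EFinM.
under [RHS]eq_bigr do rewrite dE -EFinM.
rewrite !sumEFin -EFinB -sumrB; congr (_%:E); apply: eq_bigr => k _.
rewrite -mulrBl; congr (_ * _)%R; set r := tnth _ _.
(* For a finite sum the two parts recombine termwise, by [max(r, 0) - max(- r, 0) = r]. *)
by case: (leP 0%R r) => r0; case: (leP 0%R (- r)%R) => r0'; lra.
Qed.

Lemma same_law_trans (R : realType) (J : Type) dX (X : measurableType dX)
    d1 d2 d3 (T1 : measurableType d1) (T2 : measurableType d2)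
    (T3 : measurableType d3) (P1 : probability T1 R) (P2 : probability T2 R)
    (P3 : probability T3 R) (M1 : T1 -> J -> set X -> \bar R)
    (M2 : T2 -> J -> set X -> \bar R) (M3 : T3 -> J -> set X -> \bar R) :
  same_law P1 M1 P2 M2 -> same_law P2 M2 P3 M3 -> same_law P1 M1 P3 M3.
Proof. by move=> M12 M23 D eD; rewrite M12// M23. Qed.

Lemma IBP_compound_same_law (R : realType) (q upsilon : nat)
  (dO : measure_display) (Omega : measurableType dO)
  (B0 : probability Omega R)
  (rho : {sigma_finite_measure set 'R[R]^q -> \bar R})
  (rho_orthant : rho (~` orthant R q) = 0)
  (G : R.-pker 'R[R]^q ~> 'R[R]^upsilon)
  (dT : measure_display) (T : measurableType dT) (P : probability T R)
  (Z : T -> 'I_upsilon -> set Omega -> \bar R)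
  (Z_IBP : is_IBP G rho B0 P Z)
  (varphi_gt0 : 0 < varphi G rho) (varphi_fin : varphi G rho < +oo)
  (d1 : measure_display) (T1 : measurableType d1)
  (P1 : probability T1 R) (xi : {mfun T1 >-> nat})
  (H : nat -> {mfun T1 >-> 'R[R]^q}) (X : nat -> {mfun T1 >-> 'R[R]^upsilon})
  (w : nat -> {mfun T1 >-> Omega}) :
  compound_data G rho B0 P1 xi H X w ->
  same_law P Z P1 (compound_sum xi X w).
Proof.
move=> cd; have [_ [d2 [T2 [P2 [E [s [w2 [A [mE prm cm ZA]]]]]]]]] := Z_IBP.
apply: same_law_trans ZA _.
rewrite -weighted_atoms_compound; apply: same_law_weighted_atoms => //.
- move=> k; rewrite -[X in measurable X]setTI.
  have mx : measurable_fun setT xi by [].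
  exact: (mx measurableT [set n | (k < n)%N] I).
- move=> f mf f0 fO.
  rewrite (laplace_IBP mf f0 mE prm cm).
  by rewrite (laplace_compound_data mf f0 rho_orthant varphi_gt0 varphi_fin fO cd).
Qed.

(** * Infinite product probabilities *)

Section sequence_space.
Context d (Y : measurableType d) (R : realType) (nu : probability Y R).

Definition coordinate_sets : set (set (nat -> Y)) :=
  [set A | exists k B, measurable B /\ A = [set x | B (x k)]].

Definition seqs : measurableType _ := g_sigma_algebraType coordinate_sets.

Lemma measurable_coordinate k : measurable_fun setT (fun x : seqs => (x : nat -> Y) k).
Proof.
by move=> _ B mB; rewrite setTI; apply: sub_sigma_algebra; exists k, B.
Qed.

Definition cons_seq (yx : Y * seqs) : seqs :=
  fun n => if n is k.+1 then (yx.2 : nat -> Y) k else yx.1.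

Lemma measurable_cons_seq : measurable_fun setT cons_seq.
Proof.
apply: measurability => //.
move=> _ [_ [[|k] [B [mB ->]]] <-].
  by have := @measurable_fst _ _ Y seqs measurableT B mB.
by have := measurableT_comp (measurable_coordinate k)
  (@measurable_snd _ _ Y seqs) measurableT mB.
Qed.

HB.instance Definition _ := isMeasurableFun.Build _ _ _ _ cons_seq measurable_cons_seq.

(** The law of [n] independent coordinates followed by a constant sequence. *)
Fixpoint prefix_law n : probability seqs R :=
  if n is m.+1 then distribution (nu \x prefix_law m) cons_seq
  else \d_((fun=> point) : seqs).

Definition tail_at (A : set seqs) (y : Y) : set seqs := [set x | A (cons_seq (y, x))].

Lemma prefix_lawS n A : prefix_law n.+1 A = \int[nu]_y prefix_law n (tail_at A y).
Proof.
rewrite /= /distribution /pushforward /= /product_measure1.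
apply: eq_integral => y _ /=; congr (prefix_law n _).
by apply/seteqP; split => x; rewrite /xsection/= inE.
Qed.

Lemma measurable_tail_at A y : measurable A -> measurable (tail_at A y).
Proof.
move=> mA.
have mc : measurable_fun setT (fun x : seqs => cons_seq (y, x)).
  by apply: (measurableT_comp measurable_cons_seq); exact: measurable_fun_pair.
by have := mc measurableT A mA; rewrite setTI.
Qed.

Definition depends_on_prefix n (A : set seqs) :=
  forall x x' : nat -> Y, (forall i, (i < n)%N -> x i = x' i) -> A x -> A x'.

Lemma depends_on_prefixW m n A : (m <= n)%N ->
  depends_on_prefix m A -> depends_on_prefix n A.
Proof. by move=> mn dA x x' xx'; apply: dA => i im; apply: xx'; exact: leq_trans mn. Qed.

Lemma depends_on_prefix_tail n A y : depends_on_prefix n A ->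
  depends_on_prefix n.-1 (tail_at A y).
Proof.
move=> dA x x' xx'; apply: dA => -[|i] //= ini; apply: xx'.
by rewrite -ltnS (leq_trans ini)// leqSpred.
Qed.

(** Peel off first coordinates until none matters; a set that depends on no coordinate is empty or
    everything. *)
Lemma prefix_law_stable m n A : measurable A -> depends_on_prefix m A ->
  (m <= n)%N -> prefix_law n A = prefix_law m A.
Proof.
elim: m n A => [|m ih] n A mA dA.
  move=> _; have [A0|/set0P[x Ax]] := eqVneq A set0.
    by rewrite A0 !measure0.
  have -> : A = setT by apply/seteqP; split => // x' _; exact: dA Ax.
  by rewrite (probability_setT (prefix_law n)) (probability_setT (prefix_law 0)).
case: n => // n; rewrite ltnS => mn; rewrite !prefix_lawS.
apply: eq_integral => y _; apply: ih => //; first exact: measurable_tail_at.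
exact: depends_on_prefix_tail dA.
Qed.

Definition cylinders : set (set seqs) :=
  [set A | measurable A /\ exists n, depends_on_prefix n A].

(** On a cylinder the sequence is eventually constant; taking the limit avoids choosing a length. *)
Definition cylinder_law (A : set seqs) : \bar R := limn (fun n => prefix_law n A).

Lemma cylinder_lawE m A : measurable A -> depends_on_prefix m A ->
  cylinder_law A = prefix_law m A.
Proof.
move=> mA dA; apply: cvg_lim => //; apply: cvg_near_cst.
by exists m => // n /= mn; exact: prefix_law_stable.
Qed.

Lemma cylinder_law01 A : cylinders A -> 0 <= cylinder_law A <= 1.
Proof.
by move=> [mA [m dA]]; rewrite (cylinder_lawE mA dA) measure_ge0/= probability_le1.
Qed.

Lemma cylinder_tail A y : cylinders A -> cylinders (tail_at A y).
Proof.
move=> [mA [m dA]]; split; first exact: measurable_tail_at.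
by exists m.-1; exact: depends_on_prefix_tail.
Qed.

Lemma measurable_cylinder_law_tail A : cylinders A ->
  measurable_fun setT (fun y => cylinder_law (tail_at A y)).
Proof.
move=> [mA [m dA]].
rewrite (_ : (fun y => _) = (fun y => prefix_law m.-1 (tail_at A y))); last first.
  apply/funext => y; apply: cylinder_lawE; first exact: measurable_tail_at.
  exact: depends_on_prefix_tail.
have mcA : measurable (cons_seq @^-1` A).
  by have := measurable_cons_seq measurableT mA; rewrite setTI.
have := measurable_fun_xsection (prefix_law m.-1) mcA.
congr measurable_fun; apply/funext => y /=; congr (prefix_law _ _).
by apply/seteqP; split => x; rewrite /xsection/= inE.
Qed.

Lemma cylinder_law_tail A : cylinders A ->
  cylinder_law A = \int[nu]_y cylinder_law (tail_at A y).
Proof.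
move=> [mA [m dA]].
rewrite (cylinder_lawE mA (depends_on_prefixW (leqnSn m) dA)) prefix_lawS.
apply: eq_integral => y _; apply/esym/cylinder_lawE; first exact: measurable_tail_at.
exact: depends_on_prefix_tail (depends_on_prefixW (leqnSn m) dA).
Qed.

Section decreasing_cylinders.
Variable e : R.
Hypothesis e0 : (0 < e)%R.

Let heavy (A : nat -> set seqs) := [/\ forall i, cylinders (A i),
  forall i, A i.+1 `<=` A i & forall i, e%:E <= cylinder_law (A i)].

Lemma le_cylinder_law A B : cylinders A -> cylinders B -> A `<=` B ->
  cylinder_law A <= cylinder_law B.
Proof.
move=> [mA [m dA]] [mB [n dB]] AB.
rewrite (cylinder_lawE mA (depends_on_prefixW (leq_maxl m n) dA)).
rewrite (cylinder_lawE mB (depends_on_prefixW (leq_maxr m n) dB)).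
by rewrite le_measure ?inE.
Qed.

(** If no first coordinate kept all tails heavy, the limit [g] of the laws of the tails would be
    below [e] everywhere, although by dominated convergence its integral is at least [e]. *)
Let heavy_tail A : heavy A -> exists y, heavy (fun i => tail_at (A i) y).
Proof.
move=> [cA ndA eA]; apply: contrapT => /forallNP noy.
pose f i y := cylinder_law (tail_at (A i) y).
have cf i y : cylinders (tail_at (A i) y) by exact: cylinder_tail.
have f01 i y : 0 <= f i y <= 1 by exact: cylinder_law01.
have nif y : nonincreasing_seq (f ^~ y).
  apply/nonincreasing_seqP => i; apply: le_cylinder_law => //.
  by move=> x /=; exact: ndA.
have flt y : exists i, f i y < e%:E.
  apply: contrapT => /forallNP fy; apply: (noy y); split => // i.
    by move=> x /=; exact: ndA.
  by rewrite leNgt; apply/negP; exact: fy.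
pose g y := limn (f ^~ y).
have cfg y : f i y @[i --> \oo] --> g y by exact: ereal_nonincreasing_is_cvgn.
have mf i : measurable_fun setT (f i) by exact: measurable_cylinder_law_tail.
have mg : measurable_fun setT g by apply: (emeasurable_fun_cvg f).
have g_lt y : g y < e%:E.
  have [i fi] := flt y; apply: le_lt_trans fi.
  by apply: lime_le; [exact: cfg|exists i => // j /= ij; exact: nif].
have g01 y : 0 <= g y <= 1.
  apply/andP; split.
    by apply: lime_ge; [exact: cfg|apply: nearW => i; case/andP: (f01 i y)].
  by apply: lime_le; [exact: cfg|apply: nearW => i; case/andP: (f01 i y)].
have eg : e%:E <= \int[nu]_y g y.
  have cv : \int[nu]_y f i y @[i --> \oo] --> \int[nu]_y g y.
    apply: (@dominated_cvg _ _ _ _ _ _ _ _ (cst 1)) => //.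
    - exact: finite_measure_integrable_cst.
    - by move=> n y _; have /andP[fy0 fy1] := f01 n y; rewrite gee0_abs.
  rewrite -(cvg_lim _ cv)//; apply: lime_ge; first exact: cvgP cv.
  by apply: nearW => i; rewrite -cylinder_law_tail.
have gfin y : g y \is a fin_num by exact: fin_num01.
have h0 y : 0 < e%:E - g y by rewrite sube_gt0.
have mh : measurable_fun setT (fun y => e%:E - g y) by exact: emeasurable_funB.
(* The function [e - g] is positive everywhere, yet its integral is at most zero; it then vanishes
   almost everywhere, so the whole space would be null. *)
have ih : \int[nu]_y `|e%:E - g y| = 0.
  apply/eqP; rewrite eq_le integral_ge0// andbT.
  rewrite -(@leeD2rE _ (\int[nu]_y g y)); last first.
    by apply: fin_num01; apply: integral01 => //; exact: probability_le1.
  rewrite add0e -ge0_integralD//; last 2 first.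
  - exact: measurableT_comp.
  - by move=> y _; case/andP: (g01 y).
  apply: le_trans eg; rewrite -[leRHS](integral_probability_cst nu).
  rewrite le_eqVlt; apply/orP; left; apply/eqP; apply: eq_integral => y _.
  by rewrite gee0_abs ?(ltW (h0 y))// subeK.
have [N [mN N0 hN]] := (ae_eq_integral_abs nu measurableT mh).1 ih.
suff NT : N = setT.
  have /eqP : (1 : \bar R) = 0.
    by rewrite -[RHS]N0 NT; apply/esym; exact: probability_setT.
  by rewrite onee_eq0.
apply/seteqP; split => // y _; apply: hN => /= /(_ Logic.I) hy.
by have := h0 y; rewrite hy ltxx.
Qed.

(** The chosen coordinates form the common point. If [A i] depends on [m] coordinates, its tail
    after [m] choices depends on none; being heavy it is not empty, so it is everything. *)
Lemma heavy_cylinders_nonempty A : heavy A -> \bigcap_i A i !=set0.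
Proof.
move=> hA.
have /choice[nxt nxtP] : forall B : {B | heavy B}, exists y,
    heavy (fun i => tail_at (sval B i) y).
  by move=> [B hB]; exact: heavy_tail.
pose step (B : {B | heavy B}) : {B | heavy B} := exist _ _ (nxtP B).
pose st k := iter k step (exist _ A hA).
pose x (k : nat) : Y := nxt (st k).
exists x => i _.
have [cA _ _] := hA; have [_ [m dA]] := cA i.
have stE k : sval (st k) i (fun j => x (k + j)%N) <-> A i x.
  elim: k => [|k ih] //; rewrite -ih [st _]/= /step/= /tail_at/=.
  rewrite (_ : cons_seq _ = (fun j => x (k + j)%N))//.
  by apply/funext => -[|j] /=; rewrite ?addn0// addnS addSn.
have dst k : depends_on_prefix (m - k) (sval (st k) i).
  elim: k => [|k ih]; first by rewrite subn0.
  by rewrite subnS; exact: depends_on_prefix_tail.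
apply/(stE m); have [cst _ est] := svalP (st m).
have := dst m; rewrite subnn => d0.
have [/eqP st0|/set0P[z stz]] := boolP (sval (st m) i == set0).
  have d00 : depends_on_prefix 0 set0 by move=> ? ? _.
  have := est i; rewrite st0 (cylinder_lawE (@measurable0 _ seqs) d00) measure0.
  by rewrite lee_fin leNgt e0.
exact: d0 stz.
Qed.

End decreasing_cylinders.

End sequence_space.

(** * Extension from cylinders to the product sigma-algebra *)

Section cylinder_algebra.
Context d (Y : measurableType d).

Lemma cylinder0 : cylinders (set0 : set (seqs Y)).
Proof. by split => //; exists 0%N => x x' _. Qed.

Lemma cylinderC : setC_closed (@cylinders _ Y).
Proof.
move=> A [mA [n dA]]; split; first exact: measurableC.
exists n => x x' xx' Ax Ax'; apply: Ax; apply: dA Ax' => i iN.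
by rewrite xx'.
Qed.

Lemma cylinderU : setU_closed (@cylinders _ Y).
Proof.
move=> A B [mA [m dA]] [mB [n dB]]; split; first exact: measurableU.
exists (maxn m n) => x x' xx' [Ax|Bx]; [left|right].
- exact: depends_on_prefixW (leq_maxl m n) dA _ _ xx' Ax.
- exact: depends_on_prefixW (leq_maxr m n) dB _ _ xx' Bx.
Qed.

Lemma cylinderD : setD_closed (@cylinders _ Y).
Proof.
move=> A B cA cB; rewrite setDE -[A]setCK -setCU.
by apply: cylinderC; apply: cylinderU => //; exact: cylinderC.
Qed.

(** A separate copy of the sequences whose measurable sets are the cylinders only, since the
    extension starts from an algebra of sets. *)
Definition cylinder_space : Type := nat -> Y.

HB.instance Definition _ := Pointed.on cylinder_space.

HB.instance Definition _ := @isAlgebraOfSets.Build default_measure_display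
  cylinder_space (@cylinders _ Y) cylinder0 cylinderU cylinderC.

Context (R : realType) (nu : probability Y R).

Lemma cylinder_lawU (A B : set (seqs Y)) : cylinders A -> cylinders B ->
  A `&` B = set0 ->
  cylinder_law nu (A `|` B) = cylinder_law nu A + cylinder_law nu B.
Proof.
move=> [mA [m dA]] [mB [n dB]] AB0.
have dA' := depends_on_prefixW (leq_maxl m n) dA.
have dB' := depends_on_prefixW (leq_maxr m n) dB.
have dAB : depends_on_prefix (maxn m n) (A `|` B).
  by move=> x x' xx' [Ax|Bx]; [left; exact: dA' Ax|right; exact: dB' Bx].
rewrite (cylinder_lawE _ (measurableU _ _ mA mB) dAB) (cylinder_lawE _ mA dA').
by rewrite (cylinder_lawE _ mB dB') measureU.
Qed.

(* The guard makes the set function nonnegative on arbitrary sets. *)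
Definition cylinder_measure (A : set cylinder_space) : \bar R :=
  if `[< cylinders (A : set (seqs Y)) >] then cylinder_law nu A else 0.

Let cmE (A : set cylinder_space) : cylinders (A : set (seqs Y)) ->
  cylinder_measure A = cylinder_law nu A.
Proof. by move=> cA; rewrite /cylinder_measure asboolT. Qed.

Let cm0 : cylinder_measure set0 = 0.
Proof.
rewrite cmE; last exact: cylinder0.
by rewrite (@cylinder_lawE _ _ _ nu 0)// measure0.
Qed.

Let cm_ge0 A : 0 <= cylinder_measure A.
Proof.
rewrite /cylinder_measure; case: asboolP => // cA.
by case/andP: (cylinder_law01 nu cA).
Qed.

(** The remainders [A n] of [U] after removing the first [n] pieces are decreasing cylinders. Were
    the limit of their laws positive, they would share a point; that point of [U] lies in some
    [F k], yet [A k.+1] excludes [F k]. *)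
Let cm_sigma_additive : semi_sigma_additive cylinder_measure.
Proof.
move=> F cF tF; set U := \bigcup_n F n => cU.
pose A n : set (seqs Y) := [set x | U x /\ forall i, (i < n)%N -> ~ F i x].
have A0 : A 0%N = U by apply/seteqP; split => [x []|x Ux] //; split.
have AS n : A n.+1 = A n `\` F n.
  apply/seteqP; split => x /=.
    move=> [Ux nF]; split; last exact: nF.
    by split => // i ni; apply: nF; rewrite ltnS ltnW.
  move=> [[Ux nF] nFn]; split => // i; rewrite ltnS leq_eqVlt.
  by move=> /predU1P[->//|]; exact: nF.
have cA n : cylinders (A n).
  elim: n => [|n ih]; first by rewrite A0; exact: cU.
  by rewrite AS; apply: cylinderD => //; exact: cF.
have FA n : F n `<=` A n.
  move=> x Fx; split; first by exists n.
  move=> i ni Fix_.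
  have iN := tF i n Logic.I Logic.I (ex_intro _ x (conj Fix_ Fx)).
  by rewrite iN ltnn in ni.
have lawA n : cylinder_law nu (A n) = cylinder_law nu (F n) + cylinder_law nu (A n.+1).
  rewrite -cylinder_lawU//; last 2 first.
  - exact: cF.
  - by rewrite AS setDIK.
  by rewrite AS setDUK.
have law01 n : 0 <= cylinder_law nu (A n) <= 1 by exact: cylinder_law01.
have lawU n : cylinder_law nu U =
    \sum_(0 <= i < n) cylinder_law nu (F i) + cylinder_law nu (A n).
  elim: n => [|n ih]; first by rewrite big_geq// add0e A0.
  by rewrite ih lawA big_nat_recr//= addeA.
have niA : nonincreasing_seq (fun n => cylinder_law nu (A n)).
  apply/nonincreasing_seqP => n; apply: le_cylinder_law => //.
  by rewrite AS; exact: subDsetl.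
have cvA : cylinder_law nu (A n) @[n --> \oo] --> 0.
  have cv := ereal_nonincreasing_is_cvgn niA.
  suff <- : limn (fun n => cylinder_law nu (A n)) = 0 by [].
  apply/eqP; rewrite eq_le; apply/andP; split; last first.
    by apply: lime_ge => //; apply: nearW => n; case/andP: (law01 n).
  rewrite leNgt; apply/negP => l0.
  set l := limn _ in l0.
  have lle n : l <= cylinder_law nu (A n).
    by apply: lime_le => //; exists n => // m /= nm; exact: niA.
  have lfin : l \is a fin_num.
    by apply: fin_num01; rewrite ltW//= (le_trans (lle 0%N))//; case/andP: (law01 0%N).
  have e0 : (0 < fine l)%R by rewrite -lte_fin fineK.
  have [x Ax] : \bigcap_i A i !=set0.
    apply: (heavy_cylinders_nonempty (nu := nu) e0); split => // i.
    - by rewrite AS; exact: subDsetl.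
    - by rewrite fineK.
  have [[k _ Fkx] _] := Ax 0%N Logic.I.
  by have [_ /(_ k (ltnSn k))] := Ax k.+1 Logic.I.
rewrite cmE//.
rewrite (_ : (fun n => _) = (fun n => cylinder_law nu U - cylinder_law nu (A n))).
  rewrite -[X in _ --> X]sube0; apply: cvgeB => //; last exact: cvg_cst.
  by rewrite oppe0 fin_num_adde_defl.
apply/funext => n; rewrite (lawU n) addeK.
  by apply: eq_bigr => i _; rewrite cmE//; exact: cF.
exact: fin_num01.
Qed.

HB.instance Definition _ := isMeasure.Build _ _ _ cylinder_measure
  cm0 cm_ge0 cm_sigma_additive.

Definition iid_space : measurableType _ :=
  g_sigma_algebraType (@measurable _ cylinder_space).

Definition iid_law : set iid_space -> \bar R := measure_extension cylinder_measure.

HB.instance Definition _ := Measure.on iid_law.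

Lemma iid_lawE (A : set (seqs Y)) : cylinders A -> iid_law A = cylinder_law nu A.
Proof.
move=> cA; rewrite /iid_law /measure_extension measurable_mu_extE//=.
by rewrite cmE.
Qed.

Let iid_law_setT : iid_law setT = 1.
Proof.
rewrite iid_lawE; last first.
  by rewrite -setC0; apply: cylinderC; exact: cylinder0.
rewrite (@cylinder_lawE _ _ _ nu 0)//.
exact: probability_setT (prefix_law nu 0).
Qed.

HB.instance Definition _ := Measure_isProbability.Build _ _ _ iid_law iid_law_setT.

End cylinder_algebra.

Section iid_independence.
Context d (Y : measurableType d) (R : realType) (nu : probability Y R).

Let box n (B : nat -> set Y) : set (seqs Y) :=
  [set x | forall k, (k < n)%N -> B k ((x : nat -> Y) k)].

Let boxS n B : box n.+1 B = box n B `&` [set x | B n ((x : nat -> Y) n)].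
Proof.
apply/seteqP; split => x /=.
  by move=> Bx; split => [k kn|]; apply: Bx; rewrite ltnS// ltnW.
by move=> [Bx Bn] k; rewrite ltnS leq_eqVlt => /predU1P[->//|]; exact: Bx.
Qed.

Let cylinder_box n (B : nat -> set Y) : (forall k, measurable (B k)) ->
  cylinders (box n B).
Proof.
move=> mB; split; last first.
  by exists n => x x' xx' Bx k kn; rewrite -xx'//; exact: Bx.
elim: n => [|n ih]; first by rewrite (_ : box 0 B = setT)//; apply/seteqP; split.
rewrite boxS; apply: measurableI => //.
by apply: sub_sigma_algebra; exists n, (B n).
Qed.

Let cylinder_law_box n (B : nat -> set Y) : (forall k, measurable (B k)) ->
  cylinder_law nu (box n B) = \prod_(0 <= k < n) nu (B k).
Proof.
elim: n B => [|n ih] B mB.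
  rewrite big_geq// (_ : box 0 B = setT); last by apply/seteqP; split.
  rewrite (@cylinder_lawE _ _ _ nu 0)//.
  exact: probability_setT (prefix_law nu 0).
rewrite cylinder_law_tail; last exact: cylinder_box.
rewrite big_nat_recl//= -(ih (fun k => B k.+1))//.
transitivity (\int[nu]_y ((\1_(B 0%N) y)%:E * cylinder_law nu (box n (fun k => B k.+1)))).
  apply: eq_integral => y _; rewrite indicE.
  have [/set_mem By|/negP yB] := boolP (y \in B 0%N).
    rewrite mul1e; congr cylinder_law; apply/seteqP; split => x /= Bx k kn.
      by apply: (Bx k.+1).
    by case: k kn => [|k] kn //=; exact: Bx.
  rewrite mul0e (_ : tail_at _ y = set0).
    by rewrite (@cylinder_lawE _ _ _ nu 0) ?measure0// => x x' _.
  by apply/seteqP; split => // x /= /(_ 0%N isT)/mem_set.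
rewrite ge0_integralZr//.
- by rewrite integral_indic ?setIT//; exact: mB.
- by apply: measurable_indicE; exact: mB.
- by case/andP: (cylinder_law01 nu (cylinder_box n (fun k => mB k.+1))).
Qed.

Definition iid_coord (k : nat) (x : iid_space Y) : Y := (x : nat -> Y) k.

Lemma measurable_iid_coord k : measurable_fun setT (iid_coord k).
Proof.
move=> _ B mB; rewrite setTI; apply: sub_sigma_algebra; split.
  by apply: sub_sigma_algebra; exists k, B.
by exists k.+1 => x x' xx'; rewrite /iid_coord /= xx'.
Qed.

HB.instance Definition _ k := isMeasurableFun.Build _ _ _ _ (iid_coord k)
  (measurable_iid_coord k).

Lemma iid_independent (J : seq nat) (B : nat -> set Y) : uniq J ->
  (forall k, measurable (B k)) ->
  iid_law nu (\big[setI/setT]_(k <- J) (iid_coord k @^-1` B k)) =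
  \prod_(k <- J) nu (B k).
Proof.
move=> uJ mB.
(* Coordinates outside [J] are left free, so that the event becomes a box over an initial
   segment. *)
pose C k := if k \in J then B k else setT.
have mC k : measurable (C k) by rewrite /C; case: ifP.
pose n := (\max_(k <- J) k).+1.
have Jn k : k \in J -> (k < n)%N by move=> kJ; rewrite ltnS leq_bigmax_seq.
have -> : \big[setI/setT]_(k <- J) (iid_coord k @^-1` B k) = box n C.
  rewrite -bigcap_seq; apply/seteqP; split => x /=.
    by move=> Bx k kn; rewrite /C; case: ifP => // kJ; exact: (Bx k kJ).
  by move=> Cx k /= kJ; have := Cx k (Jn k kJ); rewrite /C kJ.
rewrite iid_lawE; last exact: cylinder_box.
rewrite cylinder_law_box//.
rewrite -(big_rmcond_in (fun k => k \in J)) /=; last first.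
  by move=> k _ kJ; rewrite /C (negbTE kJ); exact: probability_setT.
rewrite -big_filter (perm_big J); last first.
  apply: uniq_perm => //; first by rewrite filter_uniq ?iota_uniq.
  move=> k; rewrite mem_filter mem_index_iota /=; case: (boolP (k \in J)) => //= kJ.
  exact: Jn.
by rewrite big_seq [RHS]big_seq; apply: eq_bigr => k kJ; rewrite /C kJ.
Qed.

End iid_independence.

Section iid_families.
Context d (Y : measurableType d) (R : realType) (nu : probability Y R).

Lemma iid_coord_law k B : measurable B ->
  iid_law nu (@iid_coord _ Y k @^-1` B) = nu B.
Proof.
move=> mB.
have := @iid_independent _ Y R nu [:: k] (fun=> B) isT (fun=> mB).
by rewrite !big_seq1.
Qed.

(** Variables that read distinct coordinates are independent, whatever part of its coordinate each
    one uses. *)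
Lemma iid_coord_independent (I : eqType) (e : I -> nat)
    (F : I -> set (set (iid_space Y))) : injective e ->
  (forall i E, F i E ->
     exists2 B, measurable B & E = @iid_coord _ Y (e i) @^-1` B) ->
  mutually_independent (iid_law nu) F.
Proof.
move=> inj_e FE J E uJ FEi.
(* The sets are reindexed by coordinate, which is unambiguous as [e] is injective; coordinates that
   no index uses get the whole space. *)
have /choice[B mBE] : forall n, exists B, measurable B /\
    forall i, e i = n -> E i = @iid_coord _ Y n @^-1` B.
  move=> n; have [[i ei]|ni] := pselect (exists i, e i = n).
    have [B mB EB] := FE _ _ (FEi i); exists B; split => // j ej.
    by rewrite -ei; have -> : j = i by apply: inj_e; rewrite ei ej.
  by exists setT; split => // i ei; case: ni; exists i.
have mB n : measurable (B n) by case: (mBE n).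
have EB i : E i = @iid_coord _ Y (e i) @^-1` B (e i) by case: (mBE (e i)) => _ ->.
transitivity (iid_law nu (\big[setI/setT]_(n <- map e J) (@iid_coord _ Y n @^-1` B n))).
  by congr (iid_law nu _); rewrite big_map; apply: eq_bigr => i _; exact: EB.
rewrite iid_independent ?map_inj_uniq// big_map.
by apply: eq_bigr => i _; rewrite EB; exact/esym/iid_coord_law.
Qed.

Lemma g_sigma_algebra_preimage_iid_coord d' (W : measurableType d') (g : Y -> W) k
    (V : iid_space Y -> W) E : measurable_fun setT g ->
  (forall x, V x = g (@iid_coord _ Y k x)) ->
  g_sigma_algebra_preimage V E ->
  exists2 B, measurable B & E = @iid_coord _ Y k @^-1` B.
Proof.
move=> mg VE [D mD <-]; exists (g @^-1` D).
  by rewrite -[X in measurable X]setTI; exact: mg.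
by rewrite setTI; apply/seteqP; split => x /=; rewrite VE.
Qed.

End iid_families.

(** * Existence of the compound representation *)

Section jump_law.
Context (R : realType) (q upsilon : nat) (G : R.-pker 'R[R]^q ~> 'R[R]^upsilon)
  (rho : {sigma_finite_measure set 'R[R]^q -> \bar R}).
Hypotheses (rho_orthant : rho (~` orthant R q) = 0)
  (phi_gt0 : 0 < varphi G rho) (phi_fin : varphi G rho < +oo).

Local Notation O := (zerov R upsilon).
Local Notation YHX := ('R[R]^q * 'R[R]^upsilon)%type.

Let c := fine (varphi G rho).

Let cE : c%:E = varphi G rho.
Proof. by rewrite fineK// ge0_fin_numE// ltW. Qed.

Let c_gt0 : (0 < c)%R. Proof. by rewrite -lte_fin cE. Qed.

Let mO : measurable (~` [set O]).
Proof. by apply: measurableC; exact: measurable_zerov. Qed.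

Let mdirac (s : 'R[R]^q) S : measurable S ->
  measurable_fun setT (fun a : 'R[R]^upsilon => \d_((s, a) : YHX) S : \bar R).
Proof.
move=> mS; apply: (measurableT_comp (measurable_fun_dirac mS)).
exact: measurable_fun_pair.
Qed.

Let nonzero_jump (s : 'R[R]^q) : {measure set YHX -> \bar R} :=
  mixture (G s) (measurable_indicE (R := R) mO) (indic01 R (~` [set O])) (@mdirac s).

Let measurable_nonzero_jump S : measurable S ->
  measurable_fun setT (nonzero_jump ^~ S).
Proof.
move=> mS; apply: (measurable_integral_kprecomp G (h := idfun)
  (k := fun sa : 'R[R]^q * 'R[R]^upsilon =>
          (\1_(~` [set O]) sa.2)%:E * \d_sa S)).
- exact: measurable_id.
- apply: emeasurable_funM; last exact: measurable_fun_dirac.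
  by apply: (measurableT_comp (measurable_indicE (R := R) mO)); exact: measurable_snd.
- by move=> sa; rewrite mule_ge0// lee_fin.
Qed.

Let nonzero_jumpX s D C : measurable D -> measurable C ->
  nonzero_jump s (D `*` C) = (\1_D s)%:E * G s (C `\` [set O]).
Proof.
move=> mD mC.
have mCO : measurable (C `\` [set O]).
  by apply: measurableD => //; exact: measurable_zerov.
have m1 : measurable_fun setT (fun a => (\1_(C `\` [set O]) a)%:E : \bar R).
  exact: measurable_indicE.
have D0 : 0 <= (\1_D s)%:E :> \bar R by rewrite lee_fin.
have C0 (a : 'R[R]^upsilon) : 0 <= (\1_(C `\` [set O]) a)%:E :> \bar R by rewrite lee_fin.
have <- : \int[G s]_a (\1_(C `\` [set O]) a)%:E = G s (C `\` [set O]).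
  by rewrite integral_indic// setIT.
rewrite -(ge0_integralZl (G s) measurableT m1 (fun a _ => C0 a) D0).
apply: eq_integral => a _; rewrite /= diracE -!EFinM; congr (_%:E).
rewrite setDE indicI /= !indicE in_setX /=.
by case: (s \in D); case: (a \in C) => /=; rewrite ?(mulr0, mul0r, mul1r, mulr1).
Qed.

Let one01 (s : 'R[R]^q) : 0 <= (cst 1 s : \bar R) <= 1.
Proof. by rewrite /= lee01 lexx. Qed.

Let ci0 : (0 <= c^-1)%R. Proof. by rewrite invr_ge0 ltW. Qed.

(** The joint law [I{a <> 0} G(da | s) rho(ds) / varphi]: the factor [pi_A(s)] of the location law
    and the denominator of the conditional law have cancelled, so nothing is divided by a possibly
    vanishing [pi_A]. *)
Let jump_measure : set YHX -> \bar R :=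
  mscale (NngNum ci0) (mixture rho (measurable_cst (1 : \bar R)) one01
    measurable_nonzero_jump).

HB.instance Definition _ := Measure.on jump_measure.

Let jump_measureX D C : measurable D -> measurable C ->
  jump_measure (D `*` C) =
  (c^-1)%:E * \int[rho]_s ((\1_D s)%:E * G s (C `\` [set O])).
Proof.
move=> mD mC; rewrite /jump_measure /mscale /= /mixture; congr (_ * _).
by apply: eq_integral => s _; rewrite mul1e nonzero_jumpX.
Qed.

Let jump_measure_setT : jump_measure setT = 1.
Proof.
rewrite -setXTT jump_measureX//.
under eq_integral do rewrite indicT mul1e setTD -pi_AE.
by rewrite -varphiE// -cE -EFinM mulVf// gt_eqF.
Qed.

Definition jump_law : probability YHX R := HB.pack_for (probability YHX R)
  jump_measure (Measure_isProbability.Build _ _ _ jump_measure jump_measure_setT).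

Let jump_lawX D C : measurable D -> measurable C ->
  jump_law (D `*` C) =
  (c^-1)%:E * \int[rho]_s ((\1_D s)%:E * G s (C `\` [set O])).
Proof. exact: jump_measureX. Qed.

(** Both laws are read off on rectangles; for the location, the second side is the whole space,
    whose nonzero part has mass [pi_A]. *)
Lemma is_jump_pair_jump_law (dT : measure_display) (T : measurableType dT)
    (P : probability T R)
    (H : {mfun T >-> 'R[R]^q}) (X : {mfun T >-> 'R[R]^upsilon}) :
  (forall S, measurable S -> P [set t | S (H t, X t)] = jump_law S) ->
  is_jump_pair G rho P H X.
Proof.
move=> lawHX.
have lawX D C : measurable D -> measurable C ->
    P (H @^-1` D `&` X @^-1` C) = jump_law (D `*` C).
  by move=> mD mC; rewrite -lawHX//; exact: measurableX.
have pi0 s : 0 <= (pi_A G s)%:E by case/andP: (pi_A01 G s).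
have law_location D : measurable D -> distribution P H D =
    \int[rho]_(s in D `&` orthant R q) ((pi_A G s)%:E * (c^-1)%:E).
  move=> mD; have := lawX D setT mD measurableT.
  rewrite preimage_setT setIT jump_lawX// => lawD; rewrite [LHS]lawD.
  rewrite setIC integral_mkcondr epatch_indic integral_orthant//; last 2 first.
  - apply: emeasurable_funM; last exact: measurable_indicE.
    by apply: emeasurable_funM => //; exact: measurable_pi_A.
  - by move=> s; rewrite !mule_ge0// lee_fin.
  rewrite -ge0_integralZl//; last first.
  - apply: emeasurable_funM; first exact: measurable_indicE.
    apply: measurable_kernel; apply: measurableD => //; exact: measurable_zerov.
  apply: eq_integral => s _.
  by rewrite setTD -pi_AE [RHS]muleC muleCA [in RHS](muleC (pi_A G s)%:E) muleCA.
split=> // D C mD mC.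
have := integral_jump_location_kernel rho_orthant phi_gt0 phi_fin law_location mD mC.
move=> /(congr1 (fun x => (c^-1)%:E * x)).
rewrite muleA -EFinM mulVf ?gt_eqF// mul1e => ->.
by rewrite lawX// jump_lawX.
Qed.

End jump_law.

Section existence.
Context (R : realType) (q upsilon : nat) (d : measure_display)
  (Omega : measurableType d) (G : R.-pker 'R[R]^q ~> 'R[R]^upsilon)
  (rho : {sigma_finite_measure set 'R[R]^q -> \bar R})
  (B0 : probability Omega R).
Hypotheses (rho_orthant : rho (~` orthant R q) = 0)
  (phi_gt0 : 0 < varphi G rho) (phi_fin : varphi G rho < +oo).

Local Notation YHX := ('R[R]^q * 'R[R]^upsilon)%type.
Local Notation Y := (YHX * (Omega * nat))%type.

Let lawHX : probability YHX R := jump_law rho_orthant phi_gt0 phi_fin.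

Let lawxi : probability nat R := poisson_prob (fine (varphi G rho)) 0%N.

(** Every coordinate carries a jump pair, a location and a count; each variable reads one component
    and ignores the others. *)
Let nu : probability Y R := (lawHX \x (B0 \x lawxi)).

Let nuX A B U : measurable A -> measurable B -> measurable U ->
  nu (A `*` (B `*` U)) = lawHX A * (B0 B * lawxi U).
Proof.
move=> mA mB mU; have mBU := measurableX mB mU.
transitivity (lawHX A * (B0 \x lawxi) (B `*` U)); first exact: product_measure1E.
by congr (_ * _); exact: product_measure1E.
Qed.

(** An injective code gives the count, each jump pair and each location a coordinate of its own. *)
Let e (i : option (nat + nat)) : nat := pickle i.

Let inj_e : injective e. Proof. exact: pcan_inj pickleK. Qed.

Let coord i : {mfun iid_space Y >-> Y} := iid_coord (e i).

Let mcomp d' (W : measurableType d') (g : Y -> W) i :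
  measurable_fun setT g -> measurable_fun setT (g \o coord i).
Proof. by move=> mg; exact: measurableT_comp. Qed.

Let mHX : measurable_fun setT (fun y : Y => y.1). Proof. exact: measurable_fst. Qed.

Let mH : measurable_fun setT (fun y : Y => y.1.1).
Proof. by apply: (measurableT_comp _ mHX); exact: measurable_fst. Qed.

Let mX : measurable_fun setT (fun y : Y => y.1.2).
Proof. by apply: (measurableT_comp _ mHX); exact: measurable_snd. Qed.

Let mw : measurable_fun setT (fun y : Y => y.2.1).
Proof. by apply: (measurableT_comp measurable_fst); exact: measurable_snd. Qed.

Let mxi : measurable_fun setT (fun y : Y => y.2.2).
Proof. by apply: (measurableT_comp measurable_snd); exact: measurable_snd. Qed.

Let pack d' (W : measurableType d') (g : iid_space Y -> W)
    (mg : measurable_fun setT g) : {mfun iid_space Y >-> W} :=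
  HB.pack_for {mfun iid_space Y >-> W} g (isMeasurableFun.Build _ _ _ _ g mg).

Let xi := pack (mcomp None mxi).
Let H k := pack (mcomp (Some (inl k)) mH).
Let X k := pack (mcomp (Some (inl k)) mX).
Let w k := pack (mcomp (Some (inr k)) mw).

Let coord_law i B : measurable B -> iid_law nu (coord i @^-1` B) = nu B.
Proof. exact: iid_coord_law. Qed.

Let nuHX S : measurable S -> nu [set y | S y.1] = lawHX S.
Proof.
move=> mS; rewrite (_ : [set y | S y.1] = S `*` (setT `*` setT)); last first.
  by apply/seteqP; split => y //= [].
rewrite nuX//.
have -> : B0 setT = 1 by exact: probability_setT.
have -> : lawxi setT = 1 by exact: probability_setT.
by rewrite !mule1.
Qed.

Let nuw B : measurable B -> nu [set y | B y.2.1] = B0 B.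
Proof.
move=> mB; rewrite (_ : [set y | B y.2.1] = setT `*` (B `*` setT)); last first.
  by apply/seteqP; split => y //= [] ? [].
rewrite nuX//.
have -> : lawHX setT = 1 by exact: probability_setT.
have -> : lawxi setT = 1 by exact: probability_setT.
by rewrite mule1 mul1e.
Qed.

Let nuxi U : nu [set y | U y.2.2] = lawxi U.
Proof.
rewrite (_ : [set y | U y.2.2] = setT `*` (setT `*` U)); last first.
  by apply/seteqP; split => y //= [] ? [].
rewrite nuX//.
have -> : lawHX setT = 1 by exact: probability_setT.
have -> : B0 setT = 1 by exact: probability_setT.
by rewrite !mul1e.
Qed.

Let preimage_coord d' (W : measurableType d') (g : Y -> W)
    (V : iid_space Y -> W) i E : measurable_fun setT g ->
  (forall x, V x = g (coord i x)) -> g_sigma_algebra_preimage V E ->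
  exists2 B, measurable B & E = coord i @^-1` B.
Proof. exact: g_sigma_algebra_preimage_iid_coord. Qed.

(** Kept generic in [g] because it is used twice: for the jumps alone, and for the pairs of location
    and jump. *)
Let algebras_independent d' (W : measurableType d') (g : Y -> W)
    (V : nat -> iid_space Y -> W) : measurable_fun setT g ->
  (forall k x, V k x = g (coord (Some (inl k)) x)) ->
  mutually_independent (iid_law nu) (compound_algebras xi V w).
Proof.
move=> mg VE; apply: (@iid_coord_independent _ Y R nu _ e _ inj_e) => -[[k|k]|] E.
- exact: (preimage_coord mg (VE k)).
- exact: (preimage_coord mw).
- exact: (preimage_coord mxi).
Qed.

Lemma compound_data_exists :
  exists (d1 : measure_display) (T1 : measurableType d1)
    (P1 : probability T1 R) (xi : {mfun T1 >-> nat})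
    (H : nat -> {mfun T1 >-> 'R[R]^q})
    (X : nat -> {mfun T1 >-> 'R[R]^upsilon})
    (w : nat -> {mfun T1 >-> Omega}),
    compound_data G rho B0 P1 xi H X w /\
    mutually_independent P1 (compound_algebras xi (fun k t => (H k t, X k t)) w).
Proof.
exists _, (iid_space Y), (iid_law nu), xi, H, X, w; split; last first.
  by apply: (algebras_independent mHX) => k x /=; case: (coord _ x).1.
split.
- move=> U; rewrite -nuxi -(coord_law None)//.
  by rewrite -[X in measurable X]setTI; exact: mxi.
- move=> k; apply: (is_jump_pair_jump_law (rho_orthant := rho_orthant) (phi_gt0 := phi_gt0)
    (phi_fin := phi_fin)) => S mS.
  rewrite -[RHS]nuHX// -(coord_law (Some (inl k))).
    congr (iid_law nu _); apply/seteqP.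
    by split => x /=; case: (coord _ x).1.
  by rewrite -[X in measurable X]setTI; exact: mHX.
- apply: (@iid_coord_independent _ Y R nu _ (fun k => e (Some (inl k)))) =>
    [k k' /inj_e[]//|k E].
  by apply: (preimage_coord mHX) => x /=; case: (coord _ x).1.
- move=> k B mB; rewrite -nuw// -(coord_law (Some (inr k)))//.
  by rewrite -[X in measurable X]setTI; exact: mw.
- exact: (algebras_independent mX).
Qed.

End existence.

(** The universal half identifies the law for any compound data; the existential half shows that
    such data exist, with the pairs [(H k, X k)] jointly independent of the count and of the
    locations. *)
Theorem proposition5p3 (R : realType) (q upsilon : nat)
  (q_gt0 : (0 < q)%N) (upsilon_gt0 : (0 < upsilon)%N)
  (Omega : ptopologicalType) (polish_Omega : polish R Omega)
  (B0 : probability (borel Omega) R)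
  (rho : {sigma_finite_measure set 'R[R]^q -> \bar R})
  (rho_conc : rho (~` (orthant R q `\` [set zerov R q])) = 0)
  (rho_levy : \int[rho]_(s in orthant R q)
     (Num.min (\sum_(j < q) tnth s j)%R 1%R)%:E < +oo)
  (calA : set 'R[R]^upsilon) (mcalA : measurable calA)
  (G : R.-pker 'R[R]^q ~> 'R[R]^upsilon)
  (G_calA : forall s, orthant R q s -> G s calA = 1)
  (G_zero : forall s, orthant R q s -> 0 < G s [set zerov R upsilon])
  (dT : measure_display) (T : measurableType dT) (P : probability T R)
  (Z : T -> 'I_upsilon -> set (borel Omega) -> \bar R)
  (Z_IBP : is_IBP G rho B0 P Z)
  (varphi_gt0 : 0 < varphi G rho)
  (varphi_fin : varphi G rho < +oo) :
  (exists (d1 : measure_display) (T1 : measurableType d1)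
     (P1 : probability T1 R) (xi : {mfun T1 >-> nat})
     (H : nat -> {mfun T1 >-> 'R[R]^q})
     (X : nat -> {mfun T1 >-> 'R[R]^upsilon})
     (w : nat -> {mfun T1 >-> borel Omega}),
     [/\ compound_data G rho B0 P1 xi H X w,
         mutually_independent P1
           (compound_algebras xi (fun k t => (H k t, X k t)) w)
       & same_law P Z P1 (compound_sum xi X w)]) /\
  (forall (d1 : measure_display) (T1 : measurableType d1)
     (P1 : probability T1 R) (xi : {mfun T1 >-> nat})
     (H : nat -> {mfun T1 >-> 'R[R]^q})
     (X : nat -> {mfun T1 >-> 'R[R]^upsilon})
     (w : nat -> {mfun T1 >-> borel Omega}),
     compound_data G rho B0 P1 xi H X w ->
     same_law P Z P1 (compound_sum xi X w)).
Proof.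
have rho_orthant : rho (~` orthant R q) = 0.
  apply/eqP; rewrite eq_le measure_ge0 andbT -rho_conc le_measure ?inE//.
  - by apply: measurableC; exact: measurable_orthant.
  - apply: measurableC; apply: measurableD; first exact: measurable_orthant.
    exact: measurable_zerov.
  - by apply: subsetC; exact: subDsetl.
have compound_law (d1 : measure_display) (T1 : measurableType d1)
    (P1 : probability T1 R) (xi : {mfun T1 >-> nat})
    (H : nat -> {mfun T1 >-> 'R[R]^q}) (X : nat -> {mfun T1 >-> 'R[R]^upsilon})
    (w : nat -> {mfun T1 >-> borel Omega}) :
    compound_data G rho B0 P1 xi H X w ->
    same_law P Z P1 (compound_sum xi X w).
  by move=> data; exact: (IBP_compound_same_law rho_orthant Z_IBP varphi_gt0
    varphi_fin data).
split=> //.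
have [d1 [T1 [P1 [xi [H [X [w [data indep]]]]]]]] :=
  compound_data_exists B0 rho_orthant varphi_gt0 varphi_fin.
exists d1, T1, P1, xi, H, X, w; split=> //.
exact: (compound_law _ _ _ _ H).
Qed.
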